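(* Let $\gamma\in(\frac23,1)$ and assume that $J(x)\sim|x|^{-(1+\gamma)}$ as $|x|\to\infty$. Then there exists a constant $c>0$ such that for any $\rho\in(0,1)$, $$\lim_{T\to\infty}\mathbb P\bigg[\frac{Z^{Y,\mathrm c}_{\beta_0,T}}{z^{\mathrm c}_{\beta_0,T}}\ \ge\ T^{-c\rho}\bigg]=0.$$
   Context: Standing setup (Random Walk Pinning Model). $J:\mathbb Z\to[0,\infty)$ is symmetric, satisfies $\sum_{x\in\mathbb Z}J(x)=1$, and is a non-increasing function of $|x|$; moreover $J(x)=\varphi(|x|)(1+|x|)^{-(1+\gamma)}$ with $\gamma\in(0,1)$ and $\varphi$ slowly varying at infinity. $W=(W_t)_{t\ge0}$ is the continuous-time random walk on $\mathbb Z$ started at $0$ with jump rate $1$ and jump distribution $J$; its law is denoted $\mathrm P$ (expectation $\mathrm E$). It is transient. For $\rho\in[0,1)$, let $X_t=W^{(1)}_{(1-\rho)t}$ and $Y_t=W^{(2)}_{\rho t}$, where $W^{(1)},W^{(2)}$ are independent copies of $W$. The law of $X$ is denoted $\mathbf P$ (expectation $\mathbf E$) and the law of $Y$ is denoted $\mathbb P$ (expectation $\mathbb E$). For $\beta>0$, $T>0$, the constrained partition function and its homogeneous counterpart are $$Z^{Y,\mathrm c}_{\beta,T}:=\beta\,\mathbf E\Big[e^{\beta\int_0^T\mathbf 1_{\{X_t=Y_t\}}\,dt}\mathbf 1_{\{X_T=Y_T\}}\Big],\qquad z^{\mathrm c}_{\beta,T}:=\beta\,\mathrm E\Big[e^{\beta\int_0^T\mathbf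 1_{\{W_s=0\}}\,ds}\mathbf 1_{\{W_T=0\}}\Big],$$ so that $\mathbb E[Z^{Y,\mathrm c}_{\beta,T}]=z^{\mathrm c}_{\beta,T}$. Set $\beta_0:=\big(\int_0^\infty \mathrm P(W_t=0)\,dt\big)^{-1}\in(0,\infty)$. *)

(* Defs.v *)
From HB Require Import structures.
From mathcomp Require Import all_boot all_order all_algebra.
From mathcomp Require Import all_classical all_reals all_analysis.
Set Implicit Arguments.
Unset Strict Implicit.
Unset Printing Implicit Defensive.
Import Order.TTheory GRing.Theory Num.Theory.
Import numFieldNormedType.Exports.
Local Open Scope classical_set_scope.
Local Open Scope ring_scope.

Section kernel.
Context {R : realType}.
Implicit Types (phi : R -> R) (J : int -> R) (gamma : R).

Definition slowly_varying phi : Prop :=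
  (exists A : R, measurable_fun `[A, +oo[ phi /\
                 forall x, A <= x -> 0 < phi x) /\
  (forall a : R, 0 < a -> phi (a * x) / phi x @[x --> +oo] --> (1 : R)).

Definition absr (x : int) : R := `|x|%:~R.

Record jump_kernel gamma J : Prop := JumpKernel {
  jump_ge0 : forall x, 0 <= J x ;
  jump_sym : forall x : int, J (- x) = J x ;
  jump_sum1 : (\esum_(x in [set: int]) (J x)%:E = 1)%E ;
  jump_noninc : forall x y : int, `|x| <= `|y| -> J y <= J x ;
  jump_regular : exists2 phi, slowly_varying phi &
    forall x, J x = phi (absr x) * (1 + absr x) `^ (- (1 + gamma)) }.

(* f(x) ~ g(x) as |x| --> oo *)
Definition equiv_at_infinity (f g : int -> R) : Prop :=
  forall e : R, 0 < e ->
    \forall n \near \oo, forall x : int, `|x|%N = n -> `|f x / g x - 1| < e.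

End kernel.

Section random_walk.
Context {R : realType} {d : measure_display} {Omega : measurableType d}.
Variable P : probability Omega R.

Definition independent_events (I : eqType) (E : I -> set Omega) : Prop :=
  forall s : seq I, uniq s ->
    (P (\bigcap_(i in [set` s]) E i) = \prod_(i <- s) P (E i))%E.

(* The increments are required to be Poisson only for s < t because
   [poisson_pmf 0 k = 1] for all k. *)
Record rate1_poisson_counter (N : R -> Omega -> nat) : Prop := PoissonCounter {
  counter_meas : forall (t : R) n, 0 <= t -> measurable (N t @^-1` [set n]) ;
  counter_start : forall w, N 0 w = 0%N ;
  counter_mono : forall (s t : R) w, 0 <= s -> s <= t -> (N s w <= N t w)%N ;
  counter_rcont : forall (t : R) w, 0 <= t -> \forall s \near t^'+, N s w = N t w ;
  counter_law : forall (s t : R) k, 0 <= s -> s < t ->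
    P [set w | (N t w - N s w)%N = k] = (poisson_pmf (t - s) k)%:E }.

Record steps_with_law (J : int -> R) (xi : nat -> Omega -> int) : Prop :=
  StepsWithLaw {
  step_meas : forall j x, measurable (xi j @^-1` [set x]) ;
  step_law : forall j x, P (xi j @^-1` [set x]) = (J x)%:E }.

(* All the increments of N over successive intervals and all the steps xi are
   mutually independent: N has independent increments, the steps are
   independent, and N is independent of the steps. *)
Definition independent_increments_steps
    (N : R -> Omega -> nat) (xi : nat -> Omega -> int) : Prop :=
  forall (t : nat -> R) (k : nat -> nat) (x : nat -> int),
    0 <= t 0%N -> (forall i, t i <= t i.+1) ->
    independent_events (fun ij : nat + nat =>
      match ij with
      | inl i => [set w | (N (t i.+1) w - N (t i) w)%N = k i]
      | inr j => [set w | xi j w = x j]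
      end).

(* N t is the number of jumps up to time t, and xi j is the (j+1)-st jump. *)
Definition random_walk (J : int -> R) (W : R -> Omega -> int) : Prop :=
  exists (N : R -> Omega -> nat) (xi : nat -> Omega -> int),
    [/\ rate1_poisson_counter N,
        steps_with_law J xi,
        independent_increments_steps N xi &
        forall (t : R) w, 0 <= t -> W t w = \sum_(j < N t w) xi j w].

End random_walk.

Section pinning.
Context {R : realType} {d : measure_display} {Omega : measurableType d}.
Variable P : probability Omega R.
Local Notation leb := (@lebesgue_measure R).

Definition overlap (T : R) (x y : R -> int) : R :=
  \int[leb]_(t in `[0, T]) (x t == y t)%:R.

(* The expectation is over the process X only; the path y is frozen. *)
Definition pinned_partition_function (beta T : R) (X : R -> Omega -> int)
    (y : R -> int) : R :=
  beta * fine ('E_P[(fun w =>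
    expR (beta * overlap T (X ^~ w) y) * (X T w == y T)%:R)%R])%E.

Definition homogeneous_partition_function (beta T : R)
    (W : R -> Omega -> int) : R :=
  pinned_partition_function beta T W (fun=> 0).

Definition beta0 (W : R -> Omega -> int) : R :=
  (\int[leb]_(t in `[0, +oo[) fine (P [set w | W t w = 0]))^-1.

End pinning.

(* Main.v *)
Require Import Defs.
From HB Require Import structures.
From mathcomp Require Import all_boot all_order all_algebra.
From mathcomp Require Import all_classical all_reals all_analysis.
From mathcomp Require Import measurable_realfun.
From mathcomp Require Import ring lra zify.
Set Implicit Arguments.
Unset Strict Implicit.
Unset Printing Implicit Defensive.
Import Order.TTheory GRing.Theory Num.Theory.
Import numFieldNormedType.Exports.
Local Open Scope classical_set_scope.
Local Open Scope ring_scope.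

(* The ratio [Z / z] is small in probability by a change of measure for [Y]: if the
   tilt [F] is such that [E (F Z) / z] is small and [E (1 / F)] is not large, then
   [Z / z] is small, since [2 sqrt (Z / z) <= lambda F Z / z + 1 / (lambda F)]. At
   time [t], the jumps of [Y] that are larger than [H t^(1 / gamma)] get their rate
   multiplied by [1 + kappa]. Such jumps make the return of [X - Y] to the origin less
   likely by a factor [1 - c kappa rho] over each dyadic time scale, so that the tilted
   mean [E (F Z)] is at most [T^(- c kappa rho) z], while [E (1 / F)] is at most
   [T^(C kappa^2 rho)]; a small [kappa] then suffices.

   The time axis is discretised with a mesh [delta] tending to [0], the exponential
   of the overlap being replaced by a product of factors [1 + beta delta 1_(X = Y)].
   The expectations then solve discrete renewal equations, and at [beta0] the
   homogeneous one has an interarrival law of total mass [1] with tail [t^(-a)],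
   [a = 1 / gamma - 1]. The renewal density is comparable to [t^(a - 1)]: it is
   quasi-monotone because its even terms are log-convex (by Cauchy-Schwarz, for the
   convolution of the pinned path densities) and bounded. The decay of the tilted
   renewal density follows by comparison with a supersolution. *)

(** All estimates on the grid have to be uniform in [delta]. The discretised interarrival law has
    mass at most [1], but its defect may be of order [delta], so its tail mass is of order [t^(-a)]
    only while [delta <= t^(-a)]. Hence the horizon [S]: it is fixed as a multiple of [T], and the
    mesh is taken small in terms of it.

    The tilted law varies with time, so its renewal equation has kernels depending on both times and
    is out of reach of transform methods. It can only be compared with the homogeneous one, and this
    needs both renewal bounds: the upper one limits the cost of the supersolution, the lower one
    secures the gain.

    The heat kernel bounds at the origin come from unimodality and mass alone, without
    characteristic functions. Laws live in the semiring of nonnegative extended-real functions under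
    convolution, so that superposing jumps or composing time-dependent steps is algebra without
    summability conditions.

    Gain and cost of the tilt both have exponents proportional to [rho]; [kappa] is thus chosen
    independently of [rho], which makes [c] independent of it. *)

Section esum_facts.
Context {R : realType}.
Local Open Scope ereal_scope.
Implicit Types (T : choiceType).

Lemma esumZl T (c : \bar R) (f : T -> \bar R) : 0 <= c -> (forall i, 0 <= f i) ->
  \esum_(i in [set: T]) (c * f i) = c * \esum_(i in [set: T]) f i.
Proof.
have le_part (d : \bar R) (g : T -> \bar R) : 0 <= d -> (forall i, 0 <= g i) ->
    \esum_(i in [set: T]) (d * g i) <= d * \esum_(i in [set: T]) g i.
  move=> d0 g0; apply: ge_ereal_sup => _ [X [finX _] <-].
  rewrite -ge0_mule_fsumr//; apply: lee_wpmul2l => //.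
  by apply: ereal_sup_ubound; exists X.
case: c => [r| |] // r0 f0; apply/eqP; rewrite eq_le le_part//=.
- have [->|rN0] := eqVneq r 0%R.
    by rewrite mul0e; apply: esum_ge0 => i _; rewrite mul0e.
  have rgt0 : (0 < r)%R by rewrite lt_neqAle eq_sym rN0 -lee_fin.
  (* The converse inequality is the same bound for [r^-1] and [r * f]. *)
  have := le_part (r^-1)%:E (fun i => r%:E * f i).
  rewrite lee_fin invr_ge0 (ltW rgt0) => /(_ isT).
  have -> : (fun i => r^-1%:E * (r%:E * f i)) = f.
    by apply/funext => i; rewrite muleA -EFinM mulVf// mul1e.
  move=> /(_ (fun i => mule_ge0 r0 (f0 i))) h.
  rewrite (le_trans (lee_wpmul2l _ h))// muleA -EFinM mulfV// mul1e.
  exact: lexx.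
- have [fz|] := pselect (forall i, f i = 0).
    by rewrite esum1 ?mule0//; apply: esum_ge0 => i _; rewrite fz mule0.
  move=> /existsNP[i /eqP fi].
  rewrite (@le_trans _ _ +oo) ?leey//.
  apply: esum_ge; exists [set i]; first by split => //; exact: finite_set1.
  rewrite fsbig_set1 gt0_mulye// lt_neqAle eq_sym fi; exact: f0.
Qed.

Lemma esum_swap T1 T2 (f : T1 -> T2 -> \bar R) : (forall i j, 0 <= f i j) ->
  \esum_(i in [set: T1]) \esum_(j in [set: T2]) f i j =
  \esum_(j in [set: T2]) \esum_(i in [set: T1]) f i j.
Proof.
move=> f0; rewrite !esum_esum//.
rewrite (reindex_esum ([set: T2] `*`` fun=> [set: T1]) _ (fun x => (x.2, x.1)))//.
split=> //= [[i j] [i' j'] _ _ [-> ->]//|[i j] _].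
by exists (j, i).
Qed.

Lemma esum_bij T1 T2 (e : T1 -> T2) (f : T2 -> \bar R) : bijective e ->
  \esum_(i in [set: T1]) f (e i) = \esum_(j in [set: T2]) f j.
Proof.
move=> [g eg ge]; rewrite (reindex_esum [set: T1] _ e)//.
split=> //= [i j _ _ /(can_inj eg)//|j _]; by exists (g j).
Qed.

Lemma esum_only T (i0 : T) (f : T -> \bar R) : (forall i, 0 <= f i) ->
  (forall i, i != i0 -> f i = 0) -> \esum_(i in [set: T]) f i = f i0.
Proof.
move=> f0 fz; rewrite (esumID [set i0])// !setTI esum_set1// [X in _ + X]esum1 ?adde0//.
by move=> i /eqP; exact: fz.
Qed.

Lemma esum_nat_le (f : nat -> \bar R) B : (forall n, 0 <= f n) ->
  (forall n, \sum_(i < n) f i <= B) -> \esum_(i in [set: nat]) f i <= B.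
Proof.
move=> f0 fB; rewrite -nneseries_esumT//.
apply: lime_le; first exact: is_cvg_nneseries.
by apply: nearW => n; rewrite big_mkord.
Qed.

Lemma esum_nat_ge (f : nat -> \bar R) n : (forall n, 0 <= f n) ->
  \sum_(i < n) f i <= \esum_(i in [set: nat]) f i.
Proof.
move=> f0; rewrite -nneseries_esumT// -(big_mkord xpredT f).
exact: nneseries_lim_ge.
Qed.

Lemma esum_le_sub T1 T2 (e : T1 -> T2) (f : T2 -> \bar R) : injective e ->
  (forall j, 0 <= f j) ->
  \esum_(i in [set: T1]) f (e i) <= \esum_(j in [set: T2]) f j.
Proof.
move=> ie f0; rewrite -(esum_image [set: T1] e f); last by move=> i j _ _ /ie.
by rewrite esum_mkcond; apply: le_esum => j _; case: ifP.
Qed.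

Lemma esum_int_le (f : int -> \bar R) : (forall x, 0 <= f x) ->
  \esum_(x in [set: int]) f x <=
  \esum_(n in [set: nat]) f n%:Z + \esum_(n in [set: nat]) f (- n%:Z)%R.
Proof.
move=> f0; rewrite (esumID [set x : int | (0 <= x)%R])// !setTI; apply: leeD.
  rewrite (_ : [set x | _] = Posz @` setT).
    by rewrite esum_image//; move=> i j _ _ [].
  by apply/seteqP; split=> [[n|n]//= _|_ [n _ <-]//]; exists n.
rewrite (_ : ~` _ = (fun n => - n%:Z)%R @` [set n | n != 0%N]).
  rewrite esum_image; last by move=> i j _ _ /oppr_inj[].
  by rewrite esum_mkcond; apply: le_esum => j _; case: ifP.
apply/seteqP; split=> [[n|n]//= _|_ [[//|n] _ <-]//].
by exists n.+1.
Qed.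

Lemma esum_pairT T1 T2 (f : T1 * T2 -> \bar R) : (forall i, 0 <= f i) ->
  \esum_(i in [set: T1 * T2]) f i =
  \esum_(i in [set: T1]) \esum_(j in [set: T2]) f (i, j).
Proof.
move=> f0; rewrite esum_esum//; congr (esum _ _).
  by apply/seteqP; split.
by apply/funext => -[].
Qed.

Lemma esum_nat_fin (f : nat -> \bar R) n : (forall n, 0 <= f n) ->
  (forall i, (n <= i)%N -> f i = 0) ->
  \esum_(i in [set: nat]) f i = \sum_(i < n) f i.
Proof.
move=> f0 fz; apply/eqP; rewrite eq_le esum_nat_ge// andbT.
apply: esum_nat_le => // N.
apply: (@le_trans _ _ (\sum_(i < N + n) f i)).
  by rewrite big_split_ord/= leeDl// sume_ge0.
rewrite addnC big_split_ord/= [X in _ + X]big1 ?adde0// => i _.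
by rewrite fz// leq_addr.
Qed.

(** Cauchy product: the inner finite sums are padded with zeros to full sums, so that the two
    summations can be exchanged. *)
Lemma esum_antidiag (f : nat -> nat -> \bar R) : (forall i j, 0 <= f i j) ->
  \esum_(n in [set: nat]) \sum_(i < n.+1) f i (n - i)%N =
  \esum_(i in [set: nat]) \esum_(j in [set: nat]) f i j.
Proof.
move=> f0.
have -> : \esum_(n in [set: nat]) \sum_(i < n.+1) f i (n - i)%N =
    \esum_(n in [set: nat]) \esum_(i in [set: nat])
       (if (i <= n)%N then f i (n - i)%N else 0).
  apply: eq_esum => n _; rewrite (@esum_nat_fin _ n.+1).
  - by apply: eq_bigr => i _; rewrite -ltnS ltn_ord.
  - by move=> i; case: ifP.
  - by move=> i ni; rewrite leqNgt ni.
rewrite esum_swap; last by move=> i j; case: ifP.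
apply: eq_esum => i _.
rewrite (esumID [set n | (i <= n)%N]); last by move=> *; case: ifP.
rewrite !setTI [X in _ + X]esum1 ?adde0; last by move=> n /= /negP/negbTE ->.
rewrite (_ : [set n | _] = (addn i) @` setT).
  rewrite esum_image; last by move=> a b _ _ /addnI.
  by apply: eq_esum => j _; rewrite leq_addr addKn.
apply/seteqP; split=> [n /= ?|_ [n _ <-]/=]; last exact: leq_addr.
by exists (n - i)%N => //; rewrite subnKC.
Qed.
End esum_facts.

(** * The convolution semiring of nonnegative functions on the integers *)

(** Bundling nonnegativity with values in [\bar R] makes convolution total, associative and
    commutative without side conditions, so that these functions form a commutative semiring and
    [bigop] and power lemmas apply to them. *)
Record nnfun (R : realType) := NNFun {
  nnfun_val :> int -> \bar R ; nnfun_ge0 : forall x, (0 <= nnfun_val x)%E }.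

HB.instance Definition _ (R : realType) := gen_eqMixin (nnfun R).
HB.instance Definition _ (R : realType) := gen_choiceMixin (nnfun R).

Section nnfun_semiring.
Context {R : realType}.
Local Notation F := (nnfun R).
Implicit Types f g h : F.
Local Open Scope ereal_scope.

Lemma nnfunP f g : (forall x, f x = g x) -> f = g.
Proof.
move=> fg; have {fg} : f = g :> (int -> \bar R) by apply/funext.
by case: f g => [f f0] [g g0]/= fg; subst g; congr NNFun; exact: Prop_irrelevance.
Qed.

Definition nnadd f g : F := NNFun (fun x => adde_ge0 (nnfun_ge0 f x) (nnfun_ge0 g x)).

Definition nnzero : F := @NNFun R (fun=> 0) (fun=> lexx 0).

Lemma conv_ge0 f g x : 0 <= \esum_(y in [set: int]) (f y * g (x - y)%R).
Proof. by apply: esum_ge0 => y _; apply: mule_ge0; exact: nnfun_ge0. Qed.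

Definition nnconv f g : F := NNFun (conv_ge0 f g).

Lemma pt_ge0 (c : R) (x : int) : 0 <= (if x == 0%R then `|c| else 0%R)%:E :> \bar R.
Proof. by case: ifP; rewrite lee_fin. Qed.

(** Point mass at the origin; multiplying by it is scaling by [c]. The absolute value only serves to
    make it total in [c]. *)
Definition pt (c : R) : F := NNFun (pt_ge0 c).

Lemma nnaddA : associative nnadd.
Proof. by move=> f g h; apply: nnfunP => x /=; rewrite addeA. Qed.

Lemma nnaddC : commutative nnadd.
Proof. by move=> f g; apply: nnfunP => x /=; rewrite addeC. Qed.

Lemma nnadd0 : left_id nnzero nnadd.
Proof. by move=> f; apply: nnfunP => x /=; rewrite add0e. Qed.

Let fg0 f g x y : 0 <= f x * g y.
Proof. by apply: mule_ge0; exact: nnfun_ge0. Qed.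

Lemma nnconvC : commutative nnconv.
Proof.
move=> f g; apply: nnfunP => x /=.
rewrite -(@esum_bij _ _ _ (fun y => x - y)%R); last first.
  by exists (fun y => x - y)%R => y; rewrite subKr.
by apply: eq_esum => y _; rewrite subKr muleC.
Qed.

Lemma nnconvA : associative nnconv.
Proof.
move=> f g h; apply: nnfunP => x /=.
transitivity (\esum_(y in [set: int]) \esum_(z in [set: int])
    (f y * (g (z - y)%R * h (x - z)%R))).
  apply: eq_esum => y _; rewrite esumZl ?nnfun_ge0//.
  congr (_ * _).
  rewrite -(@esum_bij _ _ _ (fun z => z - y)%R); last first.
    by exists (fun z => z + y)%R => z; rewrite ?subrK ?addrK.
  by apply: eq_esum => z _; rewrite opprB addrA [(x - y + y)%R]subrK.
rewrite esum_swap; last by move=> i j; apply: mule_ge0; rewrite ?nnfun_ge0.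
apply: eq_esum => z _; rewrite muleC -esumZl ?nnfun_ge0//.
by apply: eq_esum => y _; rewrite muleA muleC.
Qed.

Lemma nnconv1 : left_id (pt 1) nnconv.
Proof.
move=> f; apply: nnfunP => x /=; rewrite (@esum_only _ _ 0%R).
- by rewrite eqxx normr1 mul1e subr0.
- by move=> i; apply: mule_ge0; rewrite ?nnfun_ge0//; case: ifP; rewrite lee_fin.
- by move=> i /negbTE ->; rewrite mul0e.
Qed.

Lemma nnconvDl : left_distributive nnconv nnadd.
Proof.
move=> f g h; apply: nnfunP => x /=; rewrite -esumD//.
by apply: eq_esum => y _; rewrite ge0_muleDl ?nnfun_ge0.
Qed.

Lemma nnconv0 : left_zero nnzero nnconv.
Proof. by move=> f; apply: nnfunP => x /=; rewrite esum1// => i _; rewrite mul0e. Qed.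

HB.instance Definition _ := GRing.isNmodule.Build F nnaddA nnaddC nnadd0.

HB.instance Definition _ := GRing.Nmodule_isComPzSemiRing.Build F
  nnconvA nnconvC nnconv1 nnconvDl nnconv0.

Lemma nnfunDE f g x : (f + g)%R x = f x + g x. Proof. by []. Qed.
Lemma nnfunME f g x : (f * g)%R x = \esum_(y in [set: int]) (f y * g (x - y)%R).
Proof. by []. Qed.
Lemma nnfun0E x : (0%R : F) x = 0. Proof. by []. Qed.
Lemma nnfun1E x : (1%R : F) x = (if x == 0%R then 1%R else 0%R)%:E.
Proof. by rewrite [LHS]/= normr1. Qed.

Lemma nnfun_sumE I (r : seq I) (G : I -> F) x :
  (\sum_(i <- r) G i)%R x = \sum_(i <- r) G i x.
Proof.
elim: r => [|i r IH]; first by rewrite !big_nil.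
by rewrite !big_cons nnfunDE IH.
Qed.

Lemma ptME (c : R) f x : (0 <= c)%R -> (pt c * f)%R x = c%:E * f x.
Proof.
move=> c0; rewrite nnfunME (@esum_only _ _ 0%R)/=.
- by rewrite ?eqxx ger0_norm// subr0.
- by move=> i; apply: mule_ge0; rewrite ?nnfun_ge0//; case: ifP; rewrite lee_fin.
- by move=> i /negbTE ->; rewrite mul0e.
Qed.

Lemma ptE (c : R) x : (0 <= c)%R -> pt c x = (if x == 0%R then c else 0%R)%:E.
Proof. by move=> c0 /=; rewrite ger0_norm. Qed.

Lemma ptM (c d : R) : (0 <= c)%R -> (0 <= d)%R -> pt (c * d) = (pt c * pt d)%R.
Proof.
move=> c0 d0; apply: nnfunP => x; rewrite ptME// !ptE ?mulr_ge0//.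
by case: ifP => _; rewrite -EFinM ?mulr0.
Qed.

Lemma ptD (c d : R) : (0 <= c)%R -> (0 <= d)%R -> pt (c + d) = (pt c + pt d)%R.
Proof.
move=> c0 d0; apply: nnfunP => x; rewrite nnfunDE !ptE ?addr_ge0//.
by case: ifP => _; rewrite -EFinD ?addr0.
Qed.

Lemma ptX (c : R) n : (0 <= c)%R -> pt (c ^+ n) = (pt c ^+ n)%R.
Proof.
move=> c0; elim: n => [//|n IH]; by rewrite !exprS ptM ?exprn_ge0// IH.
Qed.

Lemma pt_nat (n : nat) : pt n%:R = (n%:R : F)%R.
Proof.
elim: n => [|n IH]; last by rewrite -addn1 !natrD ptD ?ler0n// IH.
by apply: nnfunP => x; rewrite ptE// if_same.
Qed.

Definition total f : \bar R := \esum_(x in [set: int]) f x.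

Lemma total_ge0 f : 0 <= total f.
Proof. by apply: esum_ge0 => x _; exact: nnfun_ge0. Qed.

Lemma totalD f g : total (f + g)%R = total f + total g.
Proof. by rewrite /total -esumD// => x _; exact: nnfun_ge0. Qed.

Lemma totalM f g : total (f * g)%R = total f * total g.
Proof.
rewrite /total esum_swap//.
rewrite muleC -esumZl ?total_ge0 ?nnfun_ge0//; last exact: nnfun_ge0.
apply: eq_esum => y _; rewrite esumZl ?nnfun_ge0//; last by move=> x; exact: nnfun_ge0.
rewrite muleC; congr (_ * _).
by rewrite (@esum_bij _ _ _ (fun x => x - y)%R)//;
  exists (fun x => x + y)%R => x; rewrite ?subrK ?addrK.
Qed.

Lemma total1 : total 1%R = 1.
Proof.
rewrite /total (@esum_only _ _ 0%R) ?nnfun1E ?eqxx// => i; first exact: nnfun_ge0.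
by move=> /negbTE i0; rewrite nnfun1E i0.
Qed.

Lemma totalX f n : total (f ^+ n)%R = total f ^+ n.
Proof.
elim: n => [|n IH]; first by rewrite expr0 total1.
by rewrite exprS totalM IH expeS.
Qed.

Definition even f := forall x, f (- x)%R = f x.

Lemma evenM f g : even f -> even g -> even (f * g)%R.
Proof.
move=> ef eg x; rewrite !nnfunME -(@esum_bij _ _ _ -%R); last by exists -%R; exact: opprK.
by apply: eq_esum => y _; rewrite ef opprK -(eg (- x + y)%R) opprD opprK.
Qed.

Lemma even1 : even 1%R.
Proof. by move=> x; rewrite !nnfun1E oppr_eq0. Qed.

Lemma evenX f n : even f -> even (f ^+ n)%R.
Proof.
move=> ef; elim: n => [|n IH]; first exact: even1.
by rewrite exprS; exact: evenM.
Qed.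

Lemma conv_at0 f g : even g -> (f * g)%R 0%R = \esum_(x in [set: int]) (f x * g x).
Proof. by move=> eg; apply: eq_esum => x _; rewrite sub0r eg. Qed.

End nnfun_semiring.

(** * Compound Poisson laws *)

Section compound.
Context {R : realType}.
Local Notation F := (nnfun R).
Implicit Types f g m : F.
Local Open Scope ereal_scope.

Lemma esum_exp (M : R) : (0 <= M)%R ->
  \esum_(n in [set: nat]) (n`!%:R^-1 * M ^+ n)%:E = (expR M)%:E.
Proof.
move=> M0; rewrite -nneseries_esumT; last first.
  by move=> n; rewrite lee_fin mulr_ge0// ?invr_ge0 ?exprn_ge0.
rewrite (eq_eseriesr (g := fun n => (exp_coeff M n)%:E)); last first.
  by move=> n _; rewrite exp_coeffE mulrC.
have -> : (expR M)%:E = limn (EFin \o series (exp_coeff M)).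
  by rewrite EFin_lim//; exact: is_cvg_series_exp_coeff.
by apply: congr_lim; apply/funext => n /=; rewrite sumEFin.
Qed.

Lemma cp_ge0 m x : 0 <= \esum_(n in [set: nat]) ((n`!%:R^-1)%:E * (m ^+ n)%R x).
Proof.
by apply: esum_ge0 => n _; rewrite mule_ge0 ?nnfun_ge0// lee_fin invr_ge0.
Qed.

(* The unnormalised compound Poisson distribution with jump measure [m], of
   total mass [expR (total m)]. *)
Definition cp m : F := NNFun (cp_ge0 m).

Let cpt m n x : 0 <= (n`!%:R^-1)%:E * (m ^+ n)%R x.
Proof. by rewrite mule_ge0 ?nnfun_ge0// lee_fin invr_ge0. Qed.

Lemma natmulE f n x : (f *+ n)%R x = n%:R%:E * f x.
Proof.
have -> : (f *+ n = pt n%:R * f)%R by rewrite pt_nat mulr_natl.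
by rewrite ptME. Qed.

(** The binomial formula in the convolution semiring makes the exponential series of [f + g] a
    Cauchy product. Probabilistically, independent Poisson streams of jumps superpose. *)
Lemma cpD f g : cp (f + g)%R = (cp f * cp g)%R.
Proof.
apply: nnfunP => x /=.
transitivity (\esum_(n in [set: nat]) \sum_(i < n.+1)
    (fun i j => (j`!%:R^-1 * i`!%:R^-1)%:E * (f ^+ j * g ^+ i)%R x) i (n - i)%N).
  apply: eq_esum => n _; rewrite exprDn nnfun_sumE ge0_sume_distrr; last first.
    by move=> i _; exact: nnfun_ge0.
  apply: eq_bigr => i _; rewrite natmulE muleA -EFinM; congr (_%:E * _).
  have ile : (i <= n)%N by rewrite -ltnS.
  have := bin_fact ile; move/(congr1 (fun k => k%:R : R)).
  rewrite !natrM => <-; field.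
  by rewrite !pnatr_eq0 -!lt0n !fact_gt0 bin_gt0 ile.
rewrite (esum_antidiag (f := fun i j =>
  (j`!%:R^-1 * i`!%:R^-1)%:E * (f ^+ j * g ^+ i)%R x)); last first.
  by move=> i j; rewrite mule_ge0 ?nnfun_ge0// lee_fin mulr_ge0 ?invr_ge0.
rewrite esum_swap; last first.
  by move=> i j; rewrite mule_ge0 ?nnfun_ge0// lee_fin mulr_ge0 ?invr_ge0.
transitivity (\esum_(y in [set: int]) \esum_(j in [set: nat]) \esum_(i in [set: nat])
  ((j`!%:R^-1)%:E * (f ^+ j)%R y * ((i`!%:R^-1)%:E * (g ^+ i)%R (x - y)%R))).
  rewrite [RHS]esum_swap; last by move=> y j; apply: esum_ge0 => i _; exact: mule_ge0.
  apply: eq_esum => j _; rewrite [RHS]esum_swap; last by move=> y i; exact: mule_ge0.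
  apply: eq_esum => i _; rewrite nnfunME -esumZl.
  - by apply: eq_esum => y _; rewrite EFinM -!muleA; congr (_ * _);
      rewrite muleCA.
  - by rewrite lee_fin mulr_ge0 ?invr_ge0.
  - by move=> y; rewrite mule_ge0 ?nnfun_ge0.
apply: eq_esum => y _; rewrite muleC -esumZl; [|exact: cp_ge0|by move=> n; exact: cpt].
apply: eq_esum => j _; rewrite esumZl//; exact: muleC.
Qed.

Lemma cp0 : cp 0%R = 1%R.
Proof.
apply: nnfunP => x; rewrite [LHS](@esum_only _ _ 0%N).
- by rewrite fact0 invr1 mul1e.
- by move=> n; exact: cpt.
- by move=> [//|n] _; rewrite exprS mul0r mule0.
Qed.

Lemma cp_sum I (r : seq I) (G : I -> F) :
  cp (\sum_(i <- r) G i)%R = (\prod_(i <- r) cp (G i))%R.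
Proof. by apply: (big_morph cp cpD cp0). Qed.

Lemma total_cp m (M : R) : (0 <= M)%R -> total m = M%:E ->
  total (cp m) = (expR M)%:E.
Proof.
move=> M0 tm; rewrite /total esum_swap; last exact: (fun x n => cpt m n x).
rewrite -esum_exp//; apply: eq_esum => n _; rewrite esumZl ?lee_fin ?invr_ge0//.
  by rewrite -[X in _ * X]/(total (m ^+ n)%R) totalX tm -EFin_expe.
by move=> x; exact: nnfun_ge0.
Qed.

Lemma even_cp m : even m -> even (cp m).
Proof. by move=> em x; apply: eq_esum => n _; rewrite evenX. Qed.

Definition peaked f := forall x y : int, (`|x| <= `|y|)%R -> f y <= f x.

Lemma peaked_even f : peaked f -> even f.
Proof. by move=> pf x; apply/eqP; rewrite eq_le !pf// normrN. Qed.

Lemma esum_int_split (x : int) (f : int -> \bar R) : (forall x, 0 <= f x) ->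
  \esum_(y in [set: int]) f y = \esum_(k in [set: nat]) f (x - k%:Z)%R +
                                \esum_(k in [set: nat]) f (x + 1 + k%:Z)%R.
Proof.
move=> f0; rewrite (esumID [set y : int | (y <= x)%R])// !setTI; congr (_ + _).
  rewrite (_ : [set y | _] = (fun k : nat => x - k%:Z)%R @` setT).
    by rewrite esum_image// => i j _ _ /addrI /oppr_inj [].
  apply/seteqP; split=> [y /= yx|_ [n _ <-]/=]; last by lia.
  by exists `|(x - y)%R|%N => //; lia.
rewrite (_ : ~` _ = (fun k : nat => x + 1 + k%:Z)%R @` setT).
  by rewrite esum_image// => i j _ _ /addrI [].
apply/seteqP; split=> [y /= /negP yx|_ [n _ <-]/=]; last by apply/negP; lia.
by exists `|(y - x - 1)%R|%N => //; lia.
Qed.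

Lemma rearrangement (a b c e : \bar R) : 0 <= c -> 0 <= e -> c <= a -> e <= b ->
  a * e + c * b <= a * b + c * e.
Proof.
move=> c0 e0 ca eb; have b0 := le_trans e0 eb; have a0 := le_trans c0 ca.
case: c c0 ca => [c| |] // c0 ca; last first.
  have -> : a = +oo by apply/eqP; rewrite eq_le ca leey.
  by rewrite addeC.
have -> : a = c%:E + (a - c%:E) by rewrite addeC subeK.
have ac : 0 <= a - c%:E by rewrite sube_ge0.
rewrite (ge0_muleDl e c0 ac) (ge0_muleDl b c0 ac) addeAC [leRHS]addeAC [X in _ <= X + _]addeC.
by rewrite leeD2l// lee_wpmul2l.
Qed.

(** Convolution preserves symmetric unimodality (a discrete form of Wintner's theorem). To compare
    the values at [n] and [n + 1], the points [n - k] and [n + 1 + k], exchanged by reflection at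
    [n + 1/2], are paired; on each pair the claim is the two-term rearrangement inequality. *)
Lemma peakedM f g : peaked f -> peaked g -> peaked (f * g)%R.
Proof.
move=> pf pg; have ef := peaked_even pf; have eg := peaked_even pg.
have e := evenM ef eg.
have step (n : nat) : (f * g)%R n.+1%:Z <= (f * g)%R n%:Z.
  have fg0 (u : int) (y : int) : 0 <= f y * g (u - y)%R.
    by rewrite mule_ge0 ?nnfun_ge0.
  rewrite !nnfunME (esum_int_split n%:Z (fg0 _)) (esum_int_split n%:Z (fg0 n%:Z)).
  rewrite -!esumD => [|k _|k _|k _|k _]; rewrite ?mule_ge0 ?nnfun_ge0//.
  apply: le_esum => k _.
  have -> : (n.+1%:Z - (n%:Z - k%:Z) = k.+1%:Z)%R by lia.
  have -> : (n.+1%:Z - (n%:Z + 1 + k%:Z) = - k%:Z)%R by lia.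
  have -> : (n%:Z - (n%:Z - k%:Z) = k%:Z)%R by lia.
  have -> : (n%:Z - (n%:Z + 1 + k%:Z) = - k.+1%:Z)%R by lia.
  rewrite !eg; apply: rearrangement; rewrite ?nnfun_ge0//.
    by apply: pf; lia.
  by apply: pg; lia.
have mono (i j : nat) : (f * g)%R (i + j)%N%:Z <= (f * g)%R i%:Z.
  elim: j => [|j IH]; first by rewrite addn0.
  by rewrite addnS; exact: le_trans (step _) IH.
have absE (x : int) : (f * g)%R x = (f * g)%R `|x|%N%:Z.
  by case: (intP x) => // n; rewrite abszN e.
move=> x y xy; rewrite (absE x) (absE y).
have -> : (`|y| = `|x| + (`|y| - `|x|))%N by lia.
exact: mono.
Qed.

Lemma peaked1 : peaked 1%R.
Proof.
move=> x y xy; rewrite !nnfun1E lee_fin; case: ifP => [/eqP y0|_].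
  by have -> : x = 0%R by lia.
by case: ifP.
Qed.

Lemma peakedX f n : peaked f -> peaked (f ^+ n)%R.
Proof.
move=> pf; elim: n => [|n IH]; first exact: peaked1.
by rewrite exprS; exact: peakedM.
Qed.

Lemma peaked_cp m : peaked m -> peaked (cp m).
Proof.
move=> pm x y xy; apply: le_esum => n _; apply: lee_wpmul2l.
  by rewrite lee_fin invr_ge0.
exact: peakedX.
Qed.

(** The points [0, ..., |x|] all carry at least the mass at [x]. *)
Lemma peaked_le f x (B : R) : peaked f -> total f <= B%:E ->
  f x <= (B / (`|x|%N.+1)%:R)%:E.
Proof.
move=> pf tf; rewrite EFinM lee_pdivlMr// muleC.
apply: le_trans tf; apply: (@le_trans _ _ (\sum_(i < `|x|%N.+1) f (Posz i))).
  rewrite [leLHS](_ : _ = \sum_(i < `|x|%N.+1) f x); last first.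
    by rewrite sumr_const card_ord -[RHS]mule_natl.
  apply: lee_sum => i _; apply: pf.
  by have := ltn_ord i; lia.
apply: (@le_trans _ _ (\esum_(k in [set: nat]) f (Posz k))).
  by apply: (esum_nat_ge (f := fun k => f (Posz k))) => n; exact: nnfun_ge0.
by apply: esum_le_sub => [i j []//|j]; exact: nnfun_ge0.
Qed.

Lemma conv_le_peak f g : even g -> peaked f -> (f * g)%R 0%R <= f 0%R * total g.
Proof.
move=> eg pf; rewrite conv_at0// -esumZl ?nnfun_ge0//; last exact: nnfun_ge0.
by apply: le_esum => x _; apply: lee_wpmul2r; rewrite ?nnfun_ge0// pf.
Qed.

(* Keeping only the terms with at most one jump of size in the support of [g]. *)
Lemma conv_cp_gain f g (M : R) : peaked f -> even g -> (0 <= M)%R ->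
  total g = M%:E -> (forall x, g x != 0 -> f x <= (2^-1)%:E * f 0%R) ->
  (f * cp g)%R 0%R + f 0%R * (M / 2)%:E <= f 0%R * (expR M)%:E.
Proof.
move=> pf eg M0 tg fg; rewrite conv_at0; last exact: even_cp.
have -> : \esum_(x in [set: int]) (f x * cp g x) =
    \esum_(n in [set: nat]) ((n`!%:R^-1)%:E * (f * g ^+ n)%R 0%R).
  transitivity (\esum_(x in [set: int]) \esum_(n in [set: nat])
     ((n`!%:R^-1)%:E * (f x * (g ^+ n)%R x))).
    apply: eq_esum => x _; rewrite -esumZl ?nnfun_ge0//.
      by apply: eq_esum => n _; rewrite muleCA.
  rewrite esum_swap; last first.
    by move=> *; rewrite !mule_ge0 ?nnfun_ge0 ?lee_fin ?invr_ge0.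
  apply: eq_esum => n _; rewrite esumZl ?lee_fin ?invr_ge0//.
    by rewrite conv_at0//; exact: evenX.
  by move=> x; rewrite mule_ge0 ?nnfun_ge0.
have f0 : 0 <= f 0%R by exact: nnfun_ge0.
have M2 : 0 <= f 0%R * (M / 2)%:E by rewrite mule_ge0// lee_fin divr_ge0.
(* The whole gain is placed on the term with exactly one jump; every other term is just bounded by
   [f 0 * M ^ n / n!]. *)
pose h (n : nat) := if n == 1%N then f 0%R * (M / 2)%:E else 0.
have h0 n : 0 <= h n by rewrite /h; case: ifP.
have <- : \esum_(n in [set: nat]) h n = f 0%R * (M / 2)%:E.
  by rewrite (@esum_only _ _ 1%N) ?/h// => n /negbTE ->.
rewrite -esumD; [|by move=> n _; rewrite mule_ge0 ?nnfun_ge0// lee_fin invr_ge0|by []].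
rewrite -esum_exp// -esumZl//; last first.
  by move=> n; rewrite lee_fin mulr_ge0 ?invr_ge0 ?exprn_ge0.
apply: le_esum => n _; rewrite /h; have [->|n1] := eqVneq n 1%N.
  rewrite !expr1 (_ : 1`! = 1%N)// invr1 !mul1e mul1r conv_at0//.
  have le_half : \esum_(x in [set: int]) f x * g x <= f 0%R * (M / 2)%:E.
    rewrite [in leRHS]mulrC EFinM muleA [X in X * _]muleC -tg.
    rewrite -esumZl ?nnfun_ge0//; last 2 first.
    - by rewrite mule_ge0// lee_fin invr_ge0.
    - by move=> x; exact: nnfun_ge0.
    apply: le_esum => x _; have [->|gx] := eqVneq (g x) 0.
      by rewrite !mule0.
    by apply: lee_wpmul2r; rewrite ?nnfun_ge0// fg.
  apply: le_trans (leeD le_half (lexx _)) _; rewrite -ge0_muleDr ?lee_fin ?divr_ge0//.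
  by rewrite -EFinD -splitr.
rewrite adde0 EFinM muleCA lee_wpmul2l ?lee_fin ?invr_ge0//.
apply: le_trans (conv_le_peak (evenX _ eg) pf) _.
by rewrite totalX tg -EFin_expe.
Qed.
End compound.

(** * The jump distribution and the heat kernel *)

Section power_inequalities.
Context {R : realType}.
Implicit Types y s a : R.

(** Young's inequality for [y ^ s] and [1] with conjugate exponents [s^-1] and [(1 - s)^-1]. It
    replaces calculus in all the power sums below. *)
Lemma bernoulli_powR y s : 0 < y -> 0 <= s -> s <= 1 -> y `^ s <= 1 + s * (y - 1).
Proof.
move=> y0 s0 s1.
have [->|sN0] := eqVneq s 0; first by rewrite powRr0 mul0r addr0.
have [->|sN1] := eqVneq s 1; first by rewrite powRr1 ?(ltW y0)// mul1r; lra.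
have sgt0 : 0 < s by rewrite lt_neqAle eq_sym sN0.
have slt1 : 0 < 1 - s by rewrite subr_gt0 lt_neqAle sN1.
have := @conjugate_powR R (y `^ s) 1 s^-1 (1 - s)^-1 (powR_ge0 _ _) ler01.
rewrite !invr_gt0 !invrK => /(_ sgt0 slt1).
rewrite addrC subrK => /(_ erefl).
rewrite mulr1 -powRrM mulfV// powRr1 ?(ltW y0)// powR1 mul1r => h.
by apply: le_trans h _; lra.
Qed.

Lemma powRN_ge y s : 0 < y -> y <= 1 -> 0 <= s -> s <= 1 ->
  1 + s * (1 - y) <= y `^ (- s).
Proof.
move=> y0 y1 s0 s1; rewrite powRN -[leRHS]mul1r ler_pdivlMr ?powR_gt0//.
have h := bernoulli_powR y0 s0 s1.
have u0 : 0 <= s * (1 - y) by rewrite mulr_ge0// subr_ge0.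
apply: le_trans (ler_wpM2l _ h) _; nra.
Qed.

Lemma powR_le_neg y1 y2 s : 0 < y1 -> y1 <= y2 -> 0 <= s -> y2 `^ (- s) <= y1 `^ (- s).
Proof.
move=> y0 yy s0; have y20 := lt_le_trans y0 yy.
rewrite !powRN lef_pV2 ?posrE ?powR_gt0//.
by apply: ge0_ler_powR => //; rewrite nnegrE ltW.
Qed.

Lemma powRDp y s1 s2 : 0 < y -> y `^ (s1 + s2) = y `^ s1 * y `^ s2.
Proof. by move=> y0; rewrite powRD// (gt_eqF y0) implybT. Qed.

Lemma powR_divN x y s : 0 < x -> 0 < y -> (x / y) `^ (- s) = x `^ (- s) * y `^ s.
Proof.
move=> x0 y0; rewrite powRM ?invr_ge0 ?(ltW x0) ?(ltW y0)//.
by rewrite -[y^-1]powR_inv1 ?(ltW y0)// -powRrM mulN1r opprK.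
Qed.

Lemma powR_le_base y1 y2 s : 0 <= y1 -> y1 <= y2 -> 0 <= s -> y1 `^ s <= y2 `^ s.
Proof.
move=> y0 yy s0; apply: ge0_ler_powR; rewrite ?nnegrE//; exact: le_trans yy.
Qed.

(** Discrete form of the integral of [x ^ (- a)]: by Bernoulli's inequality at [N / (N + 1)], each
    new term is at most the increment of the right-hand side. *)
Lemma sum_powR_le a N : 0 <= a -> a < 1 ->
  \sum_(j < N) (j.+1%:R : R) `^ (- a) <= N%:R `^ (1 - a) / (1 - a).
Proof.
move=> a0 a1; have a1' : 0 < 1 - a by rewrite subr_gt0.
elim: N => [|N IH]; first by rewrite big_ord0 divr_ge0 ?powR_ge0// ltW.
rewrite big_ord_recr/=.
have [->|N0] := posnP N.
  by rewrite big_ord0 add0r !powR1 ler_pdivlMr// mul1r; lra.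
apply: le_trans (lerD IH (lexx _)) _.
rewrite ler_pdivlMr// mulrDl divfK ?gt_eqF//.
have Np : 0 < N%:R :> R by rewrite ltr0n.
have N1p : 0 < N.+1%:R :> R by rewrite ltr0n.
pose y : R := N%:R / N.+1%:R.
have y0 : 0 < y by rewrite divr_gt0.
have h := bernoulli_powR y0 (ltW a1') (_ : 1 - a <= 1).
have {}h : y `^ (1 - a) <= 1 + (1 - a) * (y - 1) by apply: h; lra.
have -> : N%:R = y * N.+1%:R :> R by rewrite /y divfK// gt_eqF.
rewrite powRM ?(ltW y0) ?(ltW N1p)//.
have -> : (N.+1%:R : R) `^ (- a) = N.+1%:R `^ (1 - a) / N.+1%:R.
  by rewrite powRDp// powRr1 ?(ltW N1p)// mulrAC mulfV ?mul1r// gt_eqF.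
have P0 : 0 < (N.+1%:R : R) `^ (1 - a) by rewrite powR_gt0.
have yE : y - 1 = - N.+1%:R^-1.
  by rewrite /y -natr1; field; rewrite natr1 gt_eqF.
rewrite -mulrA mulrC -mulrDr -[leRHS]mulr1 ler_pM2l//.
rewrite {}yE in h; move: h; set u := N.+1%:R^-1; lra.
Qed.

(** Convexity of [x ^ (- s)], again from Bernoulli's inequality at [n / (n + 1)]; it makes the tails
    of the series of [n ^ (- (1 + s))] telescope. *)
Lemma powR_telescope (n : nat) s : (0 < n)%N -> 0 < s -> s <= 1 ->
  (n.+1%:R : R) `^ (- (1 + s)) <= s^-1 * (n%:R `^ (- s) - n.+1%:R `^ (- s)).
Proof.
move=> n0 s0 s1.
have Np : 0 < n%:R :> R by rewrite ltr0n.
have N1p : 0 < n.+1%:R :> R by rewrite ltr0n.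
pose y : R := n%:R / n.+1%:R.
have y0 : 0 < y by rewrite divr_gt0.
have y1 : y <= 1 by rewrite ler_pdivrMr// mul1r ler_nat.
have h := powRN_ge y0 y1 (ltW s0) s1.
have -> : n%:R = y * n.+1%:R :> R by rewrite /y divfK// gt_eqF.
rewrite powRM ?(ltW y0) ?(ltW N1p)// opprD addrC powRDp// powR_inv1 ?(ltW N1p)//.
have P0 : 0 < (n.+1%:R : R) `^ (- s) by rewrite powR_gt0.
have yE : 1 - y = n.+1%:R^-1.
  by rewrite /y -natr1; field; rewrite natr1 gt_eqF.
rewrite ler_pdivlMl// yE in h *.
rewrite [leRHS](_ : _ = n.+1%:R `^ (- s) * (y `^ (- s) - 1)); last by ring.
rewrite mulrCA ler_pM2l//; move: h; set u := n.+1%:R^-1; lra.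
Qed.

End power_inequalities.

(** * Tails and truncated mean of the jump distribution *)

Section kernel_bounds.
Context {R : realType}.
Variables (gamma : R) (J : int -> R).
Hypothesis g0 : 0 < gamma.
Hypothesis g1 : gamma < 1.
Hypothesis JK : jump_kernel gamma J.
Hypothesis Jeq : equiv_at_infinity J (fun x => absr x `^ (- (1 + gamma))).

Lemma jump_le1 x : J x <= 1.
Proof.
rewrite -lee_fin -(jump_sum1 JK) -(@esum_set1 _ _ x (fun x => (J x)%:E)).
  rewrite [X in (_ <= X)%E](esumID [set x]) ?setTI//.
    by rewrite leeDl// esum_ge0// => y _; rewrite lee_fin (jump_ge0 JK).
  by move=> y _; rewrite lee_fin (jump_ge0 JK).
by rewrite lee_fin (jump_ge0 JK).
Qed.

Lemma absr_nat (n : nat) : absr n%:Z = n%:R :> R.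
Proof. by rewrite /absr ger0_norm. Qed.

Lemma absr_ge0 x : 0 <= absr x :> R.
Proof. by rewrite /absr ler0z. Qed.

(** The asymptotic equivalence settles large [n]; below the threshold [M], monotonicity gives
    [J n >= J M > 0], while [J n <= 1]. The shift to [n + 1] lets the power bound cover the
    origin. *)
Lemma jump_bounds : exists c C : R, [/\ 0 < c, 0 < C &
  forall n : nat, c * n.+1%:R `^ (- (1 + gamma)) <= J n%:Z /\
                  J n%:Z <= C * n.+1%:R `^ (- (1 + gamma))].
Proof.
have g2 : 0 <= 1 + gamma by rewrite addr_ge0// ltW.
have [N _ HN] := Jeq (e := 2^-1) ltac:(by rewrite invr_gt0).
pose M := maxn N 1.
have big (n : nat) : (M <= n)%N ->
    2^-1 * n%:R `^ (- (1 + gamma)) <= J n%:Z <= 3 / 2 * n%:R `^ (- (1 + gamma)).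
  rewrite geq_max => /andP[Nn n1]; have := HN n Nn n%:Z erefl.
  rewrite absr_nat.
  have q0 : 0 < (n%:R : R) `^ (- (1 + gamma)) by rewrite powR_gt0// ltr0n.
  rewrite ltr_norml => /andP[h1 h2].
  by apply/andP; split; [rewrite -ler_pdivlMr//|rewrite -ler_pdivrMr//]; lra.
have JM : 0 < J M%:Z.
  have /andP[+ _] := big M (leqnn _); apply: lt_le_trans.
  by rewrite mulr_gt0// powR_gt0// ltr0n leq_maxr.
have step (n : nat) : (0 < n)%N -> n%:R `^ (- (1 + gamma)) <= 4 * (n.+1%:R : R) `^ (- (1 + gamma)).
  move=> n0; have np : 0 < n%:R :> R by rewrite ltr0n.
  have n1p : 0 < n.+1%:R :> R by rewrite ltr0n.
  rewrite !powRN ler_pdivlMr ?powR_gt0// mulrC ler_pdivrMr ?powR_gt0//.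
  have -> : 4 = (2 : R) `^ 2%:R by rewrite powR_mulrn//; ring.
  apply: (@le_trans _ _ ((2 * n%:R) `^ (1 + gamma))).
    by apply: powR_le_base => //; rewrite -natrM ler_nat; lia.
  rewrite powRM// ler_pM2r ?powR_gt0//; apply: ler_powR; first by rewrite ler1n.
  by rewrite -[2%:R]/(1 + 1 : R) lerD2l ltW.
(* The [6] is [3 / 2], from the equivalence, times the [4] that replaces [n] by [n + 1]. *)
exists (Num.min 2^-1 (J M%:Z)), (Num.max 6 ((M.+1%:R : R) `^ (1 + gamma))); split.
- by rewrite lt_min invr_gt0 ltr0n.
- by rewrite lt_max ltr0n.
move=> n; have q0 : 0 < (n.+1%:R : R) `^ (- (1 + gamma)) by rewrite powR_gt0// ltr0n.
have [Mn|nM] := leqP M n.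
  have n0 : (0 < n)%N by rewrite (leq_trans _ Mn)// leq_maxr.
  have /andP[h1 h2] := big _ Mn; split.
    apply: le_trans h1; apply: (@le_trans _ _ (2^-1 * n.+1%:R `^ (- (1 + gamma)))).
      by rewrite ler_pM2r// ge_min lexx.
    rewrite ler_pM2l ?invr_gt0//; apply: powR_le_neg => //; first by rewrite ltr0n.
    by rewrite ler_nat.
  apply: le_trans h2 _; apply: le_trans (ler_wpM2l _ (step _ n0)) _; first by lra.
  rewrite mulrA ler_pM2r// le_max; apply/orP; left; lra.
split.
  apply: (@le_trans _ _ (J M%:Z)); last by apply: (jump_noninc JK); lia.
  rewrite -[leRHS]mulr1 ler_pM// ?le_min ?invr_ge0 ?ler0n ?(ltW JM) ?(ltW q0)//.
  - by rewrite ge_min lexx orbT.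
  - by rewrite powRN invf_le1 ?powR_gt0 ?ltr0n// -[leLHS](powRr0 n.+1%:R) ler_powR// ler1n.
apply: le_trans (jump_le1 _) _.
rewrite powRN ler_pdivlMr ?powR_gt0 ?ltr0n// mul1r le_max; apply/orP; right.
by apply: powR_le_base => //; rewrite ler_nat; lia.
Qed.

Lemma jump_fun_ge0 x : (0 <= (J x)%:E)%E.
Proof. by rewrite lee_fin (jump_ge0 JK). Qed.

Definition jumpf : nnfun R := NNFun jump_fun_ge0.

Lemma peaked_jump : peaked jumpf.
Proof. by move=> x y xy /=; rewrite lee_fin (jump_noninc JK). Qed.

Lemma total_jump : total jumpf = 1%E.
Proof. exact: jump_sum1 JK. Qed.

Lemma tail_ge0 (h : R) x : (0 <= (if h <= absr x then J x else 0)%:E)%E.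
Proof. by rewrite lee_fin; case: ifP; rewrite ?(jump_ge0 JK). Qed.

Definition tailf h : nnfun R := NNFun (tail_ge0 h).

Lemma even_tail h : even (tailf h).
Proof. by move=> x /=; rewrite /absr normrN (jump_sym JK). Qed.

Lemma tail_hi : exists2 C : R, 0 < C &
  forall h, 1 <= h -> (total (tailf h) <= (C * h `^ (- gamma))%:E)%E.
Proof.
have [c [C [c0 C0 cC]]] := jump_bounds.
exists (2 * (C / gamma)); first by rewrite mulr_gt0// divr_gt0.
move=> h h1; have h0 := lt_le_trans ltr01 h1.
have half : (\esum_(n in [set: nat]) tailf h n%:Z <= (C / gamma * h `^ (- gamma))%:E)%E.
  apply: esum_nat_le => [n|N]; first exact: nnfun_ge0.
  (* The telescoping potential is frozen below [h], so that its total variation is at most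
     [h ^ (- gamma)]. *)
  pose m (n : nat) := Num.max h n%:R `^ (- gamma).
  apply: (@le_trans _ _ (\sum_(n < N) (C / gamma * (m n - m n.+1))%:E)%E).
    apply: lee_sum => -[n /= _] _; rewrite lee_fin absr_nat.
    have mm : m n.+1 <= m n.
      apply: powR_le_neg (ltW g0); first by rewrite lt_max h0.
      by rewrite ge_max !le_max lexx ler_nat leqnSn orbT.
    case: ifPn => [hn|_]; last by rewrite mulr_ge0 ?subr_ge0// divr_ge0 ?ltW.
    have n0 : (0 < n)%N by rewrite -(ltr0n R) (lt_le_trans h0).
    have [_ Jn] := cC n; apply: le_trans Jn _; rewrite -mulrA ler_pM2l//.
    rewrite /m !max_r//; first exact: powR_telescope (ltW g1).
    by apply: le_trans hn _; rewrite ler_nat.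
  rewrite sumEFin lee_fin -mulr_sumr ler_pM2l ?divr_gt0//.
  rewrite -(big_mkord xpredT (fun i => m i - m i.+1)).
  rewrite (@telescope_sumr_eq _ _ _ (fun i => - m i))//; last first.
    by move=> k _; rewrite opprK addrC.
  rewrite opprK addrC.
  by rewrite /m [Num.max h _]max_l ?(ltW h0)// lerBlDr lerDl powR_ge0.
rewrite /total; apply: le_trans (esum_int_le _) _; first exact: nnfun_ge0.
rewrite (@eq_esum _ _ _ (fun n : nat => tailf h (- n%:Z)) (fun n : nat => tailf h n%:Z)); last first.
  by move=> n _; rewrite even_tail.
apply: le_trans (leeD half half) _; rewrite -EFinD lee_fin; lra.
Qed.

(** With [M = floor h + 1 <= 2 h], the [M] integers from [M] to [2 M - 1] suffice: each has mass at
    least [c (4 h) ^ (- (1 + gamma))], and there are more than [h] of them. *)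
Lemma tail_lo : exists2 c : R, 0 < c &
  forall h, 1 <= h -> ((c * h `^ (- gamma))%:E <= total (tailf h))%E.
Proof.
have [c [C [c0 C0 cC]]] := jump_bounds.
exists (c * 4 `^ (- (1 + gamma))); first by rewrite mulr_gt0// powR_gt0.
move=> h h1; have h0 := lt_le_trans ltr01 h1.
pose M := (Num.truncn h).+1.
have Mh : h < M%:R by rewrite truncnS_gt.
have M2h : M%:R <= 2 * h.
  have : (Num.truncn h)%:R <= h by rewrite truncn_le ltW.
  rewrite -/M; rewrite /M -natr1; lra.
apply: le_trans (esum_le_sub (e := fun n : nat => Posz (M + n)) _ _); last 2 first.
- by move=> i j [] /addnI.
- exact: nnfun_ge0.
apply: le_trans (esum_nat_ge M _); last by move=> n; exact: nnfun_ge0.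
apply: (@le_trans _ _ (\sum_(i < M) (c * (4 * h) `^ (- (1 + gamma)))%:E)%E).
  rewrite sumEFin sumr_const card_ord lee_fin -[leRHS]mulr_natr.
  rewrite powRM ?(ltW h0)// -!mulrA ler_pM2l// ler_pM2l ?powR_gt0//.
  rewrite opprD addrC powRDp// powR_inv1 ?(ltW h0)// -mulrA -[leLHS]mulr1 ler_pM2l ?powR_gt0//.
  by rewrite mulrC ler_pdivlMr// mul1r ltW.
apply: lee_sum => -[n /= nM] _; rewrite lee_fin absr_nat.
rewrite (le_trans (ltW Mh)) ?ler_nat ?leq_addr//.
have [Jn _] := cC (M + n)%N; apply: le_trans Jn; rewrite ler_pM2l//.
apply: powR_le_neg; rewrite ?ltr0n ?addr_ge0 ?(ltW g0)//.
apply: (@le_trans _ _ (2 * M)%:R); first by rewrite ler_nat; lia.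
rewrite natrM; lra.
Qed.

(* The jumps have infinite mean; the truncated displacement [min (1, |x| / L)] is
   still subadditive, so that its mean grows at most linearly in time. *)
Definition capped (L : nat) (x : int) : R := Num.min 1 (absr x / L%:R).

Lemma capped_ge0 L x : 0 <= capped L x.
Proof. by rewrite le_min ler01 divr_ge0// absr_ge0. Qed.

Lemma cappedD L x y : (0 < L)%N -> capped L (x + y) <= capped L x + capped L y.
Proof.
move=> L0; have Lp : 0 < L%:R :> R by rewrite ltr0n.
rewrite /capped.
have xy : absr (x + y) / L%:R <= absr x / L%:R + absr y / L%:R :> R.
  by rewrite -mulrDl ler_pM2r ?invr_gt0// /absr -intrD ler_int ler_normD.
have x0 : 0 <= absr x / L%:R :> R by rewrite divr_ge0// absr_ge0.
have y0 : 0 <= absr y / L%:R :> R by rewrite divr_ge0// absr_ge0.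
have [u|u] := leP 1 (absr x / L%:R); first by rewrite ge_min lerDl le_min ler01 y0.
have [v|v] := leP 1 (absr y / L%:R); first by rewrite ge_min lerDr x0.
by rewrite ge_min xy orbT.
Qed.

(** Jumps beyond [L] contribute their probability, shorter ones their mean divided by [L]. Since
    [gamma < 1], the truncated mean is of order [L ^ (1 - gamma)], so both parts have the order
    [L ^ (- gamma)]. *)
Lemma capped_mean : exists2 C : R, 0 < C & forall L, (0 < L)%N ->
  (\esum_(x in [set: int]) (jumpf x * (capped L x)%:E) <= (C * L%:R `^ (- gamma))%:E)%E.
Proof.
have [c [C [c0 C0 cC]]] := jump_bounds.
have [C2 C20 H2] := tail_hi.
have g1' : 0 < 1 - gamma by rewrite subr_gt0.
exists (C2 + 2 * (C / (1 - gamma))).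
  by rewrite addr_gt0// mulr_gt0// divr_gt0.
move=> L L0; have Lp : 0 < L%:R :> R by rewrite ltr0n.
pose s (x : int) := ((if absr x < L%:R :> R then J x * (absr x / L%:R) else 0 : R)%:E).
have s0 x : (0 <= s x)%E.
  rewrite lee_fin; case: ifP => // _; rewrite mulr_ge0 ?(jump_ge0 JK)// divr_ge0//.
apply: (@le_trans _ _ (total (tailf L%:R) + \esum_(x in [set: int]) s x)%E).
  rewrite -esumD => [|x _|x _]; rewrite ?nnfun_ge0//.
  apply: le_esum => x _ /=; rewrite -EFinM lee_fin /capped.
  have [Lx|xL] := leP L%:R (absr x).
    by rewrite addr0 -[leRHS]mulr1 ler_wpM2l ?(jump_ge0 JK)// ge_min lexx.
  by rewrite add0r ler_wpM2l ?(jump_ge0 JK)// ge_min lexx orbT.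
have half : (\esum_(n in [set: nat]) s n%:Z <= (C / (1 - gamma) * L%:R `^ (- gamma))%:E)%E.
  rewrite (esum_nat_fin (n := L))//; last first.
    by move=> i Li; rewrite /s absr_nat ltr_nat ltnNge Li.
  apply: (@le_trans _ _ (\sum_(i < L) (C / L%:R * i.+1%:R `^ (- gamma))%:E)%E).
    apply: lee_sum => -[i /= iL] _; rewrite /s absr_nat ltr_nat iL lee_fin.
    have [_ Ji] := cC i; have i1 : 0 < i.+1%:R :> R by rewrite ltr0n.
    apply: (@le_trans _ _ (C * i.+1%:R `^ (- (1 + gamma)) * (i.+1%:R / L%:R))).
      apply: ler_pM => //; rewrite ?(jump_ge0 JK) ?divr_ge0//.
      by rewrite ler_pM2r ?invr_gt0// ler_nat.
    rewrite opprD powRDp// powR_inv1 ?(ltW i1)//.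
    rewrite le_eqVlt; apply/orP; left; apply/eqP; field.
    by rewrite !gt_eqF.
  rewrite sumEFin lee_fin -mulr_sumr.
  apply: le_trans (ler_wpM2l _ (sum_powR_le L (ltW g0) g1)) _.
    by rewrite divr_ge0// ltW.
  rewrite powRDp// powRr1 ?(ltW Lp)//.
  rewrite le_eqVlt; apply/orP; left; apply/eqP; field.
  by rewrite !gt_eqF.
apply: le_trans (leeD (H2 L%:R _) (esum_int_le s0)) _; first by rewrite ler1n.
rewrite (@eq_esum _ _ _ (fun n : nat => s (- n%:Z)%R) (fun n : nat => s n%:Z)); last first.
  by move=> n _; rewrite /s /absr normrN (jump_sym JK).
apply: le_trans (leeD (lexx _) (leeD half half)) _; rewrite -!EFinD lee_fin.
by rewrite le_eqVlt; apply/orP; left; apply/eqP; ring.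
Qed.

End kernel_bounds.

Lemma powR_le1 {R : realType} (x s : R) : 0 <= x -> x <= 1 -> 0 <= s -> x `^ s <= 1.
Proof.
by move=> x0 x1 s0; apply: le_trans (powR_le_base x0 x1 s0) _; rewrite powR1.
Qed.

Lemma powR_ge1 {R : realType} (x s : R) : 1 <= x -> 0 <= s -> 1 <= x `^ s.
Proof.
by move=> x1 s0; apply: le_trans (powR_le_base ler01 x1 s0); rewrite powR1.
Qed.

(** * Two-sided bounds for the heat kernel at the origin *)

Section heat_kernel.
Context {R : realType}.
Variables (gamma : R) (J : int -> R).
Hypothesis g0 : 0 < gamma.
Hypothesis g1 : gamma < 1.
Hypothesis JK : jump_kernel gamma J.
Hypothesis Jeq : equiv_at_infinity J (fun x => absr x `^ (- (1 + gamma))).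
Local Notation F := (jumpf JK).

Lemma total_jumpX n : total (F ^+ n)%R = 1%E.
Proof. by rewrite totalX total_jump; elim: n => // n IH; rewrite expeS IH mule1. Qed.

Lemma jumpX_le n x : ((F ^+ n)%R x <= (`|x|%N.+1%:R^-1)%:E)%E.
Proof.
rewrite -[X in X%:E]mul1r; apply: peaked_le; first by apply: peakedX; exact: peaked_jump.
by rewrite total_jumpX.
Qed.

Lemma jumpX_fin n x : (F ^+ n)%R x = (fine ((F ^+ n)%R x))%:E.
Proof.
rewrite fineK// ge0_fin_numE ?nnfun_ge0//.
by apply: le_lt_trans (jumpX_le _ _) _; rewrite ltry.
Qed.

Lemma jump0_gt0 : 0 < J 0.
Proof.
have [c [C [c0 _ cC]]] := jump_bounds g0 g1 JK Jeq.
by have [+ _] := cC 0%N; apply: lt_le_trans; rewrite mulr_gt0// powR_gt0.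
Qed.

Lemma jumpX0_gt0 n : (0 < (F ^+ n)%R 0%R)%E.
Proof.
elim: n => [|n IH]; first by rewrite expr0 nnfun1E eqxx.
rewrite exprS nnfunME (esumID [set 0]); last first.
  by move=> *; rewrite mule_ge0 ?nnfun_ge0.
rewrite setTI esum_set1; last by rewrite mule_ge0 ?nnfun_ge0.
apply: (@lt_le_trans _ _ (F 0%R * (F ^+ n)%R (0 - 0)%R)%E).
  by rewrite subr0 mule_gt0//= lte_fin jump0_gt0.
by rewrite leeDl// esum_ge0// => *; rewrite mule_ge0 ?nnfun_ge0.
Qed.

(** Let [a n] be the return probability. A unimodal law of mass [1] is at most [a n / 2] at distance
    [2 / a n] or more, and the next jump has a length in that range with probability of order
    [a n ^ gamma]. Hence [a (n + 1) <= a n (1 - k a n ^ gamma)], a recursion whose solutions decay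
    like [n ^ (- 1 / gamma)]. *)
Lemma return_decay : exists2 C : R, 0 < C &
  forall n, ((F ^+ n)%R 0%R <= (C * n.+1%:R `^ (- gamma^-1))%:E)%E.
Proof.
have [c c0 tl] := tail_lo g0 g1 JK Jeq.
pose a n := fine ((F ^+ n)%R 0%R).
have a0 n : 0 < a n by rewrite -lte_fin -jumpX_fin jumpX0_gt0.
have a1 n : a n <= 1.
  by have := jumpX_le n 0; rewrite jumpX_fin invr1 lee_fin.
pose k := c / 2 * 2 `^ (- gamma).
have k0 : 0 < k by rewrite mulr_gt0 ?powR_gt0// divr_gt0.
have step n : a n.+1 <= a n * (1 - k * a n `^ gamma).
  have h1 : 1 <= 2 / a n by rewrite ler_pdivlMr// mul1r (le_trans (a1 n))// ler1n.
  have := tl _ h1.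
  rewrite powR_divN// => tlh.
  rewrite -lee_fin mulrBr mulr1 EFinB leeBrDr// -!jumpX_fin exprS.
  rewrite conv_at0; last by apply: evenX; apply: peaked_even; exact: peaked_jump.
  have : ((a n / 2)%:E * (c * (2 `^ (- gamma) * a n `^ gamma))%:E <=
          (a n / 2)%:E * total (tailf JK (2 / a n)))%E.
    by rewrite lee_wpmul2l// lee_fin divr_ge0// ltW.
  rewrite -EFinM => /(leeD (lexx (\esum_(x in [set: int]) (F x * (F ^+ n)%R x))%E)).
  rewrite (_ : a n / 2 * _ = a n * (k * a n `^ gamma)); last by rewrite /k; ring.
  move=> /le_trans; apply.
  rewrite -esumZl ?lee_fin ?divr_ge0 ?(ltW (a0 n))//; last exact: nnfun_ge0.
  rewrite -esumD => [|x _|x _]; last 2 first.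
  - by rewrite mule_ge0 ?nnfun_ge0.
  - by rewrite mule_ge0 ?nnfun_ge0// lee_fin divr_ge0// ltW.
  rewrite -[leRHS]mule1 -(total_jump JK) jumpX_fin -esumZl ?lee_fin ?(ltW (a0 n))//; last first.
    exact: nnfun_ge0.
  apply: le_esum => x _; rewrite jumpX_fin /= -!EFinM -EFinD lee_fin -/(a n).
  case: ifPn => hx; last first.
    rewrite mulr0 addr0 mulrC ler_wpM2r ?(jump_ge0 JK)//.
    rewrite -lee_fin -!jumpX_fin; apply: peakedX; first exact: peaked_jump.
    by rewrite normr0 normr_ge0.
  suff : fine ((F ^+ n)%R x) <= a n / 2.
    by move=> h; have := jump_ge0 JK x; nra.
  rewrite -lee_fin -jumpX_fin; apply: le_trans (jumpX_le _ _) _.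
  rewrite lee_fin -[leRHS]invrK lef_pV2 ?posrE ?invr_gt0 ?divr_gt0// invf_div.
  apply: le_trans hx _; rewrite /absr -abszE -natr1 lerDl//.
(* This power linearises the recursion: [d] grows by at least [gamma * k] at each step. *)
pose d n := a n `^ (- gamma).
have d0 n : 0 < d n by rewrite powR_gt0.
have da n : d n * a n `^ gamma = 1.
  by rewrite /d powRN mulVf// gt_eqF// powR_gt0.
have dstep n : d n + gamma * k <= d n.+1.
  have x1 : 0 < 1 - k * a n `^ gamma.
    by rewrite -(pmulr_rgt0 _ (a0 n)) (lt_le_trans (a0 n.+1)).
  have x2 : 1 - k * a n `^ gamma <= 1.
    by rewrite lerBlDr lerDl mulr_ge0 ?powR_ge0// ltW.
  apply: (@le_trans _ _ ((a n * (1 - k * a n `^ gamma)) `^ (- gamma))); last first.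
    by apply: powR_le_neg (ltW g0).
  rewrite powRM ?(ltW (a0 n)) ?(ltW x1)// -/(d n).
  have := powRN_ge x1 x2 (ltW g0) (ltW g1) => h.
  apply: le_trans (ler_wpM2l (ltW (d0 n)) h).
  rewrite [leRHS](_ : _ = d n + gamma * k * (d n * a n `^ gamma)); last by ring.
  by rewrite da mulr1.
pose m := Num.min 1 (gamma * k).
have m0 : 0 < m by rewrite lt_min ltr01 mulr_gt0.
have dn n : m * n.+1%:R <= d n.
  elim: n => [|n IH].
    rewrite mulr1 /d /a expr0 nnfun1E eqxx /= powR1.
    by rewrite ge_min lexx.
  rewrite -natr1 mulrDr mulr1; apply: le_trans (dstep n).
  by rewrite lerD// ge_min lexx orbT.
exists (m `^ (- gamma^-1)); first by rewrite powR_gt0.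
move=> n; rewrite jumpX_fin lee_fin -/(a n) -powRM ?ler0n ?(ltW m0)//.
have -> : a n = d n `^ (- gamma^-1).
  by rewrite /d -powRrM mulrNN mulfV ?gt_eqF// powRr1// ltW.
apply: powR_le_neg => //; last by rewrite invr_ge0 ltW.
by rewrite mulr_gt0// ltr0n.
Qed.

(** The semigroup [exp (t (F - 1))], written without the subtraction that the semiring does not
    have: the law of the walk at time [t]. *)
Definition heat t : nnfun R := pt (expR (- t)) * cp (pt t * F).

Lemma heatE t x : 0 <= t -> heat t x =
  (\esum_(n in [set: nat]) ((expR (- t) * (n`!%:R^-1 * t ^+ n))%:E * (F ^+ n)%R x))%E.
Proof.
move=> t0; rewrite /heat ptME ?expR_ge0//= -esumZl ?lee_fin ?expR_ge0//.
  apply: eq_esum => n _.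
  by rewrite exprMn -ptX// ptME ?exprn_ge0// !muleA -!EFinM mulrA.
by move=> n; rewrite mule_ge0 ?nnfun_ge0// lee_fin invr_ge0.
Qed.

Lemma heatD s t : 0 <= s -> 0 <= t -> heat (s + t) = heat s * heat t.
Proof.
move=> s0 t0; rewrite /heat opprD expRD ptM ?expR_ge0// ptD// mulrDl cpD.
by rewrite mulrACA.
Qed.

Lemma total_pt (c : R) : 0 <= c -> total (pt c) = c%:E.
Proof.
move=> c0; rewrite -[pt c]mulr1 /total.
under eq_esum do rewrite ptME//.
rewrite esumZl ?lee_fin//; last exact: nnfun_ge0.
by rewrite -/(total 1) total1 mule1.
Qed.

Lemma total_heat t : 0 <= t -> total (heat t) = 1%E.
Proof.
move=> t0; rewrite totalM total_pt ?expR_ge0// (total_cp t0); last first.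
  by rewrite totalM total_pt// total_jump mule1.
by rewrite -EFinM -expRD addNr expR0.
Qed.

Lemma peaked_pt (c : R) (f : nnfun R) : 0 <= c -> peaked f -> peaked (pt c * f).
Proof. by move=> c0 pf x y xy; rewrite !ptME// lee_wpmul2l// pf. Qed.

Lemma peaked_heat t : 0 <= t -> peaked (heat t).
Proof.
move=> t0; apply: peaked_pt; first exact: expR_ge0.
by apply: peaked_cp; apply: peaked_pt => //; exact: peaked_jump.
Qed.

Lemma heat_le t x : 0 <= t -> (heat t x <= (`|x|%N.+1%:R^-1)%:E)%E.
Proof.
move=> t0; rewrite -[X in X%:E]mul1r; apply: peaked_le; first exact: peaked_heat.
by rewrite total_heat.
Qed.

Lemma heat_fin t x : 0 <= t -> heat t x = (fine (heat t x))%:E.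
Proof.
move=> t0; rewrite fineK// ge0_fin_numE ?nnfun_ge0//.
by apply: le_lt_trans (heat_le _ t0) _; rewrite ltry.
Qed.

Lemma heat_noninc s t : 0 <= s -> s <= t -> (heat t 0%R <= heat s 0%R)%E.
Proof.
move=> s0 st; have ts0 : 0 <= t - s by rewrite subr_ge0.
have -> : t = s + (t - s) by rewrite addrC subrK.
rewrite heatD//; apply: le_trans (conv_le_peak _ (peaked_heat s0)) _.
  by apply: peaked_even; exact: peaked_heat.
by rewrite total_heat// mule1.
Qed.

Lemma heat_ge_exp t : 0 <= t -> ((expR (- t))%:E <= heat t 0%R)%E.
Proof.
move=> t0; rewrite heatE//.
apply: esum_ge; exists [set 0%N]; first by split => //; exact: finite_set1.
by rewrite fsbig_set1 fact0 expr0 invr1 mulr1 mulr1 expr0 nnfun1E eqxx mule1.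
Qed.

(** Poisson average of [return_decay]. With [r = t / (n + 1)] and [1 / gamma <= 2], one has
    [r ^ (1 / gamma) <= 1 + r ^ 2], and the factor [r ^ 2] shifts the Poisson weight:
    [r ^ 2 * w n <= 2 * w (n + 2)]. The weights sum to [1], whence the constant [1 + 2 = 3]. *)
Lemma heat_hi : 2^-1 < gamma -> exists2 C : R, 0 < C &
  forall t, 0 < t -> (heat t 0%R <= (C * t `^ (- gamma^-1))%:E)%E.
Proof.
move=> g2; have [C C0 rd] := return_decay.
exists (C * 3); first by rewrite mulr_gt0.
move=> t t0; rewrite heatE ?(ltW t0)//.
pose w n := expR (- t) * (n`!%:R^-1 * t ^+ n).
have w0 n : 0 <= w n by rewrite mulr_ge0 ?expR_ge0// mulr_ge0 ?invr_ge0// exprn_ge0// ltW.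
have sw : (\esum_(n in [set: nat]) (w n)%:E = 1)%E.
  under eq_esum do rewrite EFinM.
  rewrite esumZl ?lee_fin ?expR_ge0//; last first.
    by move=> n; rewrite lee_fin mulr_ge0 ?invr_ge0// exprn_ge0// ltW.
  by rewrite esum_exp ?(ltW t0)// -EFinM -expRD addNr expR0.
have key (n : nat) : n.+1%:R `^ (- gamma^-1) * w n <= t `^ (- gamma^-1) * (w n + 2 * w n.+2).
  have n1 : 0 < n.+1%:R :> R by rewrite ltr0n.
  pose r := t / n.+1%:R; have r0 : 0 < r by rewrite divr_gt0.
  have gi0 : 0 <= gamma^-1 by rewrite invr_ge0 ltW.
  have -> : n.+1%:R = t / r by rewrite /r invf_div mulrC divfK// gt_eqF.
  rewrite powR_divN//.
  rewrite -mulrA ler_pM2l ?powR_gt0//.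
  have rr : r `^ gamma^-1 <= 1 + r ^+ 2.
    have [r1|r1] := leP r 1.
      apply: (@le_trans _ _ 1); last by rewrite lerDl sqr_ge0.
      by rewrite powR_le1 ?(ltW r0).
    apply: (@le_trans _ _ (r ^+ 2)); last by rewrite lerDr.
    rewrite -powR_mulrn ?(ltW r0)//; apply: ler_powR; first exact: ltW.
    by rewrite -[2%:R]invrK lef_pV2 ?posrE ?invr_gt0// ltW.
  apply: le_trans (ler_wpM2r (w0 n) rr) _; rewrite mulrDl mul1r lerD2l.
  have -> : w n.+2 = w n * (t ^+ 2 / (n.+2%:R * n.+1%:R)).
    rewrite /w !factS !natrM !exprS; field.
    rewrite nat1r (_ : 2 + n%:R = n.+2%:R :> R); last by rewrite -[n.+2]addn2 natrD addrC.
    by rewrite !pnatr_eq0 /= -lt0n fact_gt0.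
  rewrite [leRHS]mulrCA [leLHS]mulrC; apply: ler_wpM2l; first exact: w0.
  rewrite /r expr_div_n mulrCA; apply: ler_wpM2l; first exact: sqr_ge0.
  rewrite ler_pdivlMr ?mulr_gt0 ?ltr0n// mulrC ler_pdivrMr ?exprn_gt0//.
  by rewrite -natrX -!natrM ler_nat; nia.
apply: (@le_trans _ _ (\esum_(n in [set: nat]) ((C * t `^ (- gamma^-1))%:E *
    ((w n)%:E + 2%:E * (w n.+2)%:E)))%E).
  apply: le_esum => n _; rewrite -/(w n).
  apply: le_trans (lee_wpmul2l _ (rd n)) _; first by rewrite lee_fin.
  rewrite -[leRHS]/((C * t `^ (- gamma^-1) * (w n + 2 * w n.+2))%:E) -EFinM lee_fin.
  rewrite mulrCA -[leRHS]mulrA ler_pM2l// [leLHS]mulrC; exact: key.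
rewrite esumZl ?lee_fin ?mulr_ge0 ?powR_ge0 ?(ltW C0)//; last first.
  by move=> n; rewrite -EFinM -EFinD lee_fin addr_ge0// mulr_ge0.
rewrite mulrAC [X in (_ <= X)%E]EFinM; apply: lee_wpmul2l.
  by rewrite lee_fin mulr_ge0 ?powR_ge0// ltW.
rewrite esumD; [|by move=> n _; rewrite lee_fin|by move=> n _; rewrite -EFinM lee_fin mulr_ge0].
rewrite sw esumZl ?lee_fin//; last by move=> n; rewrite lee_fin.
have : (\esum_(n in [set: nat]) (w n.+2)%:E <= 1)%E.
  by rewrite -[leRHS]sw; apply: (esum_le_sub (e := fun n => n.+2)) => [i j []|j]; rewrite ?lee_fin.
move=> h; apply: le_trans (leeD (lexx _) (lee_wpmul2l _ h)) _; first by rewrite lee_fin.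
by rewrite mule1 -EFinD lee_fin; lra.
Qed.

Lemma capped_powers (L : nat) (m : \bar R) n : (0 < L)%N ->
  (\esum_(x in [set: int]) (F x * (capped L x)%:E) <= m)%E ->
  (\esum_(x in [set: int]) ((F ^+ n)%R x * (capped L x)%:E) <= n%:R%:E * m)%E.
Proof.
move=> L0 Fm; elim: n => [|n IH].
  rewrite mul0e (@esum_only _ _ 0).
  - by rewrite /capped /absr normr0 mul0r min_r// mule0.
  - by move=> x; rewrite mule_ge0 ?nnfun_ge0// lee_fin capped_ge0.
  - by move=> x x0; rewrite expr0 nnfun1E (negbTE x0) mul0e.
have m0 : (0 <= m)%E.
  apply: le_trans Fm; apply: esum_ge0 => x _.
  by rewrite mule_ge0 ?nnfun_ge0// lee_fin capped_ge0.
have cg x : (0 <= (capped L x)%:E :> \bar R)%E by rewrite lee_fin capped_ge0.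
have F0 k x : (0 <= (F ^+ k)%R x)%E by exact: nnfun_ge0.
have F0' x : (0 <= F x)%E by exact: nnfun_ge0.
rewrite exprS.
apply: (@le_trans _ _ (\esum_(y in [set: int]) \esum_(x in [set: int])
   (F y * ((F ^+ n)%R (x - y)%R * (capped L x)%:E)))%E).
  rewrite esum_swap; last by move=> *; rewrite !mule_ge0.
  apply: le_esum => x _; rewrite nnfunME muleC -esumZl//; last by move=> y; rewrite mule_ge0.
  by apply: le_esum => y _; rewrite muleC muleA.
apply: (@le_trans _ _ (\esum_(y in [set: int])
   (F y * (capped L y)%:E + F y * (n%:R%:E * m)))%E).
  apply: le_esum => y _; rewrite esumZl//; last by move=> *; rewrite mule_ge0.
  rewrite -ge0_muleDr//; last by rewrite mule_ge0// lee_fin.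
  apply: lee_wpmul2l => //.
  have -> : (\esum_(x in [set: int]) ((F ^+ n)%R (x - y)%R * (capped L x)%:E) =
      \esum_(z in [set: int]) ((F ^+ n)%R z * (capped L (z + y)%R)%:E))%E.
    rewrite -[RHS](@esum_bij _ _ _ (fun x : int => x - y)%R); last first.
      by exists (fun x : int => x + y)%R => z; rewrite ?subrK ?addrK.
    by apply: eq_esum => z _; rewrite subrK.
  apply: (@le_trans _ _ (\esum_(z in [set: int]) ((F ^+ n)%R z * (capped L z)%:E +
      (capped L y)%:E * (F ^+ n)%R z))%E).
    apply: le_esum => z _; rewrite [X in (_ <= _ + X)%E]muleC -ge0_muleDr//.
    by rewrite lee_wpmul2l// -EFinD lee_fin cappedD.
  rewrite esumD => [|z _|z _]; rewrite ?mule_ge0// addeC leeD//.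
  by rewrite esumZl// -/(total _) total_jumpX mule1.
rewrite esumD => [|x _|x _]; [|by rewrite mule_ge0|by rewrite !mule_ge0].
rewrite -natr1 EFinD ge0_muleDl ?lee_fin// mul1e addeC leeD//.
rewrite [X in (X <= _)%E](_ : _ = n%:R%:E * m * total F)%E.
  by rewrite total_jump mule1.
rewrite -esumZl ?mule_ge0 ?lee_fin//.
by apply: eq_esum => x _; rewrite muleC.
Qed.

(** For [L ^ gamma] a large multiple of [1 + t], the capped displacement has mean at most [1/2], so
    mass at least [1/2] remains within distance [L]. There each of at most [2 L] points carries no
    more than the origin does. The [8] collects this [1/2], the [2 L] and [L <= 2 u]. *)
Lemma heat_lo : exists2 c : R, 0 < c &
  forall t, 0 <= t -> ((c * (1 + t) `^ (- gamma^-1))%:E <= heat t 0%R)%E.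
Proof.
have [C' C'0 cm] := capped_mean g0 g1 JK Jeq.
pose C := Num.max 1 C'.
have C1 : 1 <= C by rewrite le_max lexx.
have C0 : 0 < C := lt_le_trans ltr01 C1.
have gi0 : 0 <= gamma^-1 by rewrite invr_ge0 ltW.
exists (8^-1 * (2 * C) `^ (- gamma^-1)); first by rewrite mulr_gt0 ?powR_gt0 ?mulr_gt0.
move=> t t0; have t1 : 0 < 1 + t by rewrite ltr_wpDr.
pose u := (2 * C * (1 + t)) `^ gamma^-1.
have u1 : 1 <= u.
  by apply: powR_ge1 => //; nra.
pose L := (Num.truncn u).+1.
have uL : u < L%:R by rewrite truncnS_gt.
have Lu : L%:R <= 2 * u.
  have : (Num.truncn u)%:R <= u by rewrite truncn_le (le_trans ler01).
  rewrite /L -natr1; lra.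
have L0 : 0 < L%:R :> R by rewrite ltr0n.
have LC : t * (C' * L%:R `^ (- gamma)) <= 2^-1.
  have : 2 * C * (1 + t) <= L%:R `^ gamma.
    rewrite (_ : 2 * C * (1 + t) = u `^ gamma).
      by rewrite powR_le_base ?(ltW uL) ?(ltW g0)// (le_trans ler01).
    by rewrite /u -powRrM mulVf ?gt_eqF// powRr1// !mulr_ge0 ?(ltW C0) ?(ltW t1).
  have CC : C' <= C by rewrite le_max lexx orbT.
  rewrite powRN mulrA ler_pdivrMr ?powR_gt0// => h.
  have : t * C' <= (1 + t) * C by apply: ler_pM => //; rewrite ?(ltW C'0)// lerDr.
  lra.
have cg x : (0 <= (capped L x)%:E :> \bar R)%E by rewrite lee_fin capped_ge0.
have hc : (\esum_(x in [set: int]) (heat t x * (capped L x)%:E) <= (2^-1)%:E)%E.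
  have w0 (n : nat) : (0 <= (expR (- t) * (n`!%:R^-1 * t ^+ n))%:E :> \bar R)%E.
    by rewrite lee_fin mulr_ge0 ?expR_ge0// mulr_ge0 ?invr_ge0// exprn_ge0.
  apply: (@le_trans _ _ (\esum_(n in [set: nat])
     ((C' * L%:R `^ (- gamma))%:E * (expR (- t) * (n`!%:R^-1 * t ^+ n) * n%:R)%:E)))%E.
    rewrite [leLHS](_ : _ = \esum_(x in [set: int]) \esum_(n in [set: nat])
       ((expR (- t) * (n`!%:R^-1 * t ^+ n))%:E * ((F ^+ n)%R x * (capped L x)%:E)))%E; last first.
      apply: eq_esum => x _; rewrite heatE// muleC -esumZl ?lee_fin ?capped_ge0//; last first.
        by move=> n; rewrite mule_ge0 ?nnfun_ge0.
      by apply: eq_esum => n _; rewrite muleC muleA.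
    rewrite esum_swap; last first.
      by move=> *; rewrite !mule_ge0 ?nnfun_ge0.
    apply: le_esum => n _; rewrite esumZl//; last first.
      by move=> *; rewrite !mule_ge0 ?nnfun_ge0.
    rewrite [X in (_ <= _ * X)%E]EFinM muleCA; apply: lee_wpmul2l => //.
    by rewrite muleC; apply: capped_powers => //; exact: cm.
  rewrite esumZl ?lee_fin ?mulr_ge0 ?powR_ge0 ?(ltW C'0)//; last first.
    by move=> n; rewrite EFinM mule_ge0// lee_fin.
  (* The sum is the mean number of jumps up to time [t]. *)
  suff -> : (\esum_(n in [set: nat]) (expR (- t) * (n`!%:R^-1 * t ^+ n) * n%:R)%:E = t%:E)%E.
    by rewrite -EFinM lee_fin mulrC.
  rewrite (esumID [set n | n != 0%N]); last by move=> n _; rewrite EFinM mule_ge0// lee_fin.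
  rewrite !setTI [X in (_ + X)%E]esum1 ?adde0; last first.
    by move=> n /= /negP/negPn/eqP ->; rewrite mulr0.
  rewrite (_ : [set n | _] = succn @` setT); last first.
    by apply/seteqP; split=> [[|n]//= _|_ [n _ <-]//]; exists n.
  rewrite esum_image; last by move=> i j _ _ [].
  have e n : (expR (- t) * (n.+1`!%:R^-1 * t ^+ n.+1) * n.+1%:R)%:E =
      ((t * expR (- t))%:E * (n`!%:R^-1 * t ^+ n)%:E)%E.
    rewrite -EFinM; congr (_%:E); rewrite factS natrM exprS; field.
    by rewrite pnatr_eq0 -lt0n fact_gt0 /= nat1r pnatr_eq0.
  under eq_esum do rewrite e.
  rewrite esumZl ?lee_fin ?mulr_ge0 ?expR_ge0//; last first.
    by move=> n; rewrite lee_fin mulr_ge0 ?invr_ge0// exprn_ge0.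
  by rewrite esum_exp// -EFinM -mulrA -expRD addNr expR0 mulr1.
have hcap : (\esum_(x in [set: int]) (heat t x * (1 - capped L x)%:E) <=
    (2 * L%:R)%:E * heat t 0%R)%E.
  have f0 x : (0 <= heat t x * (1 - capped L x)%:E)%E.
    by rewrite mule_ge0 ?nnfun_ge0// lee_fin subr_ge0 ge_min lexx.
  have half : (\esum_(n in [set: nat]) (heat t n%:Z * (1 - capped L n%:Z)%:E) <=
      L%:R%:E * heat t 0%R)%E.
    rewrite (@esum_nat_fin _ _ L) => [|n|n Ln]; last 2 first.
    - exact: f0.
    - rewrite /capped absr_nat min_l ?subrr ?mule0//.
      by rewrite ler_pdivlMr// mul1r ler_nat.
    rewrite [leRHS](_ : _ = \sum_(i < L) heat t 0%R)%E; last first.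
      by rewrite sumr_const card_ord -[RHS]mule_natl.
    apply: lee_sum => i _; rewrite -[leRHS]mule1.
    apply: lee_pmul; rewrite ?nnfun_ge0 ?lee_fin ?subr_ge0 ?ge_min ?lexx//.
    - by apply: peaked_heat => //; rewrite normr0 normr_ge0.
    - by rewrite lerBlDr lerDl capped_ge0.
  apply: le_trans (esum_int_le f0) _.
  have -> : (\esum_(n in [set: nat]) (heat t (- n%:Z)%R * (1 - capped L (- n%:Z)%R)%:E) =
      \esum_(n in [set: nat]) (heat t n%:Z * (1 - capped L n%:Z)%:E))%E.
    apply: eq_esum.
    by move=> n _; rewrite peaked_even ?/capped /absr ?normrN//; exact: peaked_heat.
  apply: le_trans (leeD half half) _.
  by rewrite -ge0_muleDl ?lee_fin// -EFinD mulr_natl mulr2n.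
have : (1%:E <= (2^-1)%:E + (2 * L%:R)%:E * heat t 0%R :> \bar R)%E.
  apply: le_trans (leeD hc hcap); rewrite -esumD => [|x _|x _]; last 2 first.
  - by rewrite mule_ge0 ?nnfun_ge0// lee_fin capped_ge0.
  - by rewrite mule_ge0 ?nnfun_ge0// lee_fin subr_ge0 ge_min lexx.
  rewrite -(total_heat t0); apply: le_esum => x _.
  rewrite -ge0_muleDr ?lee_fin ?capped_ge0 ?subr_ge0 ?ge_min ?lexx//.
  by rewrite -EFinD addrC subrK mule1.
rewrite heat_fin// -EFinM -EFinD !lee_fin.
set P := fine _ => h.
have hP : 2^-1 <= 4 * u * P.
  have P0 : 0 <= P by rewrite fine_ge0// nnfun_ge0.
  nra.
rewrite -mulrA -powRM ?mulr_ge0 ?(ltW C0) ?(ltW t1)// powRN -/u.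
rewrite ler_pdivrMr; last exact: lt_le_trans ltr01 u1.
lra.
Qed.

End heat_kernel.

(** * Pinned paths on a time grid *)

Section countable_valued.
Context {R : realType} {d : measure_display} {Omega : measurableType d}.
Variable mu : {measure set Omega -> \bar R}.
Variables (U : countType) (X : Omega -> U).
Hypothesis mX : forall u, measurable [set w | X w = u].
Local Open Scope ereal_scope.

Lemma measurable_countable_preimage (A : set U) : measurable [set w | A (X w)].
Proof.
rewrite (_ : [set w | A (X w)] =
    \bigcup_u (if `[< A u >] then [set w | X w = u] else set0)).
  apply: countable_bigcupT_measurable => // u.
  by case: ifP.
apply/seteqP; split=> [w /= Aw|w [u _]].
  by exists (X w) => //; rewrite (asboolT Aw).
by case: ifPn => // /asboolP Au /= ->.
Qed.

Lemma measurable_fun_countable (G : U -> \bar R) :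
  measurable_fun [set: Omega] (fun w => G (X w)).
Proof.
move=> _ B mB; rewrite setTI.
exact: (measurable_countable_preimage [set u | B (G u)]).
Qed.

(** The fibres are indexed by [pickle], so that additivity over the natural numbers applies; codes
    outside its range give empty fibres. *)
Lemma integral_countable (G : U -> \bar R) : (forall u, 0 <= G u) ->
  \int[mu]_w G (X w) = \esum_(u in [set: U]) (G u * mu [set w | X w = u]).
Proof.
move=> G0; pose F k := [set w | pickle (X w) = k].
have mF k : measurable (F k).
  exact: (measurable_countable_preimage [set u | pickle u = k]).
have -> : [set: Omega] = \bigcup_k F k.
  by apply/seteqP; split=> // w _; exists (pickle (X w)).
rewrite ge0_integral_bigcup//; last 2 first.
- by apply: measurable_funS (measurable_fun_countable G); last exact: subsetT.
- by move=> i j _ _ [w [/= <- <-]].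
rewrite nneseries_esumT; last by move=> k; apply: integral_ge0 => w _.
rewrite (esumID (pickle @` [set: U])); last first.
  by move=> k _; apply: integral_ge0 => w _.
rewrite setTI [X in _ + X]esum1 ?adde0; last first.
  move=> k [_ /= nk]; rewrite (_ : F k = set0) ?integral_set0//.
  by apply/seteqP; split=> // w /= Fw; apply: nk; exists (X w).
rewrite esum_image; last by move=> u v _ _; exact: (pcan_inj pickleK).
apply: eq_esum => u _.
have -> : F (pickle u) = [set w | X w = u].
  by rewrite /F; apply/seteqP; split=> w /= => [/(pcan_inj pickleK)|->].
rewrite -integral_cst//; apply: eq_integral => w.
by rewrite inE /= => ->.
Qed.

End countable_valued.

(** * Weighted path densities of a process with independent increments on a grid *)

Section grid_process.
Context {R : realType} {d : measure_display} {Omega : measurableType d}.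
Variable mu : {measure set Omega -> \bar R}.
Hypothesis mu1 : mu setT = 1%E.
Variables (T : countType) (D : nat -> Omega -> T) (nu : nat -> T -> \bar R).

(** The history is stored most recent increment first: a further step is a [cons], and independence
    is only asked between [D n] and the exact history. *)
Fixpoint rtrace n w : seq T := if n is n'.+1 then D n' w :: rtrace n' w else [::].

Hypothesis mD : forall n l, measurable [set w | D n w = l].
Hypothesis nu_ge0 : forall n l, (0 <= nu n l)%E.
Hypothesis D_indep : forall n s l,
  (mu [set w | rtrace n w = s /\ D n w = l] = nu n l * mu [set w | rtrace n w = s])%E.
Local Open Scope ereal_scope.

Lemma measurable_rtrace n s : measurable [set w | rtrace n w = s].
Proof.
elim: n s => [|n IH] [|l s] /=.
- by rewrite (_ : mkset _ = setT)//; apply/seteqP; split.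
- by rewrite (_ : mkset _ = set0)//; apply/seteqP; split.
- by rewrite (_ : mkset _ = set0)//; apply/seteqP; split.
rewrite (_ : mkset _ = [set w | D n w = l] `&` [set w | rtrace n w = s]).
  exact: measurableI.
by apply/seteqP; split=> w /= => [[]|[-> ->]].
Qed.

Lemma grid_step n (H : seq T -> T -> \bar R) : (forall s l, 0 <= H s l) ->
  \int[mu]_w H (rtrace n w) (D n w) =
  \esum_(l in [set: T]) (nu n l * \int[mu]_w H (rtrace n w) l).
Proof.
move=> H0.
have mpair (u : seq T * T) : measurable [set w | (rtrace n w, D n w) = u].
  case: u => s l; rewrite (_ : mkset _ = [set w | rtrace n w = s] `&` [set w | D n w = l]).
    by apply: measurableI => //; exact: measurable_rtrace.
  by apply/seteqP; split=> w /= => [[]|[-> ->]].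
rewrite (integral_countable mu mpair (G := fun u => H u.1 u.2))//=.
rewrite esum_pairT; last by move=> i; rewrite mule_ge0.
rewrite esum_swap; last by move=> i j; rewrite mule_ge0.
apply: eq_esum => l _.
rewrite (integral_countable mu (measurable_rtrace n) (G := H ^~ l))//.
rewrite -esumZl//; last by move=> s; rewrite mule_ge0.
apply: eq_esum => s _ /=; rewrite muleCA; congr (_ * _).
rewrite -D_indep; congr (mu _).
by apply/seteqP; split=> w /= [-> ->].
Qed.

Variables (phi : nat -> T -> R) (z : T -> int) (theta : R).
Hypothesis phi_ge0 : forall n l, (0 <= phi n l)%R.
Hypothesis theta_ge0 : (0 <= theta)%R.

Definition position (s : seq T) : int := (\sum_(l <- s) z l)%R.

(** The reward is collected at the position before each step, hence at times [0] to [n - 1]. Since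
    the list is reversed, [size s'] is the time index of its head. *)
Fixpoint weight (s : seq T) : R :=
  if s is l :: s' then
    weight s' * (1 + theta * (position s' == 0%R)%:R) * phi (size s') l
  else 1.

Lemma weight_ge0 s : (0 <= weight s)%R.
Proof.
elim: s => //= l s IH.
by rewrite !mulr_ge0// addr_ge0// mulr_ge0.
Qed.

Lemma size_rtrace n w : size (rtrace n w) = n.
Proof. by elim: n => //= n ->. Qed.

Lemma weight_rtrace n w : weight (rtrace n w) =
  (\prod_(i < n) (1 + theta * (position (rtrace i w) == 0)%:R) *
   \prod_(i < n) phi i (D i w))%R.
Proof.
elim: n => [|n IH] /=; first by rewrite !big_ord0 mulr1.
rewrite !big_ord_recr/= IH size_rtrace; ring.
Qed.

Lemma step_kernel_ge0 n x :
  0 <= \esum_(l in [set: T]) (nu n l * (phi n l * (z l == x)%:R)%:E).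
Proof.
by apply: esum_ge0 => l _; rewrite mule_ge0// lee_fin mulr_ge0.
Qed.

Definition step_kernel n : nnfun R := NNFun (step_kernel_ge0 n).

Lemma at0_ge0 (f : nnfun R) (x : int) : 0 <= if x == 0%R then f 0%R else 0.
Proof. by case: ifP => // _; exact: nnfun_ge0. Qed.

Definition at0 (f : nnfun R) : nnfun R := NNFun (at0_ge0 f).

(** The reward [1 + theta 1_0] acts by pointwise multiplication, which is not a convolution; it is
    expressed by adding [theta] times the restriction to the origin before convolving with the
    step. *)
Fixpoint pinned (r : nat -> nnfun R) n : nnfun R :=
  if n is n'.+1 then (r n' * (pinned r n' + pt theta * at0 (pinned r n')))%R else 1%R.

(** Discrete Feynman-Kac formula, by conditioning on the history before the last increment. *)
Lemma pinnedE n x : pinned step_kernel n x =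
  \int[mu]_w (weight (rtrace n w) * (position (rtrace n w) == x)%:R)%:E.
Proof.
elim: n x => [|n IH] x.
  rewrite [LHS]nnfun1E /= /position big_nil mul1r eq_sym.
  transitivity (\int[mu]_w (cst ((0%R == x)%:R)%:E w)); last by [].
  by rewrite integral_cst// mu1 mule1; case: eqP.
pose H s l := (weight (l :: s) * (position (l :: s) == x)%:R)%:E.
rewrite [RHS](grid_step _ (H := H)); last first.
  by move=> s l; rewrite lee_fin mulr_ge0// weight_ge0.
pose B : nnfun R := (pinned step_kernel n + pt theta * at0 (pinned step_kernel n))%R.
transitivity (\esum_(l in [set: T]) (nu n l * ((phi n l)%:E * B (x - z l)%R))).
  rewrite [LHS]nnfunME.
  transitivity (\esum_(y in [set: int]) \esum_(l in [set: T])
      (nu n l * (phi n l * (z l == y)%:R)%:E * B (x - y)%R)).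
    apply: eq_esum => y _; rewrite muleC -esumZl ?nnfun_ge0//; last first.
      by move=> l; rewrite mule_ge0// lee_fin mulr_ge0.
    by apply: eq_esum => l _; rewrite muleC.
  rewrite esum_swap; last first.
    by move=> y l; rewrite !mule_ge0 ?nnfun_ge0// lee_fin mulr_ge0.
  apply: eq_esum => l _; rewrite (@esum_only _ _ (z l)).
  - by rewrite eqxx mulr1 muleA.
  - by move=> y; rewrite !mule_ge0 ?nnfun_ge0// lee_fin mulr_ge0.
  - by move=> y /negbTE; rewrite eq_sym => ->; rewrite mulr0 mule0 mul0e.
apply: eq_esum => l _; congr (_ * _).
have -> : B (x - z l)%R = (1 + theta * ((x - z l)%R == 0%R)%:R)%:E * pinned step_kernel n (x - z l)%R.
  rewrite /B nnfunDE ptME//=; case: eqP => [->|_].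
    by rewrite mulr1 EFinD ge0_muleDl ?lee_fin// mul1e.
  by rewrite mulr0 addr0 mule0 adde0 mul1e.
rewrite IH muleA -ge0_integralZl//.
- apply: eq_integral => w _; rewrite /H /= size_rtrace -EFinM; congr (_%:E).
  rewrite /position big_cons -/(position _).
  have -> : (z l + position (rtrace n w) == x)%R = (position (rtrace n w) == x - z l)%R.
    by rewrite [RHS]eq_sym subr_eq eq_sym addrC.
  have [->|/eqP/negbTE ->] := pselect (position (rtrace n w) = x - z l)%R; last by rewrite !mulr0.
  by rewrite eqxx; ring.
- exact: (measurable_fun_countable (measurable_rtrace n)
    (fun s => (weight s * (position s == x - z l)%:R)%:E)).
- by move=> w _; rewrite lee_fin mulr_ge0// weight_ge0.
- by rewrite -EFinM lee_fin mulr_ge0// addr_ge0// mulr_ge0.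
Qed.

End grid_process.

(** * The jumps of a walk during the successive intervals of a mesh *)

Section jump_lists.
Context {R : realType} {d : measure_display} {Omega : measurableType d}.
Variable P : probability Omega R.
Variables (J : int -> R) (N : R -> Omega -> nat) (xi : nat -> Omega -> int).
Hypothesis NP : rate1_poisson_counter P N.
Hypothesis xiJ : steps_with_law P J xi.
Hypothesis NxiI : independent_increments_steps P N xi.
Variable h : R.
Hypothesis h0 : 0 < h.

Let tau (n : nat) : R := n%:R * h.

Let tau_ge0 n : 0 <= tau n.
Proof. by rewrite mulr_ge0// ltW. Qed.

Let tauS n : tau n < tau n.+1.
Proof. by rewrite ltr_pM2r// ltr_nat. Qed.

Let tau0 : tau 0 = 0.
Proof. by rewrite /tau mul0r. Qed.

(** The whole list of jumps is kept, and not only their sum, because the tilt looks at individual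
    jumps. *)
Definition jumps (n : nat) w : seq int :=
  [seq xi j w | j <- iota (N (tau n) w) (N (tau n.+1) w - N (tau n) w)].

Definition list_law (l : seq int) : R :=
  h ^+ size l * (size l)`!%:R^-1 * expR (- h) * \prod_(x <- l) J x.

Lemma N_mono n w : (N (tau n) w <= N (tau n.+1) w)%N.
Proof. by apply: (counter_mono NP); rewrite ?tau_ge0// ltW. Qed.

Lemma jumpsP n w l : jumps n w = l <->
  (N (tau n.+1) w - N (tau n) w)%N = size l /\
  forall j, (j < size l)%N -> xi (N (tau n) w + j)%N w = nth 0 l j.
Proof.
split=> [<-|[e H]].
  rewrite size_map size_iota; split=> // j jl.
  by rewrite (nth_map 0%N) ?size_iota// nth_iota.
apply: (@eq_from_nth _ 0) => [|j]; first by rewrite size_map size_iota.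
rewrite size_map size_iota => jl.
by rewrite (nth_map 0%N) ?size_iota// nth_iota// H// -e.
Qed.

Lemma measurable_jumps n l : measurable [set w | jumps n w = l].
Proof.
rewrite (_ : mkset _ = \bigcup_a ([set w | N (tau n) w = a] `&`
    [set w | N (tau n.+1) w = (a + size l)%N] `&`
    \bigcap_(j in [set j | (j < size l)%N]) [set w | xi (a + j)%N w = nth 0 l j])).
  apply: bigcupT_measurable => a; apply: measurableI.
    by apply: measurableI; apply: (counter_meas NP); exact: tau_ge0.
  by apply: bigcap_measurableType => j _; exact: (step_meas xiJ).
apply/seteqP; split=> w /=.
  move=> /jumpsP[e H]; exists (N (tau n) w) => //; split=> //; split=> //.
  by rewrite -e subnKC// N_mono.
move=> [a _ [[<- e] H]]; apply/jumpsP; split; first by rewrite e addKn.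
by move=> j jl; exact: H.
Qed.

(** The jumps of an interval sit at random indices of [xi]. Once the entire history is prescribed,
    these indices become deterministic, and the event is an intersection to which the independence
    of increments and steps applies. *)
Lemma rtrace_jumpsP n w s : rtrace jumps n w = s <->
  [/\ size s = n,
      forall i, (i < n)%N -> (N (tau i.+1) w - N (tau i) w)%N = size (nth [::] (rev s) i) &
      forall j, (j < size (flatten (rev s)))%N -> xi j w = nth 0 (flatten (rev s)) j] .
Proof.
(* The induction also carries the number of jumps so far, which tells where in [xi] the next list
   starts. *)
suff : (rtrace jumps n w = s <->
  [/\ size s = n,
      forall i, (i < n)%N -> (N (tau i.+1) w - N (tau i) w)%N = size (nth [::] (rev s) i) &
      forall j, (j < size (flatten (rev s)))%N -> xi j w = nth 0 (flatten (rev s)) j]) /\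
  (rtrace jumps n w = s -> N (tau n) w = size (flatten (rev s))) by case.
elim: n s => [|n IH] [|l s].
- by split=> // _; rewrite tau0 (counter_start NP).
- by split=> //; split=> // -[].
- by split=> //; split=> // -[].
have [[IH1 IH1'] IH2] := IH s; rewrite /= rev_cons -cats1 flatten_cat /= cats0 size_cat.
have last_nth : size s = n -> nth [::] (rev s ++ [:: l]) n = l.
  by move=> <-; rewrite nth_cat size_rev ltnn subnn.
split; first split.
- move=> [/jumpsP[e He] /[dup] tr /IH1[sn Hi Hj]].
  have Nn := IH2 tr; split.
  + by rewrite sn.
  + move=> i; rewrite ltnS leq_eqVlt => /predU1P[->|i_n].
      by rewrite last_nth.
    by rewrite Hi// nth_cat size_rev sn i_n.
  + move=> j; rewrite nth_cat; case: (ltnP j (size (flatten (rev s)))) => [jl _|jl jl']; first exact: Hj.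
    rewrite -He; last by rewrite ltn_subLR.
    by rewrite Nn subnKC.
- move=> [[sn] Hi Hj].
  have tr : rtrace jumps n w = s.
    apply: IH1'; split=> // [i i_n|j jl].
      by rewrite Hi ?(ltn_trans i_n)// nth_cat size_rev sn i_n.
    by rewrite Hj ?ltn_addr// nth_cat jl.
  rewrite tr; congr (_ :: _); apply/jumpsP; split.
    by rewrite Hi// last_nth.
  by move=> j jl; rewrite (IH2 tr) Hj ?ltn_add2l// nth_cat ltnNge leq_addr/= addKn.
- move=> [/jumpsP[e _] tr]; rewrite -e -(IH2 tr) subnKC//; exact: N_mono.
Qed.

Lemma rtrace_jumps_law n s : P [set w | rtrace jumps n w = s] =
  (if size s == n then \prod_(l <- s) list_law l else 0)%:E.
Proof.
case: eqP => [sn|sn]; last first.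
  rewrite (_ : mkset _ = set0) ?measure0//; apply/seteqP; split=> // w /=.
  by move=> /rtrace_jumpsP[].
pose r := rev s; pose L := flatten r.
pose k i := size (nth [::] r i); pose x j := nth 0 L j.
have := NxiI (t := tau) k x (tau_ge0 0) (fun i => ltW (tauS i)).
move=> /(_ (map inl (iota 0 n) ++ map inr (iota 0 (size L)))).
have u : uniq ([seq inl i | i <- iota 0 n] ++ [seq inr i | i <- iota 0 (size L)] : seq (nat + nat)).
  rewrite cat_uniq !map_inj_uniq ?iota_uniq//; [|by move=> ? ? []|by move=> ? ? []].
  rewrite andbT /=; apply/hasPn => _ /mapP[j _ ->].
  by apply/negP => /mapP[].
move=> /(_ u); set E := \bigcap_(i in _) _ => PE.
have -> : [set w | rtrace jumps n w = s] = E.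
  apply/seteqP; split=> w /=.
    move=> /rtrace_jumpsP[_ Hi Hj] [i|j] /=.
      rewrite mem_cat => /orP[/mapP[i' + [->]]|/mapP[?? //]].
      by rewrite mem_iota add0n; exact: Hi.
    rewrite mem_cat => /orP[/mapP[?? //]|/mapP[j' + [->]]].
    by rewrite mem_iota add0n; exact: Hj.
  move=> Ew; apply/rtrace_jumpsP; split=> // [i i_n|j jl].
    apply: (Ew (inl i)); rewrite /= mem_cat map_f// mem_iota//.
  by apply: (Ew (inr j)); rewrite /= mem_cat (map_f inr) ?orbT// mem_iota.
rewrite PE big_cat/= !big_map.
rewrite [X in (X * _)%E](_ : _ = (\prod_(i <- iota 0 n)
    (h ^+ k i * (k i)`!%:R^-1 * expR (- h)))%:E); last first.
  rewrite -prodEFin; apply: eq_bigr => i _.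
  rewrite (counter_law NP) ?tau_ge0 ?tauS// /poisson_pmf /tau.
  have -> : i.+1%:R * h - i%:R * h = h by rewrite -natr1; ring.
  by rewrite h0.
rewrite [X in (_ * X)%E](_ : _ = (\prod_(j <- iota 0 (size L)) J (x j))%:E); last first.
  by rewrite -prodEFin; apply: eq_bigr => j _; rewrite (step_law xiJ).
rewrite -EFinM; congr (_%:E).
have -> : \prod_(j <- iota 0 (size L)) J (x j) = \prod_(y <- L) J y.
  by rewrite -(big_map x xpredT J) -[iota _ _]/(iota 0 (size L)) map_nth_iota0// take_size.
have -> : \prod_(i <- iota 0 n) (h ^+ k i * (k i)`!%:R^-1 * expR (- h)) =
    \prod_(l <- r) (h ^+ size l * (size l)`!%:R^-1 * expR (- h)).
  rewrite -(big_map (nth [::] r) xpredT (fun l => h ^+ size l * (size l)`!%:R^-1 * expR (- h))).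
  by rewrite map_nth_iota0 ?size_rev ?sn// take_oversize// size_rev sn.
rewrite big_flatten -big_split/= /r; apply: perm_big.
by rewrite perm_rev.
Qed.

Lemma jumps_indep n s l : (P [set w | rtrace jumps n w = s /\ jumps n w = l] =
  (list_law l)%:E * P [set w | rtrace jumps n w = s])%E.
Proof.
transitivity (P [set w | rtrace jumps n.+1 w = l :: s]).
  by congr (P _); apply/seteqP; split=> w /= => [[-> ->]|[-> ->]].
rewrite !rtrace_jumps_law /= eqSS; case: ifP => _; last by rewrite mule0.
by rewrite big_cons.
Qed.

Lemma list_law_ge0 l : (forall x, 0 <= J x) -> 0 <= list_law l.
Proof.
move=> J0; rewrite /list_law !mulr_ge0 ?expR_ge0 ?invr_ge0 ?ler0n ?exprn_ge0 ?(ltW h0)//.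
by apply: prodr_ge0.
Qed.

Definition displacement (l : seq int) : int := \sum_(x <- l) x.

Lemma walk_position n w :
  \sum_(j < N (tau n) w) xi j w = position displacement (rtrace jumps n w).
Proof.
elim: n => [|n IH]; first by rewrite /position/= big_nil tau0 (counter_start NP) big_ord0.
transitivity (displacement (jumps n w) + position displacement (rtrace jumps n w)); last first.
  by rewrite /position /= big_cons.
rewrite -IH /displacement /jumps big_map.
rewrite -!(big_mkord xpredT (xi ^~ w)) [RHS]addrC.
rewrite (big_cat_nat (n := N (tau n) w))//=; last exact: N_mono.
Qed.

End jump_lists.

(** * Sums over jump lists as compound Poisson laws *)

Section list_kernel.
Context {R : realType}.
Local Open Scope ereal_scope.

Lemma esum_seq (T : choiceType) (f : seq T -> \bar R) : (forall l, 0 <= f l) ->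
  \esum_(l in [set: seq T]) f l =
  f [::] + \esum_(x in [set: T]) \esum_(l in [set: seq T]) f (x :: l).
Proof.
move=> f0; rewrite (esumID [set [::]])// setTI esum_set1//; congr (_ + _).
rewrite setTI -(esum_pairT (f := fun p => f (p.1 :: p.2)))//.
rewrite -(esum_image _ (fun p : T * seq T => p.1 :: p.2)); last first.
  by move=> [x l] [y l'] _ _ /= [-> ->].
congr (esum _ _); apply/seteqP; split=> [[|x l] /= nl|_ [[x l] _ <-]//].
  by exfalso; exact: nl.
by exists (x, l).
Qed.

Lemma prod_ge0 (f : int -> \bar R) (l : seq int) : (forall x, 0 <= f x) ->
  0 <= \big[mule/1]_(x <- l) f x.
Proof.
by move=> f0; elim: l => [|x l IH]; rewrite ?big_nil// big_cons mule_ge0.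
Qed.

Lemma esum_lists_size (f : nnfun R) n y :
  \esum_(l in [set: seq int])
    (if (size l == n) && (displacement l == y) then \big[mule/1]_(x <- l) f x else 0) =
  (f ^+ n)%R y.
Proof.
have h0 m z (l : seq int) : 0 <= (if (size l == m) && (displacement l == z)
    then \big[mule/1]_(x <- l) f x else 0).
  by case: ifP => // _; apply: prod_ge0; exact: nnfun_ge0.
elim: n y => [|n IH] y.
  rewrite expr0 nnfun1E esum_seq//= /displacement big_nil big_nil eq_sym.
  rewrite [X in _ + X]esum1 ?adde0; last by move=> x _; rewrite esum1.
  by case: eqP.
rewrite esum_seq//= add0e exprS nnfunME; apply: eq_esum => x _.
rewrite -IH -esumZl ?nnfun_ge0//; apply: eq_esum => l _.
rewrite eqSS /displacement big_cons -/(displacement l) big_cons.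
rewrite (_ : (x + _ == y)%R = (displacement l == y - x)%R); last first.
  by rewrite [RHS]eq_sym subr_eq eq_sym addrC.
by case: ifP; rewrite ?mule0.
Qed.

Lemma esum_lists (f : nnfun R) y :
  \esum_(l in [set: seq int]) (((size l)`!%:R^-1)%:E *
    (if displacement l == y then \big[mule/1]_(x <- l) f x else 0)) = cp f y.
Proof.
have h0 (l : seq int) : 0 <= (if displacement l == y then \big[mule/1]_(x <- l) f x else 0).
  by case: ifP => // _; apply: prod_ge0; exact: nnfun_ge0.
rewrite /cp/=.
transitivity (\esum_(n in [set: nat]) \esum_(l in [set: seq int])
    ((n`!%:R^-1)%:E * (if (size l == n) && (displacement l == y)
       then \big[mule/1]_(x <- l) f x else 0))).
  rewrite esum_swap; last first.
    by move=> n l; rewrite mule_ge0 ?lee_fin ?invr_ge0//; case: ifP => // /andP[_ e];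
      have := h0 l; rewrite e.
  apply: eq_esum => l _; rewrite (@esum_only _ _ (size l)).
  - by rewrite eqxx.
  - move=> n; rewrite mule_ge0 ?lee_fin ?invr_ge0//.
    by case: ifP => // /andP[_ e]; have := h0 l; rewrite e.
  - by move=> n /negbTE; rewrite eq_sym => ->; rewrite mule0.
apply: eq_esum => n _; rewrite esumZl ?lee_fin ?invr_ge0// ?esum_lists_size//.
by move=> l; case: ifP => // /andP[_ e]; have := h0 l; rewrite e.
Qed.

End list_kernel.

Section kernels.
Context {R : realType}.
Local Open Scope ereal_scope.

Lemma prod_EFin (g : int -> R) (l : seq int) :
  \big[mule/1]_(x <- l) (g x)%:E = (\prod_(x <- l) g x)%R%:E.
Proof.
by elim: l => [|x l IH]; rewrite ?big_nil// !big_cons IH EFinM.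
Qed.

(** A density that is a product over the jumps only reweights the jump measure, from [h J] to
    [h J psi]; the normalisation [expR (- h)] is left unchanged. *)
Lemma list_kernel (J psi : int -> R) (h : R) (f : nnfun R) y : (0 <= h)%R ->
  (forall x, 0 <= J x)%R -> (forall x, 0 <= psi x)%R ->
  (forall x, f x = (h * (J x * psi x))%:E) ->
  \esum_(l in [set: seq int]) ((list_law J h l)%:E *
     ((\prod_(x <- l) psi x) * (displacement l == y)%:R)%:E) =
  (expR (- h))%:E * cp f y.
Proof.
move=> h0 J0 psi0 fE; rewrite -esum_lists -esumZl ?lee_fin ?expR_ge0//.
  apply: eq_esum => l _; rewrite /list_law.
  under [X in if _ then X else _]eq_bigr do rewrite fE.
  rewrite prod_EFin big_split/= big_split/=.
  have -> : (\prod_(x <- l) h = h ^+ size l)%R.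
    by elim: (l) => [|x l' IH]; rewrite ?big_nil// big_cons IH exprS.
  case: ifP => _; last by rewrite !mulr0 !mule0.
  by rewrite -!EFinM; congr (_%:E); rewrite mulr1; ring.
move=> l; rewrite mule_ge0 ?lee_fin ?invr_ge0//.
by case: ifP => // _; apply: prod_ge0 => x; exact: nnfun_ge0.
Qed.

Lemma list_total (J psi : int -> R) (h : R) (f : nnfun R) : (0 <= h)%R ->
  (forall x, 0 <= J x)%R -> (forall x, 0 <= psi x)%R ->
  (forall x, f x = (h * (J x * psi x))%:E) ->
  \esum_(l in [set: seq int]) ((list_law J h l)%:E * (\prod_(x <- l) psi x)%R%:E) =
  (expR (- h))%:E * total (cp f).
Proof.
move=> h0 J0 psi0 fE; rewrite /total -esumZl ?lee_fin ?expR_ge0//; last first.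
  exact: nnfun_ge0.
have p0 (l : seq int) : (0 <= \prod_(x <- l) psi x)%R by apply: prodr_ge0.
have l0 l : (0 <= list_law J h l)%R.
  rewrite /list_law !mulr_ge0 ?expR_ge0 ?invr_ge0 ?ler0n ?exprn_ge0//.
  by apply: prodr_ge0.
transitivity (\esum_(y in [set: int]) \esum_(l in [set: seq int]) ((list_law J h l)%:E *
     ((\prod_(x <- l) psi x) * (displacement l == y)%:R)%:E)).
  rewrite [RHS]esum_swap; last first.
    by move=> y l; rewrite -EFinM lee_fin; exact: mulr_ge0 (l0 l) (mulr_ge0 (p0 l) (ler0n _ _)).
  apply: eq_esum => l _; rewrite (@esum_only _ _ (displacement l)).
  - by rewrite eqxx mulr1.
  - by move=> y; rewrite -EFinM lee_fin; exact: mulr_ge0 (l0 l) (mulr_ge0 (p0 l) (ler0n _ _)).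
  - by move=> y /negbTE; rewrite eq_sym => ->; rewrite mulr0 mule0.
by apply: eq_esum => y _; exact: list_kernel.
Qed.

(** A difference of independent increments has as law the convolution with the reflected second law;
    evenness of [k2] removes the reflection. *)
Lemma pair_kernel (T1 T2 : choiceType) (n1 : T1 -> R) (n2 : T2 -> R)
    (p2 : T2 -> R) (z1 : T1 -> int) (z2 : T2 -> int) (k1 k2 : nnfun R) y :
  (forall l, 0 <= n1 l)%R -> (forall l, 0 <= n2 l)%R -> (forall l, 0 <= p2 l)%R ->
  even k2 ->
  (forall x, \esum_(l in [set: T1]) ((n1 l)%:E * ((z1 l == x)%:R)%:E) = k1 x) ->
  (forall x, \esum_(l in [set: T2]) ((n2 l)%:E * (p2 l * (z2 l == x)%:R)%:E) = k2 x) ->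
  \esum_(l in [set: T1 * T2]) ((n1 l.1 * n2 l.2)%:E *
     (p2 l.2 * ((z1 l.1 - z2 l.2)%R == y)%:R)%:E) = (k1 * k2)%R y.
Proof.
move=> n10 n20 p20 ek h1 h2.
rewrite esum_pairT/=; last first.
  by move=> l; rewrite -EFinM lee_fin !mulr_ge0.
transitivity (\esum_(l1 in [set: T1]) ((n1 l1)%:E * k2 (z1 l1 - y)%R)).
  apply: eq_esum => l1 _; rewrite -h2 -esumZl ?lee_fin//; last first.
    by move=> l; rewrite -EFinM lee_fin !mulr_ge0.
  apply: eq_esum => l2 _; rewrite EFinM -muleA; congr (_ * (_ * (_ * _%:R)%:E)).
  by rewrite subr_eq addrC -subr_eq eq_sym.
transitivity (\esum_(l1 in [set: T1]) \esum_(x in [set: int])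
    ((n1 l1)%:E * ((z1 l1 == x)%:R)%:E * k2 (y - x)%R)).
  apply: eq_esum => l1 _; rewrite (@esum_only _ _ (z1 l1)).
  - by rewrite eqxx mule1 -(ek (y - _)%R) opprB.
  - by move=> x; rewrite !mule_ge0 ?lee_fin ?nnfun_ge0.
  - by move=> x /negbTE; rewrite eq_sym => ->; rewrite mule0 mul0e.
rewrite esum_swap; last by move=> l x; rewrite !mule_ge0 ?lee_fin ?nnfun_ge0.
apply: eq_esum => x _; rewrite -h1 muleC -esumZl ?nnfun_ge0//.
  by apply: eq_esum => l _; rewrite muleC.
by move=> l; rewrite mule_ge0 ?lee_fin.
Qed.

End kernels.

Section grid_products.
Context {R : realType} {d : measure_display} {Omega : measurableType d}.
Variable mu : {measure set Omega -> \bar R}.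
Hypothesis mu1 : mu setT = 1%E.
Variables (T : countType) (D : nat -> Omega -> T) (nu : nat -> T -> \bar R).
Hypothesis mD : forall n l, measurable [set w | D n w = l].
Hypothesis nu_ge0 : forall n l, (0 <= nu n l)%E.
Hypothesis D_indep : forall n s l,
  (mu [set w | rtrace D n w = s /\ D n w = l] = nu n l * mu [set w | rtrace D n w = s])%E.
Variable g : nat -> T -> R.
Hypothesis g_ge0 : forall n l, 0 <= g n l.
Local Open Scope ereal_scope.

Fixpoint trace_prod (s : seq T) : R :=
  if s is l :: s' then (trace_prod s' * g (size s') l)%R else 1.

Lemma trace_prod_ge0 s : (0 <= trace_prod s)%R.
Proof. by elim: s => //= l s IH; rewrite mulr_ge0. Qed.

Lemma trace_prodE n w : (trace_prod (rtrace D n w) = \prod_(i < n) g i (D i w))%R.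
Proof.
elim: n => [|n IH]; first by rewrite big_ord0.
by rewrite big_ord_recr/= IH size_rtrace.
Qed.

Lemma integral_grid_prod n (c : nat -> R) :
  (forall i, \esum_(l in [set: T]) (nu i l * (g i l)%:E) = (c i)%:E) ->
  \int[mu]_w (\prod_(i < n) g i (D i w))%R%:E = (\prod_(i < n) c i)%R%:E.
Proof.
move=> gc; under eq_integral do rewrite -trace_prodE.
elim: n => [|n IH].
  by rewrite big_ord0 /= -[RHS]mul1e -mu1 -integral_cst.
rewrite big_ord_recr/=.
rewrite (@grid_step _ _ _ mu _ D nu mD nu_ge0 D_indep n
  (fun s l => (trace_prod s * g (size s) l)%:E)); last first.
  by move=> s l; rewrite lee_fin mulr_ge0// trace_prod_ge0.
transitivity (\esum_(l in [set: T]) ((\prod_(i < n) c i)%R%:E * (nu n l * (g n l)%:E))).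
  apply: eq_esum => l _; rewrite muleCA; congr (_ * _).
  rewrite -IH muleC -ge0_integralZl//.
  - by apply: eq_integral => w _; rewrite size_rtrace EFinM muleC.
  - exact: (measurable_fun_countable (measurable_rtrace mD n) (fun s => (trace_prod s)%:E)).
  - by move=> w _; rewrite lee_fin trace_prod_ge0.
  - by rewrite lee_fin.
rewrite esumZl ?gc ?EFinM//; last by move=> l; rewrite mule_ge0 ?lee_fin.
rewrite -IH; apply: integral_ge0 => w _; by rewrite lee_fin trace_prod_ge0.
Qed.

End grid_products.

(** * Discrete renewal estimates *)

Section discrete_renewal.
Context {R : realType}.
Implicit Types (u k v : nat -> R).

(** With [theta * k 1], [theta * k 2], ... as interarrival probabilities, this is the probability of
    no renewal up to [n]; [k 0] is not part of that law. *)
Definition tail_mass (theta : R) k n := 1 - theta * \sum_(i < n) k i.+1.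

(** Decomposition at the last renewal up to [N]. The origin is rewarded as well, so that at positive
    times [u] is [1 + theta] times the usual renewal density, which explains the total
    [1 + theta]. *)
Lemma renewal_identity theta k u N : k 0%N = 1 ->
  (forall n, u n = k n + theta * \sum_(i < n) u i * k (n - i)%N) ->
  1 + theta = tail_mass theta k N + theta * \sum_(i < N.+1) u i * tail_mass theta k (N - i)%N.
Proof.
move=> k0 uE; elim: N => [|N IH].
  rewrite big_ord_recl big_ord0 /= /tail_mass !big_ord0 uE big_ord0 k0; ring.
have step m : tail_mass theta k m.+1 = tail_mass theta k m - theta * k m.+1.
  rewrite /tail_mass big_ord_recr/=; ring.
rewrite IH [in RHS](big_ord_recr N.+1)/= subnn.
have -> : \sum_(i < N.+1) u i * tail_mass theta k (N.+1 - i)%N =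
    \sum_(i < N.+1) u i * tail_mass theta k (N - i)%N -
    theta * \sum_(i < N.+1) u i * k (N.+1 - i)%N.
  rewrite mulr_sumr -sumrB; apply: eq_bigr => i _.
  rewrite subSn ?step; last by rewrite -ltnS.
  ring.
have t0 : tail_mass theta k 0 = 1 by rewrite /tail_mass big_ord0 mulr0 subr0.
rewrite step (uE N.+1) t0; ring.
Qed.

(** The ratios [b (n + 1) / b n] are nondecreasing, so one ratio above [1] would force geometric
    growth and contradict boundedness. *)
Lemma logconvex_noninc (b : nat -> R) (M : R) : (forall n, 0 < b n) ->
  (forall n, b n.+1 ^+ 2 <= b n * b n.+2) -> (forall n, b n <= M) ->
  forall n, b n.+1 <= b n.
Proof.
move=> b0 bb bM n; rewrite leNgt; apply/negP => lt_b.
pose q := b n.+1 / b n.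
have q1 : 1 < q by rewrite /q ltr_pdivlMr// mul1r.
have ratio j : q * b (n + j)%N <= b (n + j).+1.
  elim: j => [|j IH]; first by rewrite addn0 /q divfK// gt_eqF.
  rewrite addnS; have := bb (n + j)%N; have := b0 (n + j)%N; have := b0 (n + j).+1.
  set x := b (n + j)%N in IH *; set y := b (n + j).+1 in IH *; set w := b (n + j).+2.
  move=> y0 x0 h.
  rewrite -(ler_pM2l x0); apply: le_trans h; rewrite mulrA expr2 [x * q]mulrC ler_pM2r//.
have pw j : q ^+ j * b n <= b (n + j)%N.
  elim: j => [|j IH]; first by rewrite addn0 mul1r.
  rewrite exprS -mulrA addnS; apply: le_trans (ratio j).
  by rewrite ler_pM2l// (lt_trans ltr01).
have M0 : 0 < M / b n by rewrite divr_gt0// (lt_le_trans (b0 0%N)).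
have qj j : 1 + j%:R * (q - 1) <= q ^+ j.
  elim: j => [|j IH]; first by rewrite mul0r addr0.
  rewrite exprS -natr1; have := ler_wpM2l (ltW (lt_trans ltr01 q1)) IH.
  have : 0 <= j%:R * ((q - 1) * (q - 1)) by rewrite !mulr_ge0// subr_ge0 ltW.
  lra.
pose j := (Num.truncn (M / b n / (q - 1))).+1.
have q10 : 0 < q - 1 by rewrite subr_gt0.
have : M / b n < j%:R * (q - 1) by rewrite -ltr_pdivrMr// truncnS_gt.
move=> h; have := pw j; have := bM (n + j)%N; have := qj j.
rewrite ltr_pdivrMr// in h.
have := b0 n; set x := q ^+ j; set y := j%:R * (q - 1) in h *.
move=> xp h1 h2 h3; have : x * b n <= M by exact: le_trans h3 h2.
nra.
Qed.

Lemma sum_powR_scaled (a delta : R) (N : nat) : 0 <= a -> a < 1 -> 0 < delta ->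
  delta * \sum_(j < N) (j.+1%:R * delta) `^ (- a) <= (N%:R * delta) `^ (1 - a) / (1 - a).
Proof.
move=> a0 a1 d0.
have -> : \sum_(j < N) (j.+1%:R * delta) `^ (- a) = delta `^ (- a) * \sum_(j < N) j.+1%:R `^ (- a).
  by rewrite mulr_sumr; apply: eq_bigr => j _; rewrite powRM ?(ltW d0)// mulrC.
rewrite powRM ?(ltW d0)// mulrA.
have -> : delta * delta `^ (- a) = delta `^ (1 - a) by rewrite powRDp// powRr1 ?(ltW d0).
have := ler_wpM2l (powR_ge0 delta (1 - a)) (sum_powR_le N a0 a1).
by rewrite !mulrA [X in _ <= X / _]mulrC.
Qed.

(* [k] plays the role of the (normalised) interarrival density on the mesh
   [delta], and [u] is the corresponding renewal density. *)
Record renewal_setting (a beta c1 C1 c2 C2 delta S : R) k u : Prop := {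
  rs_delta : 0 < delta ; rs_delta1 : delta <= 1 ;
  rs_k0 : k 0%N = 1 ; rs_kge0 : forall n, 0 <= k n ;
  rs_khi : forall n, (0 < n)%N -> k n <= C1 * (n%:R * delta) `^ (- (1 + a)) ;
  rs_klo : forall n, c1 * (1 + n%:R * delta) `^ (- (1 + a)) <= k n ;
  rs_tail0 : forall n, 0 <= tail_mass (beta * delta) k n ;
  rs_taillo : forall n, 1 <= n%:R * delta ->
    c2 * (n%:R * delta) `^ (- a) <= tail_mass (beta * delta) k n ;
  rs_tailhi : forall n, (0 < n)%N -> n%:R * delta <= S ->
    tail_mass (beta * delta) k n <= C2 * (n%:R * delta) `^ (- a) ;
  rs_u : forall n, u n = k n + beta * delta * \sum_(i < n) u i * k (n - i)%N ;
  rs_u0 : forall n, 0 < u n ;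
  rs_mono : forall i j, (i <= j)%N -> u j <= 3 * u i }.

Lemma tail_mass_noninc theta k m n : 0 <= theta -> (forall i, 0 <= k i) ->
  (m <= n)%N -> tail_mass theta k n <= tail_mass theta k m.
Proof.
move=> t0 k0 mn; rewrite /tail_mass lerD2l lerN2 ler_wpM2l//.
rewrite -(subnKC mn) big_split_ord/= lerDl sumr_ge0//.
Qed.

Lemma tail_mass_le1 theta k n : 0 <= theta -> (forall i, 0 <= k i) ->
  tail_mass theta k n <= 1.
Proof.
by move=> t0 k0; rewrite /tail_mass lerBlDr lerDl mulr_ge0// sumr_ge0.
Qed.

Section bounds.
Variables a beta c1 C1 c2 C2 : R.
Hypotheses (a0 : 0 < a) (a1 : a < 1) (beta0 : 0 < beta) (c10 : 0 < c1)
  (C10 : 0 < C1) (c20 : 0 < c2) (C20 : 0 < C2).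

Lemma renewal_sum_le delta S k u n : renewal_setting a beta c1 C1 c2 C2 delta S k u ->
  beta * delta * (\sum_(i < n.+1) u i) * tail_mass (beta * delta) k n <= 1 + beta.
Proof.
case=> d0 d1 k0 kge khi klo t0 tlo thi uE up um.
have th0 : 0 <= beta * delta by rewrite mulr_ge0// ltW.
apply: (@le_trans _ _ (1 + beta * delta)); last by rewrite lerD2l ger_pMr.
rewrite (renewal_identity n k0 uE) -mulrA ler_wpDl ?t0//.
rewrite ler_wpM2l// mulr_suml; apply: ler_sum => i _.
by rewrite ler_pM2l//; apply: tail_mass_noninc => //; exact: leq_subr.
Qed.

(** By quasi-monotonicity, [n * u n] is at most three times the sum of [u] up to [n], and the
    renewal identity bounds that sum by the inverse of the tail mass, of order [t ^ a]. For times
    below [1], [u n <= 3 * u 0 = 3] is enough. *)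
Lemma renewal_upper : exists2 C : R, 0 < C & forall delta S k u,
  renewal_setting a beta c1 C1 c2 C2 delta S k u ->
  forall n, (0 < n)%N -> u n <= C * (n%:R * delta) `^ (a - 1).
Proof.
exists (Num.max 3 (3 * (1 + beta) / (beta * c2))); first by rewrite lt_max ltr0n.
move=> delta S k u rs n n0; have sumle := renewal_sum_le n rs.
case: rs => d0 d1 k0 kge khi klo t0 tlo thi uE up um.
have nd : 0 < n%:R * delta by rewrite mulr_gt0// ltr0n.
have [t1|t1] := leP 1 (n%:R * delta); last first.
  apply: (@le_trans _ _ (3 * (n%:R * delta) `^ (a - 1))); last first.
    by rewrite ler_pM2r ?powR_gt0// le_max lexx.
  apply: le_trans (um 0%N n isT) _; rewrite uE big_ord0 mulr0 addr0 k0 ler_pM2l// -opprB.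
  have a1' : 0 <= 1 - a by rewrite subr_ge0 ltW.
  by have := powR_le_neg nd (ltW t1) a1'; rewrite powR1.
apply: (@le_trans _ _ (3 * (1 + beta) / (beta * c2) * (n%:R * delta) `^ (a - 1))); last first.
  by rewrite ler_pM2r ?powR_gt0// le_max lexx orbT.
have s1 : n%:R * u n <= 3 * \sum_(i < n.+1) u i.
  rewrite big_ord_recr/= mulrDr mulr_sumr.
  apply: ler_wpDr; first by rewrite mulr_ge0// ltW.
  rewrite -[n in n%:R]card_ord -sumr_const mulr_suml; apply: ler_sum => i _.
  by rewrite mul1r um// ltnW.
have tl := tlo n t1.
have P0 : 0 < (n%:R * delta) `^ (- a) by rewrite powR_gt0.
have e : (n%:R * delta) `^ (a - 1) = ((n%:R * delta) * (n%:R * delta) `^ (- a))^-1.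
  by rewrite -[X in (X * _)^-1]powRr1 ?(ltW nd)// -powRDp// -powRN opprD opprK addrC.
rewrite e; set P := _ `^ _ in tl P0 *.
rewrite (ler_pdivlMr _ _ (mulr_gt0 nd P0)) (ler_pdivlMr _ _ (mulr_gt0 beta0 c20)).
have : beta * delta * (n%:R * u n) * (c2 * P) <= 3 * (1 + beta).
  apply: (@le_trans _ _ (beta * delta * (3 * \sum_(i < n.+1) u i) * tail_mass (beta * delta) k n)).
    apply: ler_pM => //.
    - by rewrite !mulr_ge0// ?ltW.
    - by rewrite mulr_ge0// ltW.
    - by rewrite ler_pM2l// mulr_gt0.
  rewrite [leLHS](_ : _ = 3 * (beta * delta * (\sum_(i < n.+1) u i) * tail_mass (beta * delta) k n)); last by ring.
  by rewrite ler_pM2l.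
by apply: le_trans; rewrite le_eqVlt; apply/orP; left; apply/eqP; ring.
Qed.

Lemma tail_sum_le delta S k u n : renewal_setting a beta c1 C1 c2 C2 delta S k u ->
  1 <= n%:R * delta -> n%:R * delta <= S ->
  beta * delta * \sum_(j < n) tail_mass (beta * delta) k j <=
    beta * (1 + C2 / (1 - a)) * (n%:R * delta) `^ (1 - a).
Proof.
case=> d0 d1 k0 kge khi klo t0 tlo thi uE up um n1 nS.
have nd : 0 < n%:R * delta := lt_le_trans ltr01 n1.
have a1' : 0 < 1 - a by rewrite subr_gt0.
have th0 : 0 <= beta * delta by rewrite mulr_ge0// ltW.
case: n => [|n] in n1 nS nd *; first by rewrite mul0r ltxx in nd.
rewrite -!mulrA ler_pM2l// big_ord_recl/= mulrDr mulrDl mul1r; apply: lerD.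
  apply: (@le_trans _ _ 1); last by apply: powR_ge1 => //; exact: ltW.
  by apply: mulr_ile1 => //; [exact: ltW|exact: tail_mass_le1].
apply: (@le_trans _ _ (C2 * (delta * \sum_(j < n.+1) (j.+1%:R * delta) `^ (- a)))).
  rewrite mulrCA ler_pM2l// mulr_sumr [leRHS]big_ord_recr/=.
  apply: ler_wpDr; first by rewrite mulr_ge0 ?powR_ge0// ltW.
  apply: ler_sum => j _; apply: thi => //.
  apply: le_trans nS; rewrite ler_pM2r// ler_nat.
  by rewrite ltnW// ltnS.
rewrite -mulrA ler_pM2l// [leRHS]mulrC; apply: sum_powR_scaled => //; exact: ltW.
Qed.

(* [L] and [A] are chosen so that renewals up to [n] and the event that there is
   none up to [n * L] account for at most half of the renewal identity at [n * L]. *)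
Lemma renewal_lower : exists (c A : R) (L : nat), [/\ 0 < c, 1 <= A, (1 < L)%N &
  forall delta S k u, renewal_setting a beta c1 C1 c2 C2 delta S k u ->
  forall n, A <= n%:R * delta -> (n * L)%:R * delta <= S ->
    c * (n%:R * delta) `^ (a - 1) <= u n].
Proof.
have ai0 : 0 <= a^-1 by rewrite invr_ge0 ltW.
pose K := C2 * (1 + beta) / c2.
have K0 : 0 < K by rewrite divr_gt0// mulr_gt0// addr_gt0.
pose L := (Num.truncn ((4 * K) `^ a^-1)).+2.
pose A := Num.max 1 ((4 * C2) `^ a^-1).
have A1 : 1 <= A by rewrite le_max lexx.
have HA t : A <= t -> C2 * t `^ (- a) <= 4^-1.
  move=> At; have t0 : 0 < t by apply: lt_le_trans At; exact: lt_le_trans A1.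
  rewrite powRN ler_pdivrMr ?powR_gt0//.
  have : ((4 * C2) `^ a^-1) `^ a <= t `^ a.
    apply: powR_le_base; rewrite ?powR_ge0 ?(ltW a0)//.
    by apply: le_trans At; rewrite le_max lexx orbT.
  rewrite -powRrM mulVf ?gt_eqF// powRr1; last by rewrite mulr_ge0// ltW.
  lra.
have HL : K * L.-1%:R `^ (- a) <= 4^-1.
  have L0 : 0 < L.-1%:R :> R by rewrite ltr0n.
  rewrite powRN ler_pdivrMr ?powR_gt0//.
  have : ((4 * K) `^ a^-1) `^ a <= L.-1%:R `^ a.
    by apply: powR_le_base; rewrite ?powR_ge0 ?(ltW a0)// ltW// truncnS_gt.
  rewrite -powRrM mulVf ?gt_eqF// powRr1; last by rewrite mulr_ge0// ltW.
  lra.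
pose B := beta * (1 + C2 / (1 - a)) * L%:R `^ (1 - a).
have a1' : 0 < 1 - a by rewrite subr_gt0.
have B0 : 0 < B by rewrite !mulr_gt0 ?powR_gt0 ?ltr0n// addr_gt0// divr_gt0.
exists (6 * B)^-1, A, L; split=> //; first by rewrite invr_gt0; apply: mulr_gt0.
move=> delta S k u rs n An nLS.
have sumle := renewal_sum_le n rs; have taille := tail_sum_le (n := n * L) rs.
case: rs => d0 d1 k0 kge khi klo t0 tlo thi uE up um.
have th0 : 0 < beta * delta by rewrite mulr_gt0.
have nd : 0 < n%:R * delta by apply: lt_le_trans An; exact: lt_le_trans A1.
have n0 : (0 < n)%N by rewrite -(ltr0n R) -(pmulr_lgt0 _ d0).
have n1 : 1 <= n%:R * delta by exact: le_trans An.
have nL : n%:R * delta <= (n * L)%:R * delta by rewrite ler_pM2r// ler_nat leq_pmulr.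
have {}taille := taille (le_trans n1 nL) nLS.
have id := renewal_identity (n * L) k0 uE.
have T1 : tail_mass (beta * delta) k (n * L) <= 4^-1.
  apply: le_trans (HA _ (le_trans An nL)); apply: thi => //.
  by rewrite muln_gt0 n0.
(* Beyond [n], quasi-monotonicity replaces [u] by [3 * u n]; this is the only place where [u n]
   enters the identity, and the lower bound is read off from it. *)
have split_sum : \sum_(i < (n * L).+1) u i * tail_mass (beta * delta) k (n * L - i)%N <=
   (\sum_(i < n.+1) u i) * tail_mass (beta * delta) k (n * L - n)%N +
   3 * u n * \sum_(j < n * L) tail_mass (beta * delta) k j.
  have -> : ((n * L).+1 = n.+1 + (n * L - n))%N by rewrite addSn subnKC// leq_pmulr.
  rewrite big_split_ord/=; apply: lerD.
    rewrite mulr_suml; apply: ler_sum => i _; rewrite ler_pM2l//.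
    by apply: tail_mass_noninc => //; [exact: ltW|apply: leq_sub2l; rewrite -ltnS].
  rewrite [X in _ <= _ * X](_ : _ = \sum_(j < (n * L - n) + n) tail_mass (beta * delta) k j); last first.
    by rewrite subnK// leq_pmulr.
  rewrite [X in _ <= _ * X]big_split_ord/= mulrDr; apply: ler_wpDr.
    by rewrite mulr_ge0// ?sumr_ge0// mulr_ge0// ltW.
  rewrite mulr_sumr [leRHS](reindex_inj rev_ord_inj)/=.
  apply: ler_sum => i _.
  have -> : (n * L - n - i.+1 = n * L - (n.+1 + i))%N by rewrite -subnDA addnS addSn.
  by apply: ler_wpM2r => //; apply: um; rewrite addSn -addnS leq_addr.
have T2 : beta * delta * (\sum_(i < n.+1) u i) * tail_mass (beta * delta) k (n * L - n)%N <= 4^-1.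
  have Kn : 0 < tail_mass (beta * delta) k n.
    by apply: lt_le_trans (tlo _ n1); rewrite mulr_gt0// powR_gt0.
  have h1 : beta * delta * (\sum_(i < n.+1) u i) <= (1 + beta) / (c2 * (n%:R * delta) `^ (- a)).
    rewrite ler_pdivlMr ?mulr_gt0 ?powR_gt0//; apply: le_trans sumle.
    by rewrite ler_wpM2l ?tlo// mulr_ge0 ?(ltW th0)// sumr_ge0// => i _; exact: ltW.
  have eL : (n * L - n)%N%:R * delta = L.-1%:R * (n%:R * delta).
    by rewrite mulrA -natrM; congr (_%:R * _); rewrite mulnC -[X in (_ - X)%N]mul1n -mulnBl subn1.
  have h2 : tail_mass (beta * delta) k (n * L - n) <= C2 * (L.-1%:R * (n%:R * delta)) `^ (- a).
    rewrite -eL; apply: thi; first by rewrite subn_gt0 -[X in (X < _)%N]muln1 ltn_pmul2l.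
    by apply: le_trans nLS; rewrite ler_pM2r// ler_nat leq_subr.
  apply: le_trans (ler_pM _ _ h1 h2) _ => //.
    by rewrite mulr_ge0 ?(ltW th0)// sumr_ge0// => i _; exact: ltW.
  apply: le_trans HL; rewrite (powRM _ (ler0n _ _) (ltW nd)).
  rewrite le_eqVlt; apply/orP; left; apply/eqP; rewrite /K; field.
  by rewrite !gt_eqF ?powR_gt0.
have main : 1 <= 2^-1 + 3 * u n * (B * (n%:R * delta) `^ (1 - a)).
  apply: (@le_trans _ _ (1 + beta * delta)); first by rewrite lerDl ltW.
  rewrite id; apply: le_trans (lerD T1 (ler_wpM2l (ltW th0) split_sum)) _.
  have -> : B * (n%:R * delta) `^ (1 - a) = beta * (1 + C2 / (1 - a)) * ((n * L)%:R * delta) `^ (1 - a).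
    have -> : (n * L)%:R * delta = L%:R * (n%:R * delta) by rewrite natrM; ring.
    by rewrite (powRM _ (ler0n _ _) (ltW nd)) /B; ring.
  have : beta * delta * (3 * u n * \sum_(j < n * L) tail_mass (beta * delta) k j) <=
     3 * u n * (beta * (1 + C2 / (1 - a)) * ((n * L)%:R * delta) `^ (1 - a)).
    by rewrite mulrCA ler_pM2l// mulr_gt0.
  move=> /(lerD T2); rewrite -[X in X + _ <= _]mulrA -mulrDr => /(lerD (lexx 4^-1))/le_trans; apply.
  by rewrite addrA lerD2r; lra.
have e : (n%:R * delta) `^ (a - 1) = ((n%:R * delta) `^ (1 - a))^-1.
  by rewrite -powRN opprB.
have P0 : 0 < (n%:R * delta) `^ (1 - a) by rewrite powR_gt0.
have B60 : 0 < 6 * B by apply: mulr_gt0.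
rewrite e -invfM -[leLHS]mul1r ler_pdivrMr; last exact: mulr_gt0.
move: main; set P := _ `^ (1 - a); clearbody B P; lra.
Qed.

Lemma sum_powR_scaled1 (s delta : R) (n : nat) : 0 <= s -> s < 1 -> 0 < delta ->
  delta * \sum_(1 <= j < n) (j%:R * delta) `^ (- s) <= (n%:R * delta) `^ (1 - s) / (1 - s).
Proof.
move=> s0 s1 d0; have s1' : 0 < 1 - s by rewrite subr_gt0.
rewrite big_add1 big_mkord; apply: le_trans (sum_powR_scaled _ s0 s1 d0) _.
rewrite ler_pM2r ?invr_gt0//; apply: powR_le_base; last exact: ltW.
  by rewrite mulr_ge0// ltW.
by rewrite ler_pM2r// ler_nat leq_pred.
Qed.

Lemma quarter_half_count (n : nat) : (8 <= n)%N ->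
  (n <= 8 * \sum_(1 <= i < n) ((n <= 4 * i) && (2 * i <= n)))%N.
Proof.
move=> n8; pose q := ((n + 3) %/ 4)%N; pose h := (n %/ 2).+1.
have q1 : (1 <= q)%N by rewrite /q; lia.
have qh : (q <= h)%N by rewrite /q /h; lia.
have hn : (h <= n)%N by rewrite /h; lia.
rewrite (big_cat_nat q1 (leq_trans qh hn))/= (big_cat_nat qh hn)/=.
rewrite [X in (_ + (X + _))%N](_ : _ = h - q)%N; first by rewrite /q /h; lia.
rewrite -[RHS]muln1 -sum_nat_const_nat; apply: eq_big_nat => i /andP[qi ih].
by rewrite (_ : _ && _ = true)//; apply/andP; split; rewrite /q /h in qi ih; lia.
Qed.

(** Both bounds are linear in [b], by Bernoulli's inequality. Near [n], the factor [n - i] tames the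
    non-summable singularity of [k (n - i)]. Far from [n], the inequality is applied to
    [(n / i) ^ (a / 2)], a power that remains summable against [u i]. *)
Lemma power_excess (b : R) (n i : nat) : 0 <= b -> b <= a / 2 -> (0 < i)%N -> (i < n)%N ->
  (n%:R / i%:R) `^ b - 1 <= b * (if (n < 2 * i)%N then 2 * (n - i)%:R / n%:R
                               else 2 / a * (n%:R / i%:R) `^ (a / 2)).
Proof.
move=> b0 ba i0 in_; have ip : 0 < i%:R :> R by rewrite ltr0n.
have np : 0 < n%:R :> R by rewrite ltr0n (leq_trans _ in_).
have x1 : 1 <= n%:R / i%:R :> R by rewrite ler_pdivlMr// mul1r ler_nat ltnW.
have x0 := lt_le_trans ltr01 x1.
case: ifPn => ni.
  have b1 : b <= 1 by have a1' := a1; lra.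
  have h := bernoulli_powR x0 b0 b1; have {}h : (n%:R / i%:R) `^ b - 1 <= b * (n%:R / i%:R - 1) by lra.
  apply: le_trans h _; rewrite ler_wpM2l// natrB 1?ltnW//.
  have -> : n%:R / i%:R - 1 = (n%:R - i%:R) / i%:R :> R by rewrite mulrBl mulfV ?gt_eqF.
  have h2 : i%:R^-1 <= 2 / n%:R :> R.
    by rewrite -div1r ler_pdivrMr// mulrAC ler_pdivlMr// mul1r -natrM ler_nat ltnW.
  by rewrite [2 * _]mulrC -mulrA ler_wpM2l// subr_ge0 ler_nat ltnW.
have a2 : 0 < a / 2 by rewrite divr_gt0.
have y0 : 0 < (n%:R / i%:R) `^ (a / 2) by rewrite powR_gt0.
have s0 : 0 <= b / (a / 2) by rewrite divr_ge0// ltW.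
have s1 : b / (a / 2) <= 1 by rewrite ler_pdivrMr// mul1r.
have e0 : a / 2 * (b / (a / 2)) = b by rewrite mulrC mulfVK// gt_eqF.
have := bernoulli_powR y0 s0 s1; rewrite -powRrM e0 => h.
have e : b / (a / 2) = b * (2 / a) by rewrite invf_div.
rewrite e in h; have : 0 <= b * (2 / a) by rewrite -e.
rewrite mulrA; set y := _ `^ (a / 2) in h *; lra.
Qed.

(** Once [power_excess] is inserted, the two ranges of [i] give power sums with exponents [- a] and
    [- (1 - a / 2)], both above [-1]. All powers of [t] then combine to [1 / t], the order of the
    gain in [gain_sum_ge]. *)
Lemma excess_sum_le (delta S : R) (k u : nat -> R) (C3 b : R) (n : nat) :
  renewal_setting a beta c1 C1 c2 C2 delta S k u -> 0 < C3 ->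
  (forall i, (0 < i)%N -> u i <= C3 * (i%:R * delta) `^ (a - 1)) ->
  0 <= b -> b <= a / 2 -> (0 < n)%N ->
  beta * delta * \sum_(1 <= i < n) ((n%:R / i%:R) `^ b - 1) * (u i * k (n - i)%N) <=
    b * (4 * C1 * C3 * beta / (1 - a) + 16 * beta * C1 * C3 / a ^+ 2) / (n%:R * delta).
Proof.
case=> d0 d1 k0 kge khi klo _ _ _ uE up um C30 hiu b0 ba n0.
have np : 0 < n%:R :> R by rewrite ltr0n.
set t := n%:R * delta; have t0 : 0 < t by rewrite mulr_gt0.
have a1' : 0 < 1 - a by rewrite subr_gt0.
(* [A1] collects the factors for [n < 2 i], [A2] those for [2 i <= n]. *)
pose A1 := 4 * C1 * C3 * b * t `^ (a - 2).
pose A2 := 8 * C1 * C3 * b / a * t `^ (a / 2 - (1 + a)).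
have A10 : 0 <= A1 by rewrite !mulr_ge0 ?powR_ge0 ?(ltW C10) ?(ltW C30).
have A20 : 0 <= A2 by rewrite !mulr_ge0 ?powR_ge0 ?invr_ge0 ?(ltW C10) ?(ltW C30) ?(ltW a0).
have half (s : R) : 0 <= s -> s <= 2 -> (t / 2) `^ (- s) <= 4 * t `^ (- s).
  move=> s0 s2; rewrite powR_divN// mulrC ler_wpM2r ?powR_ge0//.
  apply: (@le_trans _ _ (2 `^ 2)); first by apply: ler_powR => //; rewrite ler1n.
  by rewrite powR_mulrn// -natrX.
have half1 : (t / 2) `^ (a - 1) <= 2 * t `^ (a - 1).
  rewrite -opprB powR_divN// mulrC ler_wpM2r ?powR_ge0//.
  apply: (@le_trans _ _ (2 `^ 1)); last by rewrite powRr1.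
  by apply: ler_powR; [rewrite ler1n|rewrite lerBlDr lerDl ltW].
have termle i : (0 < i)%N -> (i < n)%N ->
    ((n%:R / i%:R) `^ b - 1) * (u i * k (n - i)%N) <=
    A1 * ((n - i)%N%:R * delta) `^ (- a) + A2 * (i%:R * delta) `^ (- (1 - a / 2)).
  move=> i0 in_; have ip : 0 < i%:R :> R by rewrite ltr0n.
  have nin : (0 < n - i)%N by rewrite subn_gt0.
  have jp : 0 < (n - i)%N%:R :> R by rewrite ltr0n.
  have s0 : 0 < i%:R * delta by rewrite mulr_gt0.
  have r0 : 0 < (n - i)%N%:R * delta by rewrite mulr_gt0.
  have px := power_excess b0 ba i0 in_; have ku := khi _ nin; have uu := hiu _ i0.
  have P1 : 0 <= ((n - i)%N%:R * delta) `^ (- a) by rewrite powR_ge0.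
  have P2 : 0 <= (i%:R * delta) `^ (- (1 - a / 2)) by rewrite powR_ge0.
  move: px; case: ifPn => [ni|]; last rewrite -leqNgt => ni.
  - move=> px; apply: ler_wpDr; first exact: mulr_ge0.
    have uu' : u i <= C3 * (2 * t `^ (a - 1)).
      apply: le_trans uu _; rewrite ler_pM2l//; apply: le_trans half1.
      rewrite -opprB; apply: powR_le_neg; rewrite ?divr_gt0 ?(ltW a1')//.
      rewrite /t mulrAC ler_pM2r// ler_pdivrMr// -natrM ler_nat mulnC.
      exact: ltnW.
    apply: (@le_trans _ _ (b * (2 * (n - i)%N%:R / n%:R) *
      (C3 * (2 * t `^ (a - 1)) * (C1 * ((n - i)%N%:R * delta) `^ (- (1 + a)))))).
      apply: le_trans (ler_wpM2r _ px) _; first by rewrite mulr_ge0// ltW.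
      apply: ler_wpM2l; first by rewrite !mulr_ge0 ?invr_ge0 ?(ltW jp) ?(ltW np).
      by apply: ler_pM => //; exact: ltW.
    have -> : - (1 + a) = - a - 1 by rewrite opprD addrC.
    have e1 : t `^ (a - 1) = t `^ (a - 2) * t.
      by rewrite -[X in _ * X]powRr1 ?(ltW t0)// -powRDp//; congr (_ `^ _); ring.
    rewrite e1 [_ `^ (- a - 1)]powRDp// powR_inv1 ?(ltW r0)// /A1.
    rewrite le_eqVlt; apply/orP; left; apply/eqP; rewrite /t; field.
    by rewrite !gt_eqF.
  - move=> px; apply: ler_wpDl; first exact: mulr_ge0.
    have kk : k (n - i)%N <= C1 * (4 * t `^ (- (1 + a))).
      apply: le_trans ku _; rewrite ler_pM2l//.
      have h1a : 0 <= 1 + a by rewrite addr_ge0// ltW.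
      have h2a : 1 + a <= 2 by have a1'' := a1; lra.
      apply: le_trans (half _ h1a h2a).
      apply: powR_le_neg => //; first by rewrite divr_gt0.
      rewrite /t mulrAC ler_pM2r// ler_pdivrMr// -natrM ler_nat; clear -ni in_; lia.
    apply: (@le_trans _ _ (b * (2 / a * (n%:R / i%:R) `^ (a / 2)) *
      (C3 * (i%:R * delta) `^ (a - 1) * (C1 * (4 * t `^ (- (1 + a))))))).
      apply: le_trans (ler_wpM2r _ px) _; first by rewrite mulr_ge0// ltW.
      apply: ler_wpM2l; first by rewrite !mulr_ge0 ?invr_ge0 ?powR_ge0 ?(ltW a0).
      by apply: ler_pM => //; exact: ltW.
    have -> : n%:R / i%:R = t / (i%:R * delta).
      by rewrite /t; field; rewrite !gt_eqF.
    rewrite -[in _ `^ (a / 2)](opprK (a / 2)) powR_divN// opprK.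
    rewrite /A2 [t `^ (a / 2 - _)]powRDp// (_ : - (1 - a / 2) = (- (a / 2)) + (a - 1)) ; last by field.
    rewrite [_ `^ (- (a / 2) + _)]powRDp//.
    rewrite le_eqVlt; apply/orP; left; apply/eqP; field.
    by rewrite gt_eqF.
apply: (@le_trans _ _ (beta * (A1 * (t `^ (1 - a) / (1 - a)) + A2 * (t `^ (1 - (1 - a / 2)) / (1 - (1 - a / 2)))))).
  rewrite -mulrA ler_pM2l//.
  apply: (@le_trans _ _ (delta * \sum_(1 <= i < n) (A1 * ((n - i)%N%:R * delta) `^ (- a) + A2 * (i%:R * delta) `^ (- (1 - a / 2))))).
    rewrite ler_pM2l// big_nat_cond [leRHS]big_nat_cond; apply: ler_sum => i /andP[/andP[i1 in_] _].
    exact: termle.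
  rewrite big_split/= -!mulr_sumr mulrDr; apply: lerD; rewrite mulrCA ler_wpM2l//.
    rewrite big_nat_rev/=.
    rewrite (eq_big_nat _ _ (F2 := fun i => (i%:R * delta) `^ (- a))) => [|i /andP[i1 in_]].
      by apply: sum_powR_scaled1; rewrite // ltW.
    by congr ((_%:R * _) `^ _); clear -i1 in_; lia.
  apply: sum_powR_scaled1 => //; first by have a1'' := a1; lra.
  by rewrite ltrBlDr ltrDl divr_gt0.
have e1 : t `^ (a - 2) * t `^ (1 - a) = t^-1.
  by rewrite -powRDp// -powR_inv1 ?(ltW t0)//; congr (_ `^ _); ring.
have e2 : t `^ (a / 2 - (1 + a)) * t `^ (1 - (1 - a / 2)) = t^-1.
  by rewrite -powRDp// -[RHS]powR_inv1 ?(ltW t0)//; congr (_ `^ _); field.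
rewrite /A1 /A2; move: e1 e2.
set x1 := t `^ _; set x2 := t `^ _; set x3 := t `^ _; set x4 := t `^ _ => e1 e2.
rewrite [leLHS](_ : _ = b * (4 * C1 * C3 * beta / (1 - a)) * (x1 * x2) + b * (16 * beta * C1 * C3 / a ^+ 2) * (x3 * x4)).
  by rewrite e1 e2 -mulrDl -mulrDr.
by field; rewrite !gt_eqF.
Qed.

(** At least [n / 8] indices lie between [n / 4] and [n / 2]; on them [u i] is at least of order
    [t ^ (a - 1)] and [k (n - i)] of order [t ^ (- (1 + a))]. The [32] is this [8] times the [4]
    bounding [2 ^ (1 + a)]. The condition [8 A <= t] puts these [i] in the range of the renewal
    lower bound and makes [n >= 8]. *)
Lemma gain_sum_ge (delta S : R) (k u : nat -> R) (c3 A : R) (L n : nat) :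
  renewal_setting a beta c1 C1 c2 C2 delta S k u -> 0 < c3 -> 1 <= A -> (1 < L)%N ->
  (forall i, A <= i%:R * delta -> (i * L)%:R * delta <= S ->
     c3 * (i%:R * delta) `^ (a - 1) <= u i) ->
  8 * A <= n%:R * delta -> (n * L)%:R * delta <= S ->
  beta * c1 * c3 / 32 / (n%:R * delta) <=
  beta * delta * \sum_(1 <= i < n)
    ((n <= 4 * i) && (2 * i <= n))%N%:R * (u i * k (n - i)%N).
Proof.
case=> d0 d1 k0 kge khi klo _ _ _ uE up um c30 A1 L1 lou.
set t := n%:R * delta => tA nS.
have t8 : 8 <= t by apply: le_trans tA; rewrite ler_peMr.
have t0 : 0 < t by apply: lt_le_trans t8.
have np : 0 < n%:R :> R by rewrite -(pmulr_lgt0 _ d0).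
have n8 : (8 <= n)%N.
  by rewrite -(ler_nat R); apply: le_trans t8 _; rewrite /t ger_pMr.
have a1' : 0 < 1 - a by rewrite subr_gt0.
have term i : (1 <= i)%N -> (i < n)%N -> (n <= 4 * i)%N ->
    c3 * t `^ (a - 1) * (c1 * (4^-1 * t `^ (- (1 + a)))) <= u i * k (n - i)%N.
  move=> i1 in_ ni; have ip : 0 < i%:R :> R by rewrite ltr0n.
  have it : i%:R * delta <= t by rewrite ler_pM2r// ler_nat ltnW.
  apply: ler_pM; rewrite ?mulr_ge0 ?powR_ge0 ?(ltW c30) ?(ltW c10)//.
    apply: le_trans (lou i _ _).
    - rewrite ler_pM2l// -opprB; apply: powR_le_neg; rewrite ?mulr_gt0// ltW//.
    - have h : n%:R <= 4 * i%:R :> R by rewrite -natrM ler_nat.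
      have : t <= 4 * (i%:R * delta) by rewrite mulrA ler_pM2r.
      have A1' := A1; move: tA; set x := i%:R * delta; lra.
    - apply: le_trans nS; rewrite ler_pM2r// ler_nat leq_pmul2r ?(ltnW in_)//; exact: ltnW.
  apply: le_trans (klo _); rewrite ler_pM2l//.
  have h1a : 0 <= 1 + a by rewrite addr_ge0// ltW.
  have jt : (n - i)%N%:R * delta <= t by rewrite ler_pM2r// ler_nat leq_subr.
  apply: (@le_trans _ _ ((2 * t) `^ (- (1 + a)))); last first.
    apply: powR_le_neg => //; first by rewrite ltr_wpDr// mulr_ge0// ltW.
    by move: jt; set x := _ * delta; lra.
  rewrite powRM ?(ltW t0)// ler_wpM2r ?powR_ge0// powRN lef_pV2 ?posrE ?powR_gt0//.
  apply: (@le_trans _ _ (2 `^ 2)); last by rewrite powR_mulrn// -natrX.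
  by apply: ler_powR; [rewrite ler1n|have a1'' := a1; lra].
pose K := c3 * t `^ (a - 1) * (c1 * (4^-1 * t `^ (- (1 + a)))).
have K0 : 0 < K by rewrite !mulr_gt0 ?powR_gt0.
apply: (@le_trans _ _ (beta * delta * \sum_(1 <= i < n) ((n <= 4 * i) && (2 * i <= n))%N%:R * K)); last first.
  rewrite ler_pM2l ?mulr_gt0// big_nat_cond [leRHS]big_nat_cond.
  apply: ler_sum => i /andP[/andP[i1 in_] _]; case: (boolP ((n <= 4 * i) && (2 * i <= n))%N) => [/andP[ni _]|_] /=.
    by rewrite !mul1r term.
  by rewrite !mul0r.
have cnt : n%:R <= 8 * \sum_(1 <= i < n) ((n <= 4 * i) && (2 * i <= n))%N%:R :> R.
  have := quarter_half_count n8.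
  by rewrite -(ler_nat R) natrM; rewrite natr_sum.
rewrite -mulr_suml; move: cnt; set c := \sum_(1 <= i < n) _ => cnt.
have eK : K * t ^+ 2 = c3 * c1 / 4.
  have : t `^ (a - 1) * t `^ (- (1 + a)) * t ^+ 2 = 1.
    by rewrite -powR_mulrn ?(ltW t0)// -!powRDp// (_ : _ + _ = 0) ?powRr0//; ring.
  rewrite /K; set x := t `^ _; set y := t `^ _ => h.
  have -> : c3 * c1 / 4 = c3 * c1 / 4 * (x * y * t ^+ 2) by rewrite h mulr1.
  by field.
rewrite ler_pdivrMr//.
have -> : beta * c1 * c3 / 32 = beta / 8 * (K * t ^+ 2) by rewrite eK; field.
have e3 : delta * n%:R = t by rewrite mulrC.
have : beta / 8 * K * t * (delta * n%:R) <= beta / 8 * K * t * (delta * (8 * c)).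
  have Q0 : 0 < beta / 8 * K * t.
    by do 2![apply: mulr_gt0 => //]; exact: divr_gt0.
  by rewrite (ler_pM2l Q0) ler_pM2l.
rewrite e3; lra.
Qed.

(* Comparison with the supersolution [C t^-b u]: at the scale of [n], the cost of
   the factor [t^-b] is [b] times a constant, whereas the reduction of the kernel
   gains a constant times [eps]. *)
Lemma tilted_decay : exists (c t2 : R) (L : nat), [/\ 0 < c, 4 <= t2, (1 < L)%N &
  forall eps : R, 0 < eps -> eps <= 1 -> exists2 C : R, 0 < C &
  forall (delta S : R) (k u v : nat -> R) (kap : nat -> nat -> R), renewal_setting a beta c1 C1 c2 C2 delta S k u ->
  (forall n, 0 <= v n) ->
  (forall n, v n <= k n + beta * delta * \sum_(i < n) v i * kap i n) ->
  (forall i n, (i < n)%N -> 0 <= kap i n <= k (n - i)%N) ->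
  (forall i n, t2 <= n%:R * delta -> n%:R * delta <= S ->
     (n <= 4 * i)%N -> (2 * i <= n)%N -> kap i n <= (1 - eps) * k (n - i)%N) ->
  forall n, (0 < n)%N -> (n * L)%:R * delta <= S ->
    v n <= C * (n%:R * delta) `^ (- (c * eps)) * u n].
Proof.
have [C3 C30 hiU] := renewal_upper.
have [c3 [A [L [c30 A1 L1 loU]]]] := renewal_lower.
pose E := 4 * C1 * C3 * beta / (1 - a) + 16 * beta * C1 * C3 / a ^+ 2.
have a1' : 0 < 1 - a by rewrite subr_gt0.
have E0 : 0 < E by rewrite addr_gt0 ?divr_gt0 ?exprn_gt0 ?mulr_gt0.
pose G := beta * c1 * c3 / 32.
have G0 : 0 < G by rewrite divr_gt0 ?mulr_gt0.
(* [c <= a / 2] is required by [power_excess]; the other entry makes the cost [b * E] at most half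
   of the gain [eps * G], the other half being kept for the boundary term. *)
pose c := Num.min (a / 2) (G / (2 * E)).
have c0 : 0 < c by rewrite lt_min !divr_gt0 ?mulr_gt0.
have ca : c <= a / 2 by rewrite ge_min lexx.
have cE : c * E <= G / 2.
  have : c <= G / (2 * E) by rewrite ge_min lexx orbT.
  rewrite ler_pdivlMr ?mulr_gt0//; lra.
pose t2 := 8 * A.
have t28 : 8 <= t2 by rewrite ler_peMr.
exists c, t2, L; split=> //; first by apply: le_trans t28; rewrite ler_nat.
move=> eps eps0 eps1.
pose b : R := c * eps.
have b0 : 0 < b by rewrite mulr_gt0.
have bc : b <= c by rewrite ger_pMr.
have ba : b <= a / 2 := le_trans bc ca.
(* The first entry makes the claim follow from [v <= u] up to time [t2]; the second makes the
   boundary term [(1 + beta) * k n] at most the half of the gain that is left. *)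
pose C : R := Num.max (t2 `^ b) (2 * (1 + beta) * C1 / (G * eps)).
have C0 : 0 < C.
  by rewrite lt_max powR_gt0// (lt_le_trans _ t28).
exists C => // delta S k u v kap rs v0 vE kapk kapg.
have rs' := rs; have hiu := hiU _ _ _ _ rs; have lou := loU _ _ _ _ rs.
case: rs => d0 d1 k0 kge khi klo _ _ _ uE up um.
have th0 : 0 < beta * delta by rewrite mulr_gt0.
have vu n : v n <= u n.
  elim/ltn_ind: n => n IH; apply: le_trans (vE n) _; rewrite uE lerD2l ler_pM2l//.
  apply: ler_sum => i _; have /andP[h1 h2] := kapk i n (ltn_ord i).
  by apply: ler_pM => //; exact: IH.
elim/ltn_ind => n IH n0 nS.
have np : 0 < n%:R :> R by rewrite ltr0n.
set t := n%:R * delta in nS *.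
have t0 : 0 < t by rewrite mulr_gt0.
have [tt2|tt2] := leP t t2.
  apply: le_trans (vu n) _; rewrite ler_peMl ?(ltW (up n))//.
  rewrite powRN ler_pdivlMr ?powR_gt0// mul1r.
  apply: (@le_trans _ _ (t2 `^ b)); last by rewrite le_max lexx.
  by apply: powR_le_base => //; exact: ltW.
have t1 : 1 <= t by apply: le_trans (ltW tt2); apply: le_trans t28; rewrite ler1n.
pose X (i : nat) : R := (n%:R / i%:R) `^ b.
have IHX i : (0 < i)%N -> (i < n)%N -> v i <= C * t `^ (- b) * (X i * u i).
  move=> i0 in_; have iS : (i * L)%:R * delta <= S.
    by apply: le_trans nS; rewrite ler_pM2r// ler_nat leq_pmul2r// ?(ltnW in_) ?(ltnW L1).
  have ip : 0 < i%:R :> R by rewrite ltr0n.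
  apply: le_trans (IH i in_ i0 iS) _.
  have -> : i%:R * delta = t / (n%:R / i%:R) by rewrite /t; field; rewrite !gt_eqF.
  by rewrite powR_divN ?divr_gt0// -/b /X !mulrA.
(* The term [i = 0] is outside the induction hypothesis and is moved to the boundary term, using
   [v 0 <= 1] and [delta <= 1]. *)
have main : v n <= (1 + beta) * k n + C * t `^ (- b) *
    (beta * delta * \sum_(1 <= i < n) X i * u i * kap i n).
  apply: le_trans (vE n) _; rewrite -(big_mkord xpredT (fun i => v i * kap i n)) big_ltn//.
  rewrite mulrDr addrA mulrDl mul1r -addrA -addrA lerD2l; apply: lerD.
    have /andP[h1 h2] := kapk 0%N n n0; rewrite subn0 in h2.
    have v1 : v 0%N <= 1 by have := vE 0%N; rewrite big_ord0 mulr0 addr0 k0.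
    rewrite -mulrA ler_pM2l//.
    apply: (@le_trans _ _ (delta * (1 * k n))); first by rewrite ler_pM2l// ler_pM.
    by rewrite mul1r ler_piMl.
  rewrite mulrCA ler_pM2l// mulr_sumr [leRHS]big_nat_cond big_nat_cond.
  apply: ler_sum => i /andP[/andP[i1 in_] _].
  have /andP[h1 h2] := kapk i n in_.
  by rewrite mulrA; apply: ler_wpM2r => //; exact: IHX.
have exc := excess_sum_le rs' C30 hiu (ltW b0) ba n0.
have gain := gain_sum_ge rs' c30 A1 L1 lou (ltW tt2) nS.
rewrite -/t in exc gain; fold E in exc; fold G in gain.
have kn : k n <= C1 * (t^-1 * t `^ (- a)).
  by apply: le_trans (khi n n0) _; rewrite opprD -/t powRDp// powR_inv1// ltW.
have nonneg i : 0 <= u i * k (n - i)%N by rewrite mulr_ge0// ltW.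
have nN : (0 < n * L)%N by rewrite muln_gt0 n0 ltnW.
have tS : t <= S.
  by apply: le_trans nS; rewrite ler_pM2r// ler_nat leq_pmulr// ltnW.
have conv : \sum_(1 <= i < n) X i * u i * kap i n <=
    \sum_(1 <= i < n) u i * k (n - i)%N +
    \sum_(1 <= i < n) (X i - 1) * (u i * k (n - i)%N) -
    eps * \sum_(1 <= i < n) ((n <= 4 * i) && (2 * i <= n))%N%:R * (u i * k (n - i)%N).
  rewrite mulr_sumr -big_split -sumrB/=.
  rewrite big_nat_cond [leRHS]big_nat_cond; apply: ler_sum => i /andP[/andP[i1 in_] _].
  have X1 : 1 <= X i.
    apply: powR_ge1; last exact: ltW.
    by rewrite ler_pdivlMr ?ltr0n// mul1r ler_nat ltnW.
  have X0 : 0 <= X i := le_trans ler01 X1.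
  have /andP[h1 h2] := kapk i n in_; have u0 := up i.
  case: (boolP ((n <= 4 * i) && (2 * i <= n))%N) => [/andP[ni ni2]|_] /=.
    have h3 := kapg i n (ltW tt2) tS ni ni2.
    have : X i * u i * kap i n <= X i * u i * ((1 - eps) * k (n - i)%N).
      by rewrite ler_wpM2l// mulr_ge0// ltW.
    have : 0 <= eps * (X i - 1) * (u i * k (n - i)%N).
      by apply: mulr_ge0 => //; apply: mulr_ge0; rewrite ?subr_ge0 ?(ltW eps0).
    lra.
  have : X i * u i * kap i n <= X i * u i * k (n - i)%N.
    by rewrite ler_wpM2l// mulr_ge0// ltW.
  lra.
have conv2 : beta * delta * \sum_(1 <= i < n) u i * k (n - i)%N <= u n.
  rewrite uE -(big_mkord xpredT (fun i => u i * k (n - i)%N)) [in leRHS]big_ltn// mulrDr.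
  by have := kge n; have := mulr_ge0 (ltW th0) (nonneg 0%N); lra.
have conv3 : beta * delta * \sum_(1 <= i < n) X i * u i * kap i n <=
   u n + b * E / t - eps * (G / t).
  have := ler_wpM2l (ltW th0) conv; rewrite mulrBr mulrDr.
  move=> /le_trans; apply; apply: lerB; first exact: lerD.
  by rewrite [leRHS]mulrCA ler_wpM2l// ltW.
have bE : b * E / t <= eps * (G / t) / 2.
  have -> : eps * (G / t) / 2 = eps * (G / 2) / t by ring.
  rewrite ler_pM2r ?invr_gt0//.
  have -> : b * E = eps * (c * E) by rewrite /b; ring.
  by rewrite ler_pM2l.
have Ct : 0 < C * t `^ (- b) by rewrite mulr_gt0 ?powR_gt0.
apply: le_trans main _.
have first : (1 + beta) * k n <= C * t `^ (- b) * (eps * (G / t) / 2).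
  have Cge : 2 * (1 + beta) * C1 / (G * eps) <= C by rewrite le_max lexx orbT.
  rewrite ler_pdivrMr ?mulr_gt0// in Cge.
  have tab : t `^ (- a) <= t `^ (- b) by apply: ler_powR => //; rewrite lerN2; move: a0; lra.
  have h1 : (1 + beta) * k n <= (1 + beta) * (C1 * (t^-1 * t `^ (- b))).
    rewrite ler_pM2l ?addr_gt0//; apply: le_trans kn _.
    by rewrite ler_pM2l// ler_pM2l// invr_gt0.
  apply: le_trans h1 _.
  have := ler_wpM2r (mulr_ge0 (ltW (divr_gt0 ltr01 t0)) (powR_ge0 t (- b))) Cge.
  rewrite div1r; set y := t `^ _; set z := t^-1; lra.
have := ler_wpM2l (ltW Ct) conv3; have := ler_wpM2l (ltW Ct) bE.
rewrite -/b mulrBr mulrDr.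
move: first; set Q := C * t `^ (- b); lra.
Qed.

End bounds.
End discrete_renewal.

(** * The renewal equation of pinned paths and its log-convexity *)

Section renewal_equation.
Context {R : realType}.
Local Notation F := (nnfun R).
Implicit Types (f g k : F) (r : nat -> F).
Variable theta : R.
Hypothesis theta_ge0 : 0 <= theta.
Local Open Scope ereal_scope.

Lemma at0ME f g x : (at0 f * g)%R x = f 0%R * g x.
Proof.
rewrite nnfunME (esum_only (i0 := 0%R))/= ?eqxx ?subr0// => y; last first.
  by move=> /negPf ->; rewrite mul0e.
by rewrite mule_ge0// ?nnfun_ge0//; case: ifP; rewrite ?nnfun_ge0.
Qed.

Lemma pinnedS r n : pinned theta r n.+1 =
  (r n * (pinned theta r n + pt theta * at0 (pinned theta r n)))%R.
Proof. by []. Qed.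

(** Expansion at the last time [i] where the term [theta] of the reward is taken; from then on the
    steps are free. *)
Lemma pinned_sum r n : pinned theta r n = (\prod_(0 <= l < n) r l +
  \sum_(0 <= i < n) pt theta * at0 (pinned theta r i) * \prod_(i <= l < n) r l)%R.
Proof.
elim: n => [|n IH]; first by rewrite !big_geq// addr0.
rewrite pinnedS {1}IH mulrDr mulrDr mulr_sumr.
rewrite (big_nat_recr n 0 r)// (big_nat_recr n)//= big_nat1.
rewrite [(r n * \prod_(0 <= l < n) _)%R]mulrC -addrA; congr (_ + (_ + _))%R.
  apply: eq_big_nat => i /andP[_ in_].
  by rewrite [in RHS]big_nat_recr ?(ltnW in_)//= mulrCA [(r n * _)%R]mulrC.
by rewrite mulrC.
Qed.

Lemma pinned_real r (q : nat -> nat -> R) : (forall i n, 0 <= q i n)%R ->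
  (forall i n, (i <= n)%N -> (\prod_(i <= l < n) r l)%R 0%R = (q i n)%:E) ->
  exists2 u : nat -> R, (forall n, pinned theta r n 0%R = (u n)%:E) &
    (forall n, 0 <= u n)%R /\
    (forall n, u n = q 0%N n + theta * \sum_(i < n) u i * q i n)%R.
Proof.
move=> q0 rq.
have eqn n : pinned theta r n 0%R =
    (q 0%N n)%:E + \sum_(0 <= i < n) theta%:E * (pinned theta r i 0%R * (q i n)%:E).
  rewrite pinned_sum nnfunDE rq// nnfun_sumE; congr (_ + _).
  by apply: eq_big_nat => i /andP[_ in_]; rewrite -mulrA ptME// at0ME rq// ltnW.
have fin n : pinned theta r n 0%R \is a fin_num.
  elim/ltn_ind: n => n IH; rewrite eqn fin_numD/=; apply/sum_fin_numP => i; rewrite mem_index_iota.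
  by move=> /andP[_ in_] _; rewrite !fin_numM// IH.
exists (fun n => fine (pinned theta r n 0%R)) => [n|]; first by rewrite fineK.
split=> n; first by rewrite fine_ge0// nnfun_ge0.
apply: EFin_inj; rewrite fineK// eqn EFinD EFinM -sumEFin -(big_mkord xpredT (fun i => ((fine (pinned theta r i 0%R) * q i n)%R)%:E)).
rewrite ge0_sume_distrr; last by move=> i _; rewrite lee_fin mulr_ge0// fine_ge0// nnfun_ge0.
by congr (_ + _); apply: eq_bigr => i _; rewrite EFinM fineK.
Qed.

Lemma mul_reward f g : (f * (g + pt theta * at0 g))%R 0%R =
  (f * g)%R 0%R + theta%:E * (f 0%R * g 0%R).
Proof.
rewrite mulrDr nnfunDE (mulrCA f (pt theta) (at0 g)) (ptME _ _ theta_ge0).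
by rewrite (mulrC f (at0 g)) (at0ME g f 0%R) (muleC (g 0%R)).
Qed.

Section homogeneous.
Variable k : F.
Hypothesis evenk : even k.
Local Notation a := (pinned theta (fun=> k)).
Local Notation f n := (a n + pt theta * at0 (a n))%R.

Lemma even_pinned n : even (a n).
Proof.
elim: n => [|n IH]; first exact: even1.
rewrite pinnedS.
apply: evenM => // x; rewrite !nnfunDE IH !ptME//=; congr (_ + _ * _).
by rewrite oppr_eq0.
Qed.

(** A loop of length [m + n] is cut at time [m] and its second part reversed, which evenness
    permits. Both end points are then rewarded, and the junction once through [f n]: this is one
    reward more than in [a (m + n)], hence the factor [1 + theta]. *)
Lemma pinned_add m n : (a m * f n)%R 0%R = (1 + theta)%:E * a (m + n) 0%R.
Proof.
have sym i j : (a i * f j)%R 0%R = (a j * f i)%R 0%R.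
  by rewrite (mul_reward (a i) (a j)) (mul_reward (a j) (a i)) (mulrC (a i) (a j)) (muleC (a i 0%R) (a j 0%R)).
elim: n m => [|n IH] m; last first.
  by rewrite sym -addSnnS -IH !pinnedS -!mulrA (mulrC (f n) (f m)).
rewrite addn0 mul_reward mulr1 nnfun1E eqxx mule1.
by rewrite EFinD ge0_muleDl// mul1e.
Qed.

Lemma mule_AMGM (x y : \bar R) (l : R) : 0 <= x -> 0 <= y -> (0 < l)%R ->
  2%:E * (x * y) <= l%:E * (x * x) + (l^-1)%:E * (y * y).
Proof.
move: x y => [x| |] [y| |]//; rewrite ?lee_fin => x0 y0 l0.
- rewrite -subr_ge0 [leRHS](_ : _ = l * (x - l^-1 * y) ^+ 2)%R.
    by rewrite mulr_ge0 ?sqr_ge0 ?(ltW l0).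
  by field; rewrite gt_eqF.
- by rewrite mulyy (gt0_muley (x := (l^-1)%:E)) ?lte_fin ?invr_gt0// addey ?leey// -!EFinM.
- by rewrite mulyy (gt0_muley (x := l%:E)) ?lte_fin// addye ?leey// -!EFinM.
- by rewrite mulyy (gt0_muley (x := l%:E)) ?lte_fin// addye ?leey// gt0_muley ?lte_fin ?invr_gt0.
Qed.

(** Cauchy-Schwarz for the two halves of a loop, with a free parameter [l] in place of square roots,
    which suits extended reals. *)
Lemma pinned_AMGM m n (l : R) : (0 < l)%R ->
  2%:E * a (m + n) 0%R <= l%:E * a (m + m) 0%R + (l^-1)%:E * a (n + n) 0%R.
Proof.
move=> l0; have l1 : (0 < l^-1)%R by rewrite invr_gt0.
have t1 : (0 < 1 + theta)%R by rewrite ltr_pwDl.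
suff: (1 + theta)%:E * (2%:E * a (m + n) 0%R) <=
    (1 + theta)%:E * (l%:E * a (m + m) 0%R + (l^-1)%:E * a (n + n) 0%R).
  by rewrite lee_pmul2l// lte_fin.
rewrite ge0_muleDr; [|by rewrite mule_ge0 ?nnfun_ge0// lee_fin ltW..].
rewrite ![(1 + theta)%:E * (_ * _)]muleCA -!pinned_add.
have E i j : (a i * f j)%R 0%R =
    \esum_(x in [set: int]) (a i x * a j x) + theta%:E * (a i 0%R * a j 0%R).
  by rewrite mul_reward (conv_at0 _ (@even_pinned j)).
have p0 i j : 0 <= \esum_(x in [set: int]) (a i x * a j x).
  by apply: esum_ge0 => x _; rewrite mule_ge0// nnfun_ge0.
have q0 i j : 0 <= theta%:E * (a i 0%R * a j 0%R) by rewrite !mule_ge0// nnfun_ge0.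
rewrite !E !ge0_muleDr// addeACA; apply: leeD.
  have ee i j x : 0 <= a i x * a j x by rewrite mule_ge0// nnfun_ge0.
  have l0' : 0 <= l%:E by rewrite lee_fin ltW.
  have l1' : 0 <= (l^-1)%:E by rewrite lee_fin ltW.
  rewrite -(esumZl _ (ee m n))// -(esumZl l0' (ee m m)) -(esumZl l1' (ee n n)).
  rewrite -esumD; try by move=> x _; exact: mule_ge0.
  by apply: le_esum => x _; apply: mule_AMGM; rewrite ?nnfun_ge0.
rewrite ![_%:E * (theta%:E * _)]muleCA -ge0_muleDr; try by rewrite !mule_ge0// ?nnfun_ge0// lee_fin ltW.
by apply: lee_wpmul2l => //; apply: mule_AMGM; rewrite ?nnfun_ge0.
Qed.

Lemma pinned_step n : k 0%R * a n 0%R <= a n.+1 0%R.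
Proof.
rewrite pinnedS mulrDr nnfunDE; rewrite -[leLHS]adde0; apply: leeD; last exact: nnfun_ge0.
rewrite (conv_at0 _ (@even_pinned n)).
have h x : 0 <= k x * a n x by rewrite mule_ge0// nnfun_ge0.
apply: le_trans (esum_le_sub (e := fun=> 0%R : int) (T1 := unit) _ h) => [|[] []//].
rewrite (_ : [set: unit] = [set tt]) ?esum_set1//.
by apply/seteqP; split=> -[].
Qed.

End homogeneous.
End renewal_equation.

Section homogeneous_renewal.
Context {R : realType}.
Variables (theta : R) (k : nnfun R) (kk u : nat -> R).
Hypotheses (theta0 : 0 < theta) (evenk : even k).
Hypothesis kE : forall n, (k ^+ n)%R 0%R = (kk n)%:E.
Hypothesis kk0 : forall n, 0 < kk n.
Hypothesis uP : forall n, pinned theta (fun=> k) n 0%R = (u n)%:E.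
Hypothesis uE : forall n, u n = kk n + theta * \sum_(i < n) u i * kk (n - i)%N.
Hypothesis tail0 : forall n, 0 <= tail_mass theta kk n.

Lemma renewal_gt0 n : 0 < u n.
Proof.
elim/ltn_ind: n => n IH; rewrite uE ltr_pwDl// mulr_ge0 ?(ltW theta0)//.
by apply: sumr_ge0 => i _; rewrite mulr_ge0// ltW// IH.
Qed.

(** Cauchy-Schwarz compares only even times. Passing from an odd index to a neighbouring even one
    costs a factor [e], paid at most once at each end, hence [e ^ 2 <= 3]. *)
Lemma renewal_quasi_monotone (e : R) : 0 < e -> e ^+ 2 <= 3 -> 1 <= e -> e^-1 <= kk 1%N ->
  forall i j, (i <= j)%N -> u j <= 3 * u i.
Proof.
move=> e0 e3 e1 ek.
have kk00 : kk 0%N = 1 by apply: EFin_inj; rewrite -kE expr0 nnfun1E eqxx.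
have up := renewal_gt0.
have u_le n : theta * u n <= 1 + theta.
  rewrite (renewal_identity n kk00 uE) big_ord_recr/= subnn mulrDr.
  have -> : tail_mass theta kk 0 = 1 by rewrite /tail_mass big_ord0 mulr0 subr0.
  rewrite mulr1 addrA lerDr addr_ge0// mulr_ge0 ?(ltW theta0)//.
  by apply: sumr_ge0 => i _; rewrite mulr_ge0// ltW.
(* The optimal parameter [u (m + n) / u (m + m)] turns the additive inequality into the product
   form. *)
have cs m n : u (m + n)%N ^+ 2 <= u (m + m)%N * u (n + n)%N.
  have l0 : 0 < u (m + n)%N / u (m + m)%N by rewrite divr_gt0.
  have := pinned_AMGM (ltW theta0) evenk m n l0.
  rewrite !uP -!EFinM -EFinD lee_fin invf_div divfK ?gt_eqF//.
  have := up (m + n)%N; set x := u (m + n)%N; set y := u (m + m)%N; set z := u (n + n)%N.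
  move=> x0 h; have : x <= y / x * z by move: h; lra.
  by rewrite mulrAC ler_pdivlMr// expr2.
have noninc := @logconvex_noninc _ (fun n => u n.*2) ((1 + theta) / theta).
have {}noninc n : u n.+1.*2 <= u n.*2.
  apply: noninc => {}n; first exact: up.
    have := cs n n.+2; rewrite (_ : n + n.+2 = n.+1.*2)%N ?addnn//.
    by rewrite addnS -addSn addnn.
  by rewrite ler_pdivlMr// mulrC.
have {}noninc i j : (i <= j)%N -> u j.*2 <= u i.*2.
  move=> /subnKC <-; elim: (j - i)%N => [|m IH]; first by rewrite addn0.
  by rewrite addnS; apply: le_trans (noninc _) IH.
have step n : u n <= e * u n.+1.
  have := pinned_step (ltW theta0) evenk n.
  rewrite !uP -[k]expr1 kE -EFinM lee_fin => h.
  rewrite -ler_pdivrMl//; apply: le_trans h.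
  by rewrite ler_pM2r.
have half n : n = n./2.*2 \/ n.+1 = n./2.+1.*2.
  have := odd_double_half n; case: odd => /= h; [right|left] => //.
  by rewrite doubleS -{1}h.
have lo i : u i./2.*2 <= e * u i.
  have := odd_double_half i; case: odd => /= h.
    by rewrite -{2}h; exact: step.
  by rewrite -{2}h add0n ler_peMl// ltW.
have hi j : u j <= e * u (uphalf j).*2.
  have := odd_double_half j; rewrite uphalf_half; case: odd => /= h.
    by rewrite -{1}h add1n doubleS; exact: step.
  by rewrite -{1}h !add0n ler_peMl// ltW.
move=> i j ij; apply: le_trans (hi j) _.
apply: le_trans (ler_wpM2l (ltW e0) (noninc i./2 _ _)) _.
  by apply: leq_trans (half_leq ij) _; rewrite uphalf_half leq_addl.
apply: le_trans (ler_wpM2l (ltW e0) (lo i)) _.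
by rewrite mulrA ler_pM2r.
Qed.

End homogeneous_renewal.

(** * Riemann sums of a nonincreasing function on the half-line *)

Section monotone_integral.
Context {R : realType}.
Local Notation leb := (@lebesgue_measure R).
Variable p : R -> R.
Hypothesis p0 : forall t, 0 <= t -> 0 <= p t.
Hypothesis p_noninc : forall s t, 0 <= s -> s <= t -> p t <= p s.
Local Open Scope ereal_scope.

Lemma measurable_noninc : measurable_fun (`[0%R, +oo[%classic : set R) p.
Proof.
(* Monotonicity is known on the half-line only; composing with [Num.max 0] extends it to the whole
   line. *)
apply: (eq_measurable_fun (fun t : R => p (Num.max 0 t)%R)).
  by move=> t; rewrite inE/= in_itv/= andbT => t0; rewrite max_r.
apply: nonincreasing_measurable => // s t st; apply: p_noninc.
  by rewrite le_max lexx.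
by rewrite ge_max !le_max lexx/= st orbT.
Qed.

Let cell (delta : R) (i : nat) : set R := `[(i%:R * delta)%R, (i.+1%:R * delta)%R[%classic.

Let cell_measure delta i : (0 < delta)%R -> leb (cell delta i) = delta%:E.
Proof.
move=> d0; rewrite lebesgue_measure_itv/= lte_fin ltr_pM2r// ltr_nat ltnSn -EFinB -mulrBl.
by rewrite -natrB// subSnn mul1r.
Qed.

Let cell_integral delta i : (0 < delta)%R ->
  \int[leb]_(t in `[0%R, +oo[) (\1_(cell delta i) t)%:E = delta%:E.
Proof.
move=> d0.
rewrite integral_indic//; last exact: measurable_itv.
have -> : cell delta i `&` `[0%R, +oo[ = cell delta i.
  apply: setIidl => t; rewrite /cell/= !in_itv/= andbT => /andP[it _].
  by apply: le_trans it; rewrite mulr_ge0// ltW.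
exact: cell_measure.
Qed.

Let cell_index delta (t : R) : (0 < delta)%R -> (0 <= t)%R ->
  exists i, cell delta i t /\ forall j, cell delta j t -> j = i.
Proof.
move=> d0 t0; exists (Num.truncn (t / delta)); have h := truncn_itv (divr_ge0 t0 (ltW d0)).
split; first by rewrite /cell/= in_itv/= -ler_pdivlMr// -ltr_pdivrMr.
move=> j; rewrite /cell/= in_itv/= -ler_pdivlMr// -ltr_pdivrMr// => hj.
by apply/eqP; rewrite eq_sym truncn_eq// divr_ge0// ltW.
Qed.

Lemma sum_le_integral (delta : R) M : (0 < delta)%R ->
  (delta * \sum_(i < M) p (i.+1%:R * delta))%:E <= \int[leb]_(t in `[0%R, +oo[) (p t)%:E.
Proof.
move=> d0.
have nd i : (0 <= i%:R * delta)%R by rewrite mulr_ge0// ltW.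
pose h (i : nat) (t : R) := (p (i.+1%:R * delta) * \1_(cell delta i) t)%:E.
have mh i : measurable_fun (`[0%R, +oo[%classic : set R) (h i).
  apply/measurable_EFinP; apply: measurable_funM; first exact: measurable_cst.
  by apply: measurable_indic; exact: measurable_itv.
have mc i : measurable (cell delta i) by exact: measurable_itv.
have h0 i t : 0 <= h i t by rewrite lee_fin mulr_ge0// p0.
have -> : (delta * \sum_(i < M) p (i.+1%:R * delta))%:E =
    \int[leb]_(t in `[0%R, +oo[) \sum_(i < M) h i t.
  rewrite ge0_integral_sum//; last by move=> n; exact: mh.
  rewrite mulr_sumr -sumEFin; apply: eq_bigr => i _.
  under eq_integral do rewrite /h EFinM.
  rewrite ge0_integralZl ?lee_fin ?p0//; last first.
    by apply/measurable_EFinP; apply: measurable_indic; exact: measurable_itv.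
  by rewrite cell_integral// -EFinM mulrC.
apply: ge0_le_integral => //.
- by move=> t _; rewrite sume_ge0.
- by apply: emeasurable_sum => n; exact: mh.
- by apply/measurable_EFinP; exact: measurable_noninc.
move=> t /=; rewrite in_itv/= andbT => t0.
have [i0 [it uniq]] := cell_index d0 t0.
have hz j : j != i0 -> h j t = 0.
  move=> ji; rewrite /h indicE memNset ?mulr0// => /uniq ej; by rewrite ej eqxx in ji.
have hi : h i0 t <= (p t)%:E.
  rewrite lee_fin indicE mem_set// mulr1; apply: p_noninc => //.
  by move: it; rewrite /cell/= in_itv/= => /andP[_ /ltW].
have [iM|iM] := ltnP i0 M.
  rewrite (bigD1 (Ordinal iM))//= big1 ?adde0// => j ji; apply: hz.
  by apply: contra ji => /eqP ej; apply/eqP/val_inj.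
rewrite big1 ?lee_fin ?p0// => j _; apply: hz.
by apply: contraTneq (ltn_ord j) => ->; rewrite -leqNgt.
Qed.

Lemma integral_le_sum (delta B : R) : (0 < delta)%R ->
  (forall M, delta * \sum_(i < M) p (i%:R * delta) <= B)%R ->
  \int[leb]_(t in `[0%R, +oo[) (p t)%:E <= B%:E.
Proof.
move=> d0 HB.
have nd i : (0 <= i%:R * delta)%R by rewrite mulr_ge0// ltW.
pose h (i : nat) (t : R) := (p (i%:R * delta) * \1_(cell delta i) t)%:E.
have mh i : measurable_fun (`[0%R, +oo[%classic : set R) (h i).
  apply/measurable_EFinP; apply: measurable_funM; first exact: measurable_cst.
  by apply: measurable_indic; exact: measurable_itv.
have mc i : measurable (cell delta i) by exact: measurable_itv.
have h0 i t : 0 <= h i t by rewrite lee_fin mulr_ge0// p0.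
apply: (@le_trans _ _ (\int[leb]_(t in `[0%R, +oo[) \sum_(0 <= i <oo) h i t)).
  apply: ge0_le_integral => //.
  - by move=> t /=; rewrite in_itv/= andbT lee_fin => t0; exact: p0.
  - by apply/measurable_EFinP; exact: measurable_noninc.
  - by apply: (ge0_emeasurable_sum (P := xpredT)) => [i t _ _|i _]; [exact: h0|exact: mh].
  move=> t /=; rewrite in_itv/= andbT => t0.
  have [i0 [it uniq]] := cell_index d0 t0.
  apply: (@le_trans _ _ (h i0 t)).
    rewrite lee_fin indicE mem_set// mulr1; apply: p_noninc => //.
    by move: it; rewrite /cell/= in_itv/= => /andP[].
  apply: le_trans (nneseries_lim_ge i0.+1 (fun i _ _ => h0 i t)).
  rewrite big_nat_recr//= -[leLHS]add0e; apply: leeD => //.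
  exact: sume_ge0.
rewrite integral_nneseries//.
apply: lime_le; first by apply: is_cvg_nneseries => i _ _; exact: integral_ge0.
near=> M; apply: le_trans (_ : (delta * \sum_(i < M) p (i%:R * delta))%:E <= _); last first.
  by rewrite lee_fin.
rewrite big_mkord mulr_sumr -sumEFin; apply: lee_sum => i _.
under eq_integral do rewrite /h EFinM.
rewrite ge0_integralZl ?lee_fin ?p0//; last first.
  by apply/measurable_EFinP; apply: measurable_indic; exact: measurable_itv.
by rewrite cell_integral// -EFinM mulrC.
Unshelve. all: by end_near.
Qed.

End monotone_integral.

(** * The renewal setting of the heat kernel at the critical parameter *)

Section heat_renewal.
Context {R : realType}.
Local Notation leb := (@lebesgue_measure R).
Variables (gamma : R) (J : int -> R).
Hypotheses (g23 : 2 / 3 < gamma) (g1 : gamma < 1).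
Hypothesis JK : jump_kernel gamma J.
Hypothesis Jeq : equiv_at_infinity J (fun x => absr x `^ (- (1 + gamma))).

Definition return_prob (t : R) : R := fine (heat JK t 0).
Local Notation p := return_prob.

Lemma return_probE t : 0 <= t -> heat JK t 0 = (p t)%:E.
Proof. by move=> t0; exact: heat_fin. Qed.

Lemma return_prob_ge0 t : 0 <= p t.
Proof. by rewrite fine_ge0// nnfun_ge0. Qed.

Lemma return_prob_noninc s t : 0 <= s -> s <= t -> p t <= p s.
Proof.
move=> s0 st; have t0 := le_trans s0 st.
by rewrite -lee_fin -!return_probE//; exact: heat_noninc.
Qed.

Lemma return_prob_ge_exp t : 0 <= t -> expR (- t) <= p t.
Proof. by move=> t0; rewrite -lee_fin -return_probE//; exact: heat_ge_exp. Qed.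

Lemma heat0 : heat JK 0 = 1.
Proof.
rewrite /heat oppr0 expR0; have -> : pt 0 * jumpf JK = 0.
  by apply: nnfunP => x; rewrite ptME// mul0e nnfun0E.
by rewrite cp0 mulr1; apply: nnfunP => x; rewrite ptE// nnfun1E.
Qed.

Lemma return_prob0 : p 0 = 1.
Proof. by rewrite /p heat0 nnfun1E eqxx. Qed.

Lemma heatX d n : 0 <= d -> heat JK d ^+ n = heat JK (n%:R * d).
Proof.
move=> d0; elim: n => [|n IH]; first by rewrite mul0r heat0 expr0.
by rewrite exprS IH -natr1 mulrDl mul1r addrC -heatD// mulr_ge0.
Qed.

Let a : R := gamma^-1 - 1.
Let g0 : 0 < gamma. Proof. by have h := g23; lra. Qed.
Let g2 : 2^-1 < gamma. Proof. by have h := g23; lra. Qed.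

Lemma renewal_exponent : 0 < a /\ a < 2^-1.
Proof.
have h1 : 1 < gamma^-1 by rewrite invf_gt1.
have h2 : gamma^-1 < 3 / 2.
  by rewrite -[3 / 2]invf_div ltf_pV2 ?posrE ?divr_gt0.
by rewrite /a; split; lra.
Qed.

Let a0 : 0 < a := renewal_exponent.1.
Let a1 : a < 1. Proof. by have := renewal_exponent.2; lra. Qed.

Lemma sum_powR_tail (delta : R) N M : (0 < N)%N -> (N <= M)%N -> 0 < delta ->
  delta * \sum_(N <= i < M) (i.+1%:R * delta) `^ (- (1 + a)) <= a^-1 * (N%:R * delta) `^ (- a).
Proof.
move=> N0 NM d0.
have term i : (0 < i)%N -> delta * (i.+1%:R * delta) `^ (- (1 + a)) <=
    a^-1 * ((i%:R * delta) `^ (- a) - (i.+1%:R * delta) `^ (- a)).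
  move=> i0; have h := powR_telescope i0 a0 (ltW a1).
  rewrite !powRM ?(ltW d0)// mulrCA.
  have -> : delta * delta `^ (- (1 + a)) = delta `^ (- a).
    by rewrite -[X in X * _]powRr1 ?(ltW d0)// -powRDp//; congr (_ `^ _); ring.
  apply: le_trans (ler_wpM2r (powR_ge0 delta (- a)) h) _.
  by rewrite -mulrA mulrBl.
rewrite mulr_sumr.
apply: (@le_trans _ _ (\sum_(N <= i < M) a^-1 * ((i%:R * delta) `^ (- a) - (i.+1%:R * delta) `^ (- a)))).
  rewrite big_nat_cond [leRHS]big_nat_cond; apply: ler_sum => i /andP[/andP[Ni _] _].
  by apply: term; exact: leq_trans Ni.
rewrite -mulr_sumr ler_pM2l ?invr_gt0//.
rewrite (eq_bigr (fun i => - ((i.+1%:R * delta) `^ (- a) - (i%:R * delta) `^ (- a)))); last first.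
  by move=> i _; rewrite [RHS]opprB.
by rewrite sumrN (telescope_sumr (fun i => (i%:R * delta) `^ (- a)))// opprB lerBlDr lerDl powR_ge0.
Qed.

Definition total_occupation : R := \int[leb]_(t in `[0, +oo[) p t.
Local Notation I := total_occupation.
Local Notation beta := (I^-1).

Lemma partial_sum_le (delta : R) n (C : R) M : 0 < delta -> (0 < n)%N -> 0 < C ->
  (forall t, 0 < t -> p t <= C * t `^ (- gamma^-1)) ->
  delta * \sum_(i < M) p (i%:R * delta) <=
  delta + delta * \sum_(i < n) p (i.+1%:R * delta) + C / a * (n%:R * delta) `^ (- a).
Proof.
move=> d0 n0 C0 hi.
have nd i : 0 <= i%:R * delta by rewrite mulr_ge0// ltW.
have pn i : 0 <= p (i%:R * delta) by exact: return_prob_ge0.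
have first : delta * \sum_(i < n.+1) p (i%:R * delta) = delta + delta * \sum_(i < n) p (i.+1%:R * delta).
  by rewrite big_ord_recl/= mul0r return_prob0 mulrDr mulr1.
have extra : 0 <= C / a * (n%:R * delta) `^ (- a).
  by rewrite mulr_ge0 ?powR_ge0// divr_ge0// ltW.
have [Mn|nM] := leqP M n.+1.
  apply: ler_wpDr => //; rewrite -first ler_pM2l//.
  rewrite -!(big_mkord xpredT (fun i => p (i%:R * delta))) (big_cat_nat (leq0n M) Mn)/= lerDl.
  by apply: sumr_ge0.
rewrite -first -(big_mkord xpredT (fun i => p (i%:R * delta))) (big_cat_nat (leq0n n.+1) (ltnW nM))/=.
rewrite mulrDr big_mkord lerD2l.
rewrite -[M]prednK ?(leq_ltn_trans _ nM)// big_add1.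
have nM1 : (n <= M.-1)%N by rewrite -ltnS prednK ?(leq_ltn_trans _ nM)// ltnW.
have := ler_wpM2l (ltW C0) (sum_powR_tail n0 nM1 d0).
rewrite [leRHS]mulrA => /(le_trans _); apply.
rewrite mulrCA ler_pM2l// mulr_sumr; apply: ler_sum => i _.
have -> : 1 + a = gamma^-1 by rewrite /a; ring.
by apply: hi; rewrite mulr_gt0.
Qed.

(** Sums over right endpoints stay below the integral and sums over left endpoints above it; the two
    differ by the initial term [delta * p 0 = delta]. The part beyond [n] is bounded by a power
    tail, which also shows that the integral is finite. *)
Lemma occupation_bounds : exists2 C : R, 0 < C &
  [/\ 0 < I, forall (delta : R) M, 0 < delta -> delta * \sum_(i < M) p (i.+1%:R * delta) <= I &
   forall (delta : R) n, 0 < delta -> (0 < n)%N ->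
    I <= delta + delta * \sum_(i < n) p (i.+1%:R * delta) + C / a * (n%:R * delta) `^ (- a)].
Proof.
have [C C0 hi] := heat_hi g0 g1 JK Jeq g2.
have hi' t : 0 < t -> p t <= C * t `^ (- gamma^-1).
  by move=> t0; rewrite -lee_fin -return_probE ?(ltW t0)// hi.
have p0 (t : R) : 0 <= t -> 0 <= p t by move=> _; exact: return_prob_ge0.
have lo := sum_le_integral p0 return_prob_noninc.
have up delta n : 0 < delta -> (0 < n)%N -> (\int[leb]_(t in `[0%R, +oo[) (p t)%:E <=
    (delta + delta * \sum_(i < n) p (i.+1%:R * delta) + C / a * (n%:R * delta) `^ (- a))%:E)%E.
  move=> d0 n0; apply: (integral_le_sum p0 return_prob_noninc d0) => M.
  exact: partial_sum_le.
have IE : (\int[leb]_(t in `[0%R, +oo[) (p t)%:E = I%:E)%E.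
  rewrite /I /Rintegral fineK// ge0_fin_numE; last by apply: integral_ge0 => t _; rewrite lee_fin return_prob_ge0.
  exact: le_lt_trans (up 1 1%N ltr01 isT) (ltry _).
rewrite IE in lo up.
have lo' (delta : R) M : 0 < delta -> delta * \sum_(i < M) p (i.+1%:R * delta) <= I.
  by move=> d0; rewrite -lee_fin lo.
exists C => //; split=> //.
apply: lt_le_trans (lo' 1 1%N ltr01); rewrite big_ord1 !mul1r.
exact: lt_le_trans (expR_gt0 _) (return_prob_ge_exp ler01).
Qed.

(** The discretisation error of the total mass is at most [beta * delta]. It keeps the tail mass
    nonnegative, but would dominate it at very large times; the upper tail bound is therefore
    claimed up to [S] only, where [delta <= S ^ (- a) <= t ^ (- a)]. All constants are chosen before
    [delta] and [S]. *)
Lemma heat_renewal : exists c1 C1 c2 C2 : R, [/\ 0 < I, 0 < c1, 0 < C1, 0 < c2 & 0 < C2 /\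
  forall delta S : R, 0 < delta -> delta <= 4^-1 -> 0 < S -> delta <= S `^ (- a) ->
  exists2 u : nat -> R, (forall n, pinned (beta * delta) (fun=> heat JK delta) n 0 = (u n)%:E) &
    renewal_setting a beta c1 C1 c2 C2 delta S (fun n => p (n%:R * delta)) u].
Proof.
have [C C0 [I0 lo up]] := occupation_bounds.
have [C1 C10 hi] := heat_hi g0 g1 JK Jeq g2.
have [c1 c10 hlo] := heat_lo g0 g1 JK Jeq.
have b0 : 0 < beta by rewrite invr_gt0.
exists c1, C1, (beta * c1 * 3 `^ (- (1 + a))), (beta * (1 + C / a)); split=> //.
  by rewrite !mulr_gt0// powR_gt0.
split; first by rewrite mulr_gt0// addr_gt0// divr_gt0.
move=> delta S d0 d4 S0 dS.
have g1a : gamma^-1 = 1 + a by rewrite /a; ring.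
have nd i : 0 <= i%:R * delta by rewrite mulr_ge0// ltW.
have th0 : 0 < beta * delta by rewrite mulr_gt0.
have q0 (i n : nat) : 0 <= p ((n - i)%N%:R * delta) by exact: return_prob_ge0.
have prodE i n : (i <= n)%N ->
    (\prod_(i <= l < n) heat JK delta) 0 = (p ((n - i)%N%:R * delta))%:E.
  by move=> _; rewrite prodr_const_nat heatX ?(ltW d0)// return_probE.
have [u uP [_ uE]] := pinned_real (ltW th0) q0 prodE.
have {}uE n : u n = p (n%:R * delta) + beta * delta * \sum_(i < n) u i * p ((n - i)%N%:R * delta).
  by rewrite {1}uE subn0.
have kpos n : 0 < p (n%:R * delta) by exact: lt_le_trans (expR_gt0 _) (return_prob_ge_exp (nd n)).
have tm n : tail_mass (beta * delta) (fun n => p (n%:R * delta)) n =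
    beta * (I - delta * \sum_(i < n) p (i.+1%:R * delta)).
  by rewrite /tail_mass mulrBr mulVf ?gt_eqF// mulrA.
have t0 n : 0 <= tail_mass (beta * delta) (fun n => p (n%:R * delta)) n.
  by rewrite tm mulr_ge0 ?(ltW b0)// subr_ge0 lo.
have evenh : even (heat JK delta) by apply: peaked_even; apply: peaked_heat; exact: ltW.
have kE n : (heat JK delta ^+ n) 0 = (p (n%:R * delta))%:E by rewrite heatX ?(ltW d0)// return_probE.
exists u => //; split=> //.
- by apply: le_trans d4 _; rewrite invf_le1// ler1n.
- by rewrite mul0r return_prob0.
- by move=> n; exact: ltW.
- move=> n n0; rewrite -lee_fin -return_probE// -g1a; apply: hi.
  by rewrite mulr_gt0// ltr0n.
- by move=> n; rewrite -lee_fin -return_probE// -g1a; exact: hlo.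
- move=> n; set t := n%:R * delta => t1; have tp := lt_le_trans ltr01 t1.
  rewrite tm -!mulrA ler_pM2l//.
  have := lo delta (n + n)%N d0; rewrite big_split_ord/= mulrDr => h.
  (* Only the indices from [n + 1] to [2 n] are used, where the kernel is at least [p (2 t)]; the
     [3] comes from [1 + 2 t <= 3 t]. *)
  have h2 : c1 * (3 `^ (- (1 + a)) * t `^ (- a)) <= delta * \sum_(i < n) p ((n + i).+1%:R * delta).
    apply: (@le_trans _ _ (t * p (2 * t))).
      apply: (@le_trans _ _ (t * (c1 * (1 + 2 * t) `^ (- (1 + a))))); last first.
        have t20 : 0 <= 2 * t by apply: mulr_ge0 => //; exact: ltW.
        by rewrite ler_pM2l// -lee_fin -(return_probE t20) -g1a; exact: hlo.
      rewrite [leRHS]mulrCA ler_pM2l//.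
      have -> : t `^ (- a) = t * t `^ (- (1 + a)).
        by rewrite -[X in X * _]powRr1 ?(ltW tp)// -powRDp//; congr (_ `^ _); ring.
      rewrite [leLHS]mulrCA ler_pM2l// -powRM ?(ltW tp)//; apply: powR_le_neg.
      - by rewrite addr_gt0// mulr_gt0.
      - by move: t1; lra.
      - by rewrite addr_ge0// ltW.
    rewrite /t [_%:R * delta]mulrC -mulrA ler_pM2l//.
    rewrite -[n in n%:R * _]card_ord -sumr_const mulr_suml; apply: ler_sum => i _.
    rewrite mul1r; apply: return_prob_noninc => //.
    rewrite [delta * n%:R]mulrC mulrA ler_pM2r// -natrM ler_nat -addnS mul2n -addnn leq_add2l.
    exact: ltn_ord.
  by move: h h2; set x := c1 * _; set y := delta * _; set z := delta * _; lra.
- move=> n n0; set t := n%:R * delta => tS; have tp : 0 < t by rewrite mulr_gt0// ltr0n.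
  rewrite tm -mulrA ler_pM2l// mulrDl mul1r.
  have dt : delta <= t `^ (- a) by apply: le_trans dS _; apply: powR_le_neg => //; exact: ltW.
  have := up delta n d0 n0; rewrite -/t; move: dt; set x := t `^ _; set y := delta * _; set z := C / a * x; lra.
- exact: (renewal_gt0 th0 kpos uE).
(* The kernel after one mesh is at least [exp (- delta) >= 1 - delta], so
   [e = (1 - delta)^-1 <= 4 / 3] is admissible. *)
- have e0 : 0 < (1 - delta)^-1 by rewrite invr_gt0; lra.
  have e43 : (1 - delta)^-1 <= 4 / 3 by rewrite -[4 / 3]invf_div lef_pV2 ?posrE ?divr_gt0//; lra.
  apply: (renewal_quasi_monotone th0 evenh kE kpos uP uE t0 e0).
  + by rewrite expr2; nra.
  + by rewrite invf_ge1; lra.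
  + rewrite invrK; apply: le_trans (return_prob_ge_exp (nd 1%N)).
    by rewrite mul1r; have := expR_ge1Dx (- delta).
Qed.

End heat_renewal.

(** * The change of measure *)

Section tilted_kernel.
Context {R : realType}.
Variables (gamma : R) (J : int -> R).
Hypotheses (g23 : 2 / 3 < gamma) (g1 : gamma < 1).
Hypothesis JK : jump_kernel gamma J.
Hypothesis Jeq : equiv_at_infinity J (fun x => absr x `^ (- (1 + gamma))).
Let g0 : 0 < gamma. Proof. by have h := g23; lra. Qed.
Local Notation p := (return_prob JK).
Local Notation a := (gamma^-1 - 1).

Definition tail_prob (h : R) : R := fine (total (tailf JK h)).

Lemma tail_probE h : total (tailf JK h) = (tail_prob h)%:E.
Proof.
rewrite /tail_prob fineK// ge0_fin_numE ?total_ge0//.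
apply: (@le_lt_trans _ _ 1%E); last exact: ltry.
rewrite -(total_jump JK); apply: le_esum => x _ /=.
by rewrite lee_fin; case: ifP => // _; exact: (jump_ge0 JK).
Qed.

Lemma tail_prob_ge0 h : 0 <= tail_prob h.
Proof. by rewrite fine_ge0// total_ge0. Qed.

(* The tilt at time [l * delta] increases the rate of the jumps of [Y] that are
   at least as large as the typical displacement [(l * delta) ^ (1 / gamma)]. *)
Section tilt.
Variables (H kappa rho delta : R).
Hypotheses (kappa0 : 0 < kappa) (rho0 : 0 < rho) (delta0 : 0 < delta).

Definition tilt_level (l : nat) : R := H * (l%:R * delta) `^ gamma^-1.
(** No tilt is applied before time [1]: from then on [tilt_level] is at least [1] when [H >= 1], the
    range in which the jump tails are controlled. *)
Definition tilt_strength (l : nat) : R := if 1 <= l%:R * delta then kappa else 0.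
Definition tilt_jumps (l : nat) : nnfun R :=
  pt (tilt_strength l * (rho * delta)) * tailf JK (tilt_level l).
Definition tilt_mean (l : nat) : R := tilt_strength l * (rho * delta) * tail_prob (tilt_level l).
(** Law of the increment of [X - Y] over one mesh interval under the tilt. Multiplying the rate of
    large jumps by [1 + kappa] amounts to adding an independent compound Poisson variable with
    [kappa] times that rate, of mean number [tilt_mean]. *)
Definition tilted (l : nat) : nnfun R :=
  heat JK delta * (pt (expR (- tilt_mean l)) * cp (tilt_jumps l)).

Lemma tilt_strength_ge0 l : 0 <= tilt_strength l.
Proof. by rewrite /tilt_strength; case: ifP => // _; exact: ltW. Qed.

Lemma tilt_strength_rate_ge0 l : 0 <= tilt_strength l * (rho * delta).
Proof. by rewrite !mulr_ge0 ?tilt_strength_ge0// ltW. Qed.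

Lemma tilt_mean_ge0 l : 0 <= tilt_mean l.
Proof. by rewrite mulr_ge0 ?tail_prob_ge0 ?tilt_strength_rate_ge0. Qed.

Lemma total_tilt_jumps l : total (tilt_jumps l) = (tilt_mean l)%:E.
Proof. by rewrite totalM total_pt ?tilt_strength_rate_ge0// tail_probE -EFinM. Qed.

Lemma even_tilt_jumps l : even (tilt_jumps l).
Proof. by move=> x; rewrite !ptME ?tilt_strength_rate_ge0// even_tail. Qed.

Lemma total_tilt_sum i n :
  total (\sum_(i <= l < n) tilt_jumps l) = (\sum_(i <= l < n) tilt_mean l)%:E.
Proof.
elim/big_ind2: _ => [|x1 x2 y1 y2 h1 h2|l _]; last exact: total_tilt_jumps.
  by rewrite /total esum1.
by rewrite totalD h1 h2.
Qed.

Lemma even_tilt_sum i n : even (\sum_(i <= l < n) tilt_jumps l).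
Proof.
elim/big_ind: _ => [x|f g ef eg x|l _]; last exact: even_tilt_jumps.
  by rewrite !nnfun0E.
by rewrite !nnfunDE ef eg.
Qed.

Lemma tilted_prod i n : (i <= n)%N -> \prod_(i <= l < n) tilted l =
  heat JK ((n - i)%N%:R * delta) *
  (pt (expR (- \sum_(i <= l < n) tilt_mean l)) * cp (\sum_(i <= l < n) tilt_jumps l)).
Proof.
move=> in_; rewrite /tilted big_split/= prodr_const_nat heatX ?(ltW delta0)//.
rewrite big_split/= cp_sum.
suff -> : \prod_(i <= l < n) pt (expR (- tilt_mean l)) = pt (expR (- \sum_(i <= l < n) tilt_mean l)) by [].
elim: (index_iota i n) => [|l s IH].
  by rewrite !big_nil oppr0 expR0; apply: nnfunP => x; rewrite ptE// nnfun1E.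
by rewrite !big_cons IH opprD expRD (ptM (expR_ge0 _) (expR_ge0 _)).
Qed.

(** Additional symmetric jumps cannot raise the value at the origin of a peaked law. *)
Lemma tilted_prod_fin i n : (i <= n)%N ->
  exists2 r, (\prod_(i <= l < n) tilted l) 0 = r%:E & 0 <= r <= p ((n - i)%N%:R * delta).
Proof.
move=> in_; rewrite tilted_prod//.
set M := \sum_(i <= l < n) tilt_mean l; set G := \sum_(i <= l < n) tilt_jumps l.
have M0 : 0 <= M by apply: sumr_ge0 => l _; exact: tilt_mean_ge0.
have s0 : 0 <= (n - i)%N%:R * delta by rewrite mulr_ge0// ltW.
have le1 : ((heat JK ((n - i)%N%:R * delta) * (pt (expR (- M)) * cp G))%R 0%R <=
    (p ((n - i)%N%:R * delta))%:E)%E.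
  rewrite mulrCA (ptME _ _ (expR_ge0 _)).
  have h := conv_le_peak (even_cp (even_tilt_sum i n)) (peaked_heat JK s0).
  rewrite (total_cp M0 (total_tilt_sum i n)) return_probE// in h.
  apply: le_trans (lee_wpmul2l _ h) _; first by rewrite lee_fin expR_ge0.
  by rewrite -!EFinM lee_fin mulrCA -expRD addNr expR0 mulr1.
set X := nnfun_val _ _ in le1 *.
have X0 : (0 <= X)%E by exact: nnfun_ge0.
have Xf : X \is a fin_num by rewrite ge0_fin_numE// (le_lt_trans le1)// ltry.
exists (fine X); first by rewrite fineK.
by rewrite -!lee_fin fineK// X0.
Qed.

End tilt.

(** For [n / 4 <= i <= n / 2], the mean number [M] of extra jumps between [i] and [n] lies between
    [kappa * rho * cM] and [CM]. Such jumps land where the heat kernel is at most half of its value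
    at the origin, so by [conv_cp_gain] the return probability loses a factor
    [1 - exp (- M) * M / 2]. *)
Lemma tilted_gain : exists (H c C : R), [/\ 1 <= H, 0 < c, c <= 1, 0 < C &
  (forall rho delta kappa : R, 0 < kappa -> kappa <= 1 -> 0 < rho -> rho <= 1 -> 0 < delta ->
    forall i n, 4 <= n%:R * delta -> (n <= 4 * i)%N -> (2 * i <= n)%N ->
    ((\prod_(i <= l < n) tilted H kappa rho delta l)%R 0%R <=
      ((1 - c * (kappa * rho)) * p ((n - i)%N%:R * delta))%:E)%E) /\
  forall delta l, 0 < delta -> 1 <= l%:R * delta ->
    tail_prob (tilt_level H delta l) <= C * (l%:R * delta)^-1].
Proof.
have [C C0 hi] := tail_hi g0 g1 JK Jeq.
have [c c0 lo] := tail_lo g0 g1 JK Jeq.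
have [c1 c10 hlo] := heat_lo g0 g1 JK Jeq.
have gi0 : 0 <= gamma^-1 by rewrite invr_ge0 ltW.
(* At a distance of at least [H (t / 4) ^ (1 / gamma)] the heat kernel is below the inverse
   distance, while at the origin it is at least [c1 (2 t) ^ (- 1 / gamma)]. With [2 t = 8 (t / 4)],
   this [H] makes the ratio at most [1/2]. *)
pose H := Num.max 1 (2 * 8 `^ gamma^-1 / c1).
have H1 : 1 <= H by rewrite le_max lexx.
have Hc : 2 * 8 `^ gamma^-1 <= H * c1 by rewrite -ler_pdivrMr// le_max lexx orbT.
clearbody H.
have H0 : 0 < H := lt_le_trans ltr01 H1.
pose K := H `^ (- gamma); have K0 : 0 < K by rewrite powR_gt0.
have level1 delta l : 1 <= l%:R * delta -> 1 <= tilt_level H delta l.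
  by move=> l1; rewrite -[1]mulr1; apply: ler_pM => //; exact: powR_ge1.
have levelE delta l : 1 <= l%:R * delta -> tilt_level H delta l `^ (- gamma) = K * (l%:R * delta)^-1.
  move=> l1; have l0 := lt_le_trans ltr01 l1.
  rewrite /tilt_level powRM ?powR_ge0 ?(ltW H0)// -powRrM mulrN mulVf ?gt_eqF//.
  by rewrite powR_inv1 ?(ltW l0).
have hi' delta l : 0 < delta -> 1 <= l%:R * delta ->
    tail_prob (tilt_level H delta l) <= C * K * (l%:R * delta)^-1.
  by move=> d0 l1; rewrite -lee_fin -tail_probE -mulrA -levelE// hi// level1.
have lo' delta l : 0 < delta -> 1 <= l%:R * delta ->
    c * K * (l%:R * delta)^-1 <= tail_prob (tilt_level H delta l).
  by move=> d0 l1; rewrite -lee_fin -tail_probE -mulrA -levelE// lo// level1.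
(* The [4] comes from [l * delta >= t / 4], the [1/2] from the elapsed time being at least
   [t / 2]. *)
pose CM := 4 * C * K; pose cM := c * K / 2.
have CM0 : 0 < CM by rewrite !mulr_gt0.
have cM0 : 0 < cM by rewrite !mulr_gt0.
pose e := Num.min 1 (expR (- CM) * (cM / 2)).
have e0 : 0 < e by rewrite lt_min ltr01 mulr_gt0 ?expR_gt0// divr_gt0.
exists H, e, (C * K); split=> //; [by rewrite ge_min lexx|by rewrite mulr_gt0|].
split=> // rho delta kappa k0 k1 r0 r1 d0 i n n4 n4i n2i.
set t := n%:R * delta in n4 *.
have t0 : 0 < t by apply: lt_le_trans n4.
have np : 0 < n%:R :> R by rewrite -(pmulr_lgt0 _ d0).
have in_ : (i <= n)%N by move: n2i; clear; lia.
have l1 l : (i <= l)%N -> t / 4 <= l%:R * delta.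
  move=> il; rewrite /t mulrAC ler_pM2r// ler_pdivrMr// -natrM ler_nat mulnC.
  by apply: leq_trans n4i _; rewrite leq_mul2l.
have l1' l : (i <= l)%N -> 1 <= l%:R * delta.
  by move=> il; apply: le_trans (l1 l il); rewrite ler_pdivlMr// mul1r.
rewrite tilted_prod ?(ltW d0)//.
set M := \sum_(i <= l < n) tilt_mean H kappa rho delta l.
set G := \sum_(i <= l < n) tilt_jumps H kappa rho delta l.
set s := (n - i)%N%:R * delta.
have s0 : 0 <= s by rewrite mulr_ge0// ltW.
have st : s <= t by rewrite ler_pM2r// ler_nat leq_subr.
have st2 : t / 2 <= s.
  rewrite /t mulrAC ler_pM2r// ler_pdivrMr// -natrM ler_nat; move: n2i; clear; lia.
have sumconst (x : R) : \sum_(i <= l < n) x = (n - i)%N%:R * x.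
  by rewrite sumr_const_nat mulr_natl.
have kr0 : 0 < kappa * rho by rewrite mulr_gt0.
have kr1 : kappa * rho <= 1 by rewrite mulr_ile1// ltW.
have Mhi : M <= CM.
  apply: (@le_trans _ _ (\sum_(i <= l < n) delta * (CM * t^-1))).
    rewrite /M big_nat_cond [leRHS]big_nat_cond; apply: ler_sum => l /andP[/andP[il _] _].
    rewrite /tilt_mean /tilt_strength l1'//.
    apply: (@le_trans _ _ (1 * delta * (C * K * (l%:R * delta)^-1))).
      rewrite mulrA; apply: ler_pM; rewrite ?tail_prob_ge0 ?hi' ?l1'//.
        by rewrite mulr_ge0 ?(ltW kr0)// ltW.
      by rewrite ler_pM2r.
    rewrite mul1r ler_pM2l// /CM -!mulrA [4 * _]mulrC -!mulrA ler_pM2l// ler_pM2l//.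
    have h : (l%:R * delta)^-1 <= (t / 4)^-1.
      rewrite lef_pV2 ?posrE; [exact: l1| |by rewrite divr_gt0].
      by apply: lt_le_trans (l1' l il).
    by rewrite invf_div in h; rewrite mulrC.
  rewrite sumconst mulrA -/s mulrCA ger_pMr// ler_pdivrMr// mul1r//.
have Mlo : kappa * rho * cM <= M.
  apply: (@le_trans _ _ (\sum_(i <= l < n) delta * (kappa * rho * (c * K) * t^-1))).
    rewrite sumconst mulrA -/s; apply: (@le_trans _ _ (kappa * rho * (c * K) * (t / 2 * t^-1))).
      have -> : t / 2 / t = 2^-1 by field; rewrite gt_eqF.
      by rewrite /cM mulrA.
    rewrite [leRHS]mulrCA ler_pM2l ?mulr_gt0// ler_pM2r ?invr_gt0//.
  rewrite /M big_nat_cond [leRHS]big_nat_cond; apply: ler_sum => l /andP[/andP[il ln] _].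
  rewrite /tilt_mean /tilt_strength l1'//.
  rewrite (_ : _ * t^-1 = kappa * rho * (c * K * t^-1)); last by ring.
  rewrite mulrCA [kappa * (rho * delta)]mulrA -[leRHS]mulrA ler_pM2l//.
  rewrite ler_pM2l//; apply: le_trans (lo' _ _ d0 (l1' l il)).
  rewrite ler_pM2l ?mulr_gt0// lef_pV2 ?posrE//; first by rewrite ler_pM2r// ler_nat ltnW.
  exact: lt_le_trans (l1' l il).
have M0 : 0 <= M by apply: le_trans Mlo; rewrite mulr_ge0 ?ltW.
rewrite mulrCA (ptME _ _ (expR_ge0 _)).
have eG : even G by apply: even_tilt_sum => //; exact: ltW.
have tG : total G = M%:E by apply: total_tilt_sum.
have gap x : G x != 0%E -> (heat JK s x <= (2^-1)%:E * heat JK s 0%R)%E.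
  move=> Gx.
  have [l [il ln hx]] : exists l, [/\ (i <= l)%N, (l < n)%N & tilt_level H delta l <= absr x].
    case: (pselect (exists l, [/\ (i <= l)%N, (l < n)%N & tilt_level H delta l <= absr x])) => // nex.
    exfalso; move/eqP: Gx; apply; rewrite /G nnfun_sumE big_nat_cond big1// => l /andP[/andP[il ln] _].
    rewrite ptME ?tilt_strength_rate_ge0//=; case: ifPn => hx; last by rewrite mule0.
    by exfalso; apply: nex; exists l.
  have xlo : H * (t / 4) `^ gamma^-1 <= absr x.
    apply: le_trans hx; rewrite ler_pM2l//; apply: powR_le_base => //; last exact: l1.
    by rewrite divr_ge0// ltW.
  apply: le_trans (heat_le JK x s0) _.
  apply: (@le_trans _ _ (2^-1 * (c1 * (1 + s) `^ (- gamma^-1)))%:E); last first.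
    by rewrite [in leRHS](return_probE _ s0) -EFinM lee_fin ler_pM2l// -lee_fin -return_probE// hlo.
  rewrite lee_fin.
  have P0 : 0 < (t / 4) `^ gamma^-1 by rewrite powR_gt0// divr_gt0.
  apply: (@le_trans _ _ (H * (t / 4) `^ gamma^-1)^-1).
    rewrite lef_pV2 ?posrE ?ltr0n//; last exact: mulr_gt0.
    by apply: le_trans xlo _; rewrite /absr -abszE -pmulrn ler_nat.
  apply: (@le_trans _ _ (2^-1 * (c1 * (2 * t) `^ (- gamma^-1)))); last first.
    rewrite ler_pM2l// ler_pM2l//; apply: powR_le_neg => //; first by rewrite ltr_wpDr.
    by move: st n4; lra.
  have -> : 2 * t = 8 * (t / 4) by field.
  have E0 : 0 < 8 `^ gamma^-1 :> R by rewrite powR_gt0.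
  rewrite [in leRHS]powRN [in leRHS](powRM _ _ (ltW (divr_gt0 t0 _)))//.
  have -> : 2^-1 * (c1 * (8 `^ gamma^-1 * (t / 4) `^ gamma^-1)^-1) =
      (2 * 8 `^ gamma^-1 / c1 * (t / 4) `^ gamma^-1)^-1.
    by field; rewrite !gt_eqF.
  rewrite lef_pV2 ?posrE; first by rewrite ler_pM2r// ler_pdivrMr.
    by apply: mulr_gt0.
  by rewrite mulr_gt0// divr_gt0// mulr_gt0.
have := conv_cp_gain (peaked_heat JK s0) eG M0 tG gap.
set X := (heat JK s * cp G) 0; rewrite return_probE// -!EFinM.
have := nnfun_ge0 (heat JK s * cp G) 0; rewrite -/X.
case: X => [X| |]// _; rewrite -EFinD -EFinM !lee_fin => h.
have := ler_wpM2l (expR_ge0 (- M)) h; rewrite mulrDr => {}h.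
have : expR (- M) * X <= p s * (1 - expR (- M) * (M / 2)).
  have : expR (- M) * (p s * expR M) = p s by rewrite mulrCA -expRD addNr expR0 mulr1.
  by move: h; lra.
move=> /le_trans; apply; rewrite mulrC ler_wpM2r ?return_prob_ge0// lerD2l lerN2.
apply: (@le_trans _ _ (expR (- CM) * (kappa * rho * cM / 2))).
  rewrite [leLHS]mulrC [leRHS](_ : _ = kappa * rho * (expR (- CM) * (cM / 2))); last by ring.
  by rewrite ler_pM2l// ge_min lexx orbT.
apply: ler_pM; first exact: expR_ge0.
- by apply: divr_ge0 => //; apply: mulr_ge0; exact: ltW.
- by rewrite ler_expR lerN2.
- by rewrite ler_pM2r.
Qed.

Local Notation beta := (total_occupation JK)^-1.

Lemma tilted_pinned_decay : exists (H c C : R) (L : nat), [/\ 1 <= H, 0 < c, 0 < C, (0 < L)%N &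
  (forall delta l, 0 < delta -> 1 <= l%:R * delta ->
    tail_prob (tilt_level H delta l) <= C * (l%:R * delta)^-1) /\
  forall kappa rho, 0 < kappa -> kappa <= 1 -> 0 < rho -> rho <= 1 ->
  exists2 D : R, 0 < D &
  forall delta S, 0 < delta -> delta <= 4^-1 -> 0 < S -> delta <= S `^ (- a) ->
  forall n, (0 < n)%N -> (n * L)%:R * delta <= S ->
    (pinned (beta * delta)%R (tilted H kappa rho delta) n 0%R <=
     (D * (n%:R * delta) `^ (- (c * (kappa * rho))))%:E *
       pinned (beta * delta)%R (fun=> heat JK delta) n 0%R)%E].
Proof.
have [c1 [C1 [c2 [C2 [I0 c10 C10 c20 [C20 rs]]]]]] := heat_renewal g23 g1 JK Jeq.
have [a0 a2] := renewal_exponent g23 g1.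
have a1 : a < 1 by apply: lt_trans a2 _; rewrite invf_lt1// ltr1n.
have b0 : 0 < beta by rewrite invr_gt0.
have [c [t2 [L [c0 t24 L1 decay]]]] := tilted_decay a0 a1 b0 c10 C10 c20 C20.
have [H [e [C [H1 e0 e1 C0 [gain hi]]]]] := tilted_gain.
exists H, (c * e), C, L; split=> //; [exact: mulr_gt0|exact: ltnW|split=> //].
move=> kappa rho k0 k1 r0 r1.
have kr0 : 0 < kappa * rho by rewrite mulr_gt0.
have eps0 : 0 < e * (kappa * rho) by rewrite mulr_gt0.
have eps1 : e * (kappa * rho) <= 1.
  by rewrite mulr_ile1 ?(ltW e0) ?(ltW kr0)// mulr_ile1// ltW.
have [D D0 dec] := decay _ eps0 eps1.
exists D => // delta S d0 d4 S0 dS n n0 nS.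
have [u uP set_] := rs delta S d0 d4 S0 dS.
pose kap i m : R := fine ((\prod_(i <= l < m) tilted H kappa rho delta l)%R 0%R).
have kapE i m : (i <= m)%N -> (\prod_(i <= l < m) tilted H kappa rho delta l) 0 = (kap i m)%:E /\
    0 <= kap i m <= p ((m - i)%N%:R * delta).
  by move=> im; have [r rE rb] := tilted_prod_fin H k0 r0 d0 im; rewrite /kap rE.
have kap0 i m : 0 <= kap i m by rewrite fine_ge0// nnfun_ge0.
have th0 : 0 <= beta * delta by rewrite mulr_ge0// ltW.
have [v vP [v0 vE]] := pinned_real th0 kap0 (fun i m im => (kapE i m im).1).
rewrite vP uP -EFinM lee_fin -mulrA.
apply: (dec delta S _ u v kap set_ v0) => //.
- move=> m; rewrite vE lerD2r; have /andP[_] := (kapE 0%N m (leq0n m)).2.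
  by rewrite subn0.
- by move=> i m /ltnW /kapE[].
- move=> i m mt _ m4 m2; rewrite -lee_fin -(kapE i m _).1 ?gain//; first exact: le_trans mt.
  by move: m2; clear; lia.
Qed.

End tilted_kernel.

(** * The density of the tilt and the mean of its inverse *)

Section tilt_density.
Context {R : realType}.
Variables (gamma : R) (J : int -> R).
Hypothesis JK : jump_kernel gamma J.
Variables (H kappa rho delta : R).
Hypotheses (kappa0 : 0 < kappa) (rho0 : 0 < rho) (rho1 : rho < 1) (delta0 : 0 < delta).

Local Notation strength := (tilt_strength kappa delta).
Local Notation level := (tilt_level gamma H delta).
Local Notation mean := (tilt_mean JK H kappa rho delta).
Let strength_ge0 := tilt_strength_ge0 delta kappa0.
Let J0 x : 0 <= J x := jump_ge0 JK x.

Definition jump_tilt l (x : int) : R := 1 + strength l * (level l <= absr x)%R%:R.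

(** Girsanov density of the jumps of [Y] in one mesh interval: a factor [1 + kappa] per large jump,
    and [expR (- mean l)] as normalisation. *)
Definition tilt_density l (s : seq int) : R := expR (- mean l) * \prod_(x <- s) jump_tilt l x.

Lemma jump_tilt_gt0 l x : 0 < jump_tilt l x.
Proof. by rewrite ltr_pwDl// mulr_ge0. Qed.

Lemma tilt_density_gt0 l s : 0 < tilt_density l s.
Proof. by rewrite mulr_gt0 ?expR_gt0// prodr_gt0// => x _; exact: jump_tilt_gt0. Qed.

Let mesh1 : R := (1 - rho) * delta.
Let mesh2 : R := rho * delta.
Let mesh1_gt0 : 0 < mesh1. Proof. by rewrite mulr_gt0// subr_gt0. Qed.
Let mesh1_ge0 : 0 <= mesh1 := ltW mesh1_gt0.
Let mesh2_gt0 : 0 < mesh2. Proof. exact: mulr_gt0. Qed.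
Let mesh2_ge0 : 0 <= mesh2 := ltW mesh2_gt0.

Lemma heat_list_kernel h x : 0 <= h ->
  (\esum_(s in [set: seq int]) ((list_law J h s)%:E * ((displacement s == x)%:R)%:E) = heat JK h x)%E.
Proof.
move=> h0; rewrite /heat (ptME _ _ (expR_ge0 _)).
rewrite -(@list_kernel _ J (fun=> 1) h)//; last first.
  by move=> y; rewrite (ptME _ _ h0) -EFinM mulr1.
by apply: eq_esum => s _; rewrite big1 ?mul1r.
Qed.

Lemma tilted_list_kernel l x :
  (\esum_(s in [set: seq int]) ((list_law J mesh2 s)%:E *
      (tilt_density l s * (displacement s == x)%:R)%:E) =
   (heat JK mesh2 * (pt (expR (- mean l)) * cp (tilt_jumps JK H kappa rho delta l)))%R x)%E.
Proof.
pose f : nnfun R := pt mesh2 * jumpf JK + tilt_jumps JK H kappa rho delta l.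
have fE y : f y = (mesh2 * (J y * jump_tilt l y))%:E.
  rewrite nnfunDE (ptME _ _ mesh2_ge0) (ptME _ _ (tilt_strength_rate_ge0 kappa0 rho0 delta0 l)) /=.
  rewrite -!EFinM -EFinD /jump_tilt /mesh2; congr (_%:E).
  by case: (level l <= absr y) => /=; ring.
have K := @list_kernel _ J (jump_tilt l) mesh2 f x mesh2_ge0 J0 (fun y => ltW (jump_tilt_gt0 l y)) fE.
rewrite /heat mulrCA (ptME _ _ (expR_ge0 _)) -[X in _ = (_ * X)%E]/((_ : nnfun R) x).
rewrite -mulrA (ptME _ _ (expR_ge0 _)) -cpD -/f -K -esumZl ?lee_fin ?expR_ge0//; last first.
  move=> s; rewrite mule_ge0// lee_fin ?list_law_ge0// mulr_ge0// prodr_ge0// => y _.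
  exact: ltW (jump_tilt_gt0 _ _).
apply: eq_esum => s _; rewrite -!EFinM /tilt_density; congr (_%:E); ring.
Qed.

Lemma tilted_pair_kernel l x :
  (\esum_(s in [set: seq int * seq int]) ((list_law J mesh1 s.1 * list_law J mesh2 s.2)%:E *
      (tilt_density l s.2 * ((displacement s.1 - displacement s.2)%R == x)%:R)%:E) =
   tilted JK H kappa rho delta l x)%E.
Proof.
have <- : heat JK mesh1 * (heat JK mesh2 * (pt (expR (- mean l)) * cp (tilt_jumps JK H kappa rho delta l))) =
    tilted JK H kappa rho delta l.
  by rewrite mulrA -heatD// (_ : mesh1 + mesh2 = delta)// /mesh1 /mesh2; ring.
apply: (pair_kernel (n1 := list_law J mesh1) (n2 := list_law J mesh2) (p2 := tilt_density l)
  (z1 := displacement) (z2 := displacement)).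
- by move=> s; exact: list_law_ge0.
- by move=> s; exact: list_law_ge0.
- by move=> s; exact: ltW (tilt_density_gt0 _ _).
- apply: evenM; first by apply: peaked_even; exact: peaked_heat.
  move=> y; rewrite !(ptME _ _ (expR_ge0 _)); congr (_ * _)%E.
  by apply: even_cp; exact: even_tilt_jumps.
- by move=> y; exact: heat_list_kernel.
- by move=> y; exact: tilted_list_kernel.
Qed.

(* The terms linear in [kappa] cancel: the cost of the tilt is quadratic in [kappa],
   whereas its gain is linear. *)
Lemma inverse_tilt_mean l : exists2 c : R,
  (\esum_(s in [set: seq int]) ((list_law J mesh2 s)%:E * ((tilt_density l s)^-1)%:E) = c%:E)%E &
  0 <= c <= expR (mesh2 * strength l ^+ 2 * tail_prob JK (level l)).
Proof.
set k := strength l; have k0 : 0 <= k := strength_ge0 l.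
have k1 : 0 < 1 + k by rewrite ltr_pwDl.
set q := tail_prob JK (level l).
(* Since [1 - b = (1 + k)^-1], the inverse density thins the large jumps by a fraction [b]. Against
   the normalisation there remains [k - b = k ^ 2 / (1 + k)] in the exponent. *)
pose b := k / (1 + k).
have b0 : 0 <= b by rewrite divr_ge0// ltW.
have b1 : b <= 1 by rewrite ler_pdivrMr// mul1r lerDr.
have inv_ge0 y : 0 <= (jump_tilt l y)^-1 by rewrite invr_ge0 ltW// jump_tilt_gt0.
have mb : 0 <= mesh2 * b by exact: mulr_ge0.
have fge0 x : (0 <= (mesh2 * (J x * (jump_tilt l x)^-1))%:E)%E.
  by rewrite lee_fin; do 2![apply: mulr_ge0 => //].
pose f : nnfun R := NNFun fge0.
have ftot : total f = (mesh2 * (1 - b * q))%:E.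
  have : (total f + total (pt (mesh2 * b) * tailf JK (level l))%R = mesh2%:E)%E.
    rewrite -totalD (_ : f + _ = pt mesh2 * jumpf JK)%R.
      by rewrite totalM total_pt// total_jump mule1.
    apply: nnfunP => x; rewrite nnfunDE (ptME _ _ mesh2_ge0) (ptME _ _ mb)/=.
    rewrite -!EFinM -EFinD /jump_tilt -/k; congr (_%:E).
    case: (level l <= absr x) => /=; last by field.
    by rewrite /b; field; rewrite ?mulr1 gt_eqF.
  rewrite totalM (total_pt mb) tail_probE -EFinM.
  case: (total f) (total_ge0 f) => // r _ [e]; congr (_%:E); rewrite -/q in e.
  by apply: (addIr (mesh2 * b * q)); rewrite e; ring.
have f0 : 0 <= mesh2 * (1 - b * q) by rewrite -lee_fin -ftot total_ge0.
have T := @list_total _ J _ mesh2 f mesh2_ge0 J0 inv_ge0 (fun=> erefl).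
rewrite (total_cp f0 ftot) -EFinM -expRD in T.
exists (expR (mean l) * expR (- mesh2 + mesh2 * (1 - b * q))).
  rewrite EFinM -T -esumZl ?lee_fin ?expR_ge0//; last first.
    by move=> s; rewrite mule_ge0// lee_fin ?list_law_ge0// prodr_ge0.
  apply: eq_esum => s _; rewrite -!EFinM /tilt_density invfM -expRN opprK; congr (_%:E).
  by rewrite mulrCA; congr (_ * (_ * _)); rewrite prodfV.
rewrite mulr_ge0 ?expR_ge0//= -expRD ler_expR.
have -> : mean l + (- mesh2 + mesh2 * (1 - b * q)) = mesh2 * (k - b) * q.
  rewrite /tilt_mean -/k -/q /mesh2; ring.
rewrite ler_wpM2r ?tail_prob_ge0// ler_wpM2l//.
have -> : k - b = k ^+ 2 / (1 + k) by rewrite /b; field; rewrite gt_eqF.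
by rewrite ler_pdivrMr// ler_peMr ?sqr_ge0// lerDl.
Qed.

End tilt_density.

Section harmonic.
Context {R : realType}.
Implicit Types delta : R.

Lemma inv_le_ln (m : nat) : (0 < m)%N -> m%:R^-1 <= 2 * (ln m.+1%:R - ln m%:R) :> R.
Proof.
move=> m0; have mp : 0 < m%:R :> R by rewrite ltr0n.
rewrite -ln_div ?posrE ?ltr0n//; set y : R := m%:R^-1 / 2.
have y0 : 0 < y by rewrite divr_gt0// invr_gt0.
have y1 : y <= 2^-1 by rewrite /y ler_piMl// invf_le1// ler1n.
have e : m.+1%:R / m%:R = 1 + 2 * y :> R.
  by rewrite -natr1 mulrDl divff ?gt_eqF// /y; field; rewrite gt_eqF.
rewrite e (_ : m%:R^-1 = 2 * y); last by rewrite /y mulrC divfK.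
rewrite ler_pM2l// -ler_expR lnK ?posrE; last by rewrite addr_gt0// mulr_gt0.
have h := expR_ge1Dx (- y); rewrite expRN in h.
have e0 := expR_gt0 y.
have : expR y * (1 - y) <= 1 by rewrite -ler_pdivlMl// mulr1.
nra.
Qed.

(** The restriction to times at least [1] makes the bound depend on [n * delta] alone, whatever the
    mesh. The sum is empty until time [1] is reached; after that each term is absorbed by an
    increment of the logarithm. *)
Lemma harmonic_le_ln delta n : 0 < delta -> 1 <= n%:R * delta ->
  \sum_(l < n | 1 <= l%:R * delta) l%:R^-1 <= 2 * ln (n%:R * delta).
Proof.
move=> d0.
have small m : m%:R * delta < 1 -> \sum_(l < m | 1 <= l%:R * delta) l%:R^-1 = 0 :> R.
  move=> m1; rewrite big_pred0// => l; apply/negbTE; rewrite -ltNge; apply: le_lt_trans m1.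
  by rewrite ler_pM2r// ler_nat ltnW.
elim: n => [|m IH]; first by rewrite mul0r ler10.
move=> m1; rewrite big_mkcond big_ord_recr/= -big_mkcond/=.
have mp : 0 < m.+1%:R * delta by exact: lt_le_trans m1.
case: ifPn => h; last first.
  by rewrite addr0 small ?ltNge// mulr_ge0// ln_ge0.
have m0 : (0 < m)%N by rewrite lt0n; apply: contraTneq h => ->; rewrite mul0r ler10.
apply: le_trans (lerD (IH h) (inv_le_ln m0)) _.
by rewrite !lnM ?posrE ?ltr0n//; lra.
Qed.

End harmonic.

(** * Expectations over one walk and over a pair of walks *)

Section path_weight.
Context {R : realType}.

Definition path_weight (theta : R) (n : nat) (x : nat -> int) : R :=
  \prod_(i < n) (1 + theta * (x i == 0)%R%:R) * (x n == 0)%R%:R.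

Lemma path_weight_ge0 theta n x : 0 <= theta -> 0 <= path_weight theta n x.
Proof. by move=> t0; rewrite mulr_ge0// prodr_ge0// => i _; rewrite addr_ge0// mulr_ge0. Qed.

Lemma path_weight_le theta n x : 0 <= theta -> path_weight theta n x <= (1 + theta) ^+ n.
Proof.
move=> t0; have p0 : 0 <= \prod_(i < n) (1 + theta * (x i == 0)%R%:R).
  by rewrite prodr_ge0// => i _; rewrite addr_ge0// mulr_ge0.
apply: (@le_trans _ _ (\prod_(i < n) (1 + theta * (x i == 0)%R%:R))).
  by rewrite /path_weight ler_piMr//; case: eqP.
rewrite -[n in leRHS]card_ord -prodr_const.
by apply: ler_prod => i _; rewrite addr_ge0 ?mulr_ge0//= lerD2l ler_piMr//; case: eqP.
Qed.

Lemma weight_path (d : measure_display) (Omega : measurableType d) (T : countType)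
    (D : nat -> Omega -> T) phi (z : T -> int) (theta : R) n w :
  weight phi z theta (rtrace D n w) * (position z (rtrace D n w) == 0)%R%:R =
  path_weight theta n (fun i => position z (rtrace D i w)) * \prod_(i < n) phi i (D i w).
Proof. by rewrite weight_rtrace /path_weight; ring. Qed.

End path_weight.

Section one_walk.
Context {R : realType} {d : measure_display} {Omega : measurableType d}.
Variable P : probability Omega R.
Variables (gamma : R) (J : int -> R) (N : R -> Omega -> nat) (xi : nat -> Omega -> int).
Hypothesis JK : jump_kernel gamma J.
Hypothesis NP : rate1_poisson_counter P N.
Hypothesis xiJ : steps_with_law P J xi.
Hypothesis NxiI : independent_increments_steps P N xi.
Local Open Scope ereal_scope.

Definition walk (t : R) w : int := (\sum_(j < N t w) xi j w)%R.

Lemma walk0 w : walk 0%R w = 0%R.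
Proof. by rewrite /walk (counter_start NP) big_ord0. Qed.

Variables (theta h : R).
Hypotheses (theta0 : (0 <= theta)%R) (h0 : (0 < h)%R).

Let mD := measurable_jumps NP xiJ h0.
Let nu (n : nat) (l : seq int) : \bar R := (list_law J h l)%:E.
Let nu0 n l : 0 <= nu n l.
Proof. by rewrite lee_fin list_law_ge0// => x; exact: (jump_ge0 JK). Qed.
Let indep n s l := jumps_indep NP xiJ NxiI h0 n s l.

Lemma measurable_walk_path_weight n :
  measurable_fun setT (fun w => (path_weight theta n (fun i => walk (i%:R * h)%R w))%:E).
Proof.
apply: (eq_measurable_fun (fun w => (fun s : seq (seq int) =>
  (weight (fun _ _ => 1%R) displacement theta s * (position displacement s == 0)%R%:R)%:E)
  (rtrace (jumps N xi h) n w))).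
  move=> w _; rewrite weight_path big1// mulr1; congr (_%:E).
  by congr path_weight; apply/funext => i; rewrite /walk (walk_position _ NP h0).
exact: (measurable_fun_countable (measurable_rtrace mD n) (fun s : seq (seq int) =>
  (weight (fun _ _ => 1%R) displacement theta s * (position displacement s == 0)%R%:R)%:E)).
Qed.

Lemma homogeneous_expectation n :
  \int[P]_w (path_weight theta n (fun i => walk (i%:R * h)%R w))%:E =
  pinned theta (fun=> heat JK h) n 0%R.
Proof.
have one0 (i : nat) (l : seq int) : (0 <= 1 :> R)%R by [].
have -> : (fun=> heat JK h) = step_kernel nu0 displacement one0.
  apply/funext => l; apply: nnfunP => x.
  rewrite -(@heat_list_kernel _ _ _ JK h x (ltW h0)).
  by apply: eq_esum => s _; rewrite mul1r.
rewrite (pinnedE (probability_setT P) mD nu0 indep displacement one0 theta0).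
apply: eq_integral => w _; rewrite weight_path big1// mulr1; congr (_%:E).
by congr path_weight; apply/funext => i; rewrite /walk (walk_position _ NP h0).
Qed.

End one_walk.

(** A grid with a single interval of length [t] and no reward; [t = 0] is separate because meshes
    are positive. *)
Lemma walk_law {R : realType} {d : measure_display} {Omega : measurableType d}
    (P : probability Omega R) (gamma : R) (J : int -> R) N xi (JK : jump_kernel gamma J) (t : R) :
  rate1_poisson_counter P N -> steps_with_law P J xi -> independent_increments_steps P N xi ->
  0 <= t -> P [set w | walk N xi t w = 0] = heat JK t 0.
Proof.
move=> NP xiJ NxiI; rewrite le_eqVlt => /orP[/eqP <-|t0].
  rewrite heat0 nnfun1E eqxx -[RHS](probability_setT P); congr (P _).
  by apply/seteqP; split => // w _ /=; rewrite (walk0 _ NP).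
have := homogeneous_expectation JK NP xiJ NxiI (lexx 0) t0 1%N.
rewrite pinnedS (mul_reward (lexx 0)) mul0e adde0 mulr1 => <-.
have mA : measurable [set w | walk N xi t w = 0].
  have -> : [set w | walk N xi t w = 0] =
      [set w | (fun s : seq (seq int) => position displacement s = 0) (rtrace (jumps N xi t) 1 w)].
    by apply: eq_set => w; rewrite -(walk_position _ NP t0) mul1r.
  exact: (measurable_countable_preimage (measurable_rtrace (measurable_jumps NP xiJ t0) 1)
    [set s : seq (seq int) | position displacement s = 0]).
rewrite -[X in P X]setIT -(integral_indic P measurableT mA).
apply: eq_integral => w _; rewrite /path_weight big_ord1 mul0r addr0 !mul1r indicE; congr (_%:E).
case: eqP => h /=; first by rewrite mem_set.
by rewrite memNset.
Qed.

Section two_walks.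
Context {R : realType} {d1 d2 : measure_display}.
Context {Omega1 : measurableType d1} {Omega2 : measurableType d2}.
Variables (P1 : probability Omega1 R) (P2 : probability Omega2 R).
Variables (gamma : R) (J : int -> R).
Variables (N1 : R -> Omega1 -> nat) (xi1 : nat -> Omega1 -> int).
Variables (N2 : R -> Omega2 -> nat) (xi2 : nat -> Omega2 -> int).
Hypothesis JK : jump_kernel gamma J.
Hypotheses (NP1 : rate1_poisson_counter P1 N1) (xiJ1 : steps_with_law P1 J xi1)
  (NxiI1 : independent_increments_steps P1 N1 xi1).
Hypotheses (NP2 : rate1_poisson_counter P2 N2) (xiJ2 : steps_with_law P2 J xi2)
  (NxiI2 : independent_increments_steps P2 N2 xi2).
Variables (rho delta theta : R).
Hypotheses (rho0 : 0 < rho) (rho1 : rho < 1) (delta0 : 0 < delta) (theta0 : 0 <= theta).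
Local Open Scope ereal_scope.

Let h1 : R := ((1 - rho) * delta)%R.
Let h2 : R := (rho * delta)%R.
Let h10 : (0 < h1)%R. Proof. by rewrite mulr_gt0// subr_gt0. Qed.
Let h20 : (0 < h2)%R. Proof. exact: mulr_gt0. Qed.
Local Notation D1 := (jumps N1 xi1 h1).
Local Notation D2 := (jumps N2 xi2 h2).
Let D (n : nat) (w : Omega1 * Omega2) : seq int * seq int := (D1 n w.1, D2 n w.2).
Let z (l : seq int * seq int) : int := (displacement l.1 - displacement l.2)%R.
Let nu (n : nat) (l : seq int * seq int) : \bar R := (list_law J h1 l.1 * list_law J h2 l.2)%:E.
Let J0 x : (0 <= J x)%R := jump_ge0 JK x.
Let nu0 n l : 0 <= nu n l.
Proof. by rewrite lee_fin mulr_ge0// list_law_ge0. Qed.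

Let preimage_pair n l : [set w | D n w = l] = [set w | D1 n w = l.1] `*` [set w | D2 n w = l.2].
Proof. by case: l => l1 l2; apply/seteqP; split => -[w1 w2] /=; rewrite /D /= => -[<- <-]. Qed.

Let rtrace_pair n w s : rtrace D n w = s <->
  rtrace D1 n w.1 = unzip1 s /\ rtrace D2 n w.2 = unzip2 s.
Proof.
elim: n s => [|n IH] [|[l1 l2] s] /=; split => //; try by case.
  by move=> [<- <- /IH[-> ->]].
by move=> [[<- e1] [<- e2]]; congr (_ :: _); apply/IH.
Qed.

Let rtrace_preimage n s : [set w | rtrace D n w = s] =
  [set w | rtrace D1 n w = unzip1 s] `*` [set w | rtrace D2 n w = unzip2 s].
Proof. by apply/seteqP; split => w /= => [/rtrace_pair|h]//; apply/rtrace_pair. Qed.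

Let mD1 := measurable_jumps NP1 xiJ1 h10.
Let mD2 := measurable_jumps NP2 xiJ2 h20.

Let mD n l : measurable [set w | D n w = l].
Proof. by rewrite preimage_pair; apply: measurableX. Qed.

Let indep n s l : (P1 \x P2) [set w | rtrace D n w = s /\ D n w = l] =
  nu n l * (P1 \x P2) [set w | rtrace D n w = s].
Proof.
have m1 := measurable_rtrace mD1 n (unzip1 s).
have m2 := measurable_rtrace mD2 n (unzip2 s).
have -> : [set w | rtrace D n w = s /\ D n w = l] =
    [set w | rtrace D1 n w = unzip1 s /\ D1 n w = l.1] `*`
    [set w | rtrace D2 n w = unzip2 s /\ D2 n w = l.2].
  case: l => l1 l2; apply/seteqP; split => -[w1 w2] /=.
    by move=> [/rtrace_pair[/= -> ->]]; rewrite /D /= => -[<- <-].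
  by move=> [[a <-] [b <-]]; split => //; apply/rtrace_pair.
rewrite rtrace_preimage !product_measure1E//.
- have e1 := jumps_indep NP1 xiJ1 NxiI1 h10 n (unzip1 s) l.1.
  have e2 := jumps_indep NP2 xiJ2 NxiI2 h20 n (unzip2 s) l.2.
  by rewrite [X in X * _ = _]e1 [X in _ * X = _]e2 /nu EFinM muleACA.
- by apply: measurableI => //; exact: mD1.
- by apply: measurableI => //; exact: mD2.
Qed.

Definition walk_difference (t : R) (w : Omega1 * Omega2) : int :=
  (walk N1 xi1 ((1 - rho) * t) w.1 - walk N2 xi2 (rho * t) w.2)%R.

Let positionE i w : position z (rtrace D i w) = walk_difference (i%:R * delta)%R w.
Proof.
have -> : position z (rtrace D i w) =
    (position displacement (rtrace D1 i w.1) - position displacement (rtrace D2 i w.2))%R.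
  rewrite /position; elim: i => [|i IH] /=; first by rewrite !big_nil subr0.
  by rewrite !big_cons IH /z /=; ring.
rewrite -(walk_position _ NP1 h10) -(walk_position _ NP2 h20) /walk_difference /walk.
have -> : (i%:R * h1 = (1 - rho) * (i%:R * delta))%R by rewrite /h1; ring.
by have -> : (i%:R * h2 = rho * (i%:R * delta))%R by rewrite /h2; ring.
Qed.

Lemma path_weight_trace n w : path_weight theta n (fun i => walk_difference (i%:R * delta)%R w) =
  (weight (fun _ _ => 1) z theta (rtrace D n w) * (position z (rtrace D n w) == 0)%R%:R)%R.
Proof.
rewrite weight_path big1// mulr1; congr path_weight.
by apply/funext => i; rewrite positionE.
Qed.

Lemma measurable_path_weight n : measurable_fun setT
  (fun w => (path_weight theta n (fun i => walk_difference (i%:R * delta)%R w))%:E).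
Proof.
apply: (eq_measurable_fun (fun w => (fun s : seq (seq int * seq int) =>
  (weight (fun _ _ => 1%R) z theta s * (position z s == 0)%R%:R)%:E) (rtrace D n w))).
  by move=> w _; rewrite path_weight_trace.
exact: (measurable_fun_countable (measurable_rtrace mD n) (fun s : seq (seq int * seq int) =>
  (weight (fun _ _ => 1%R) z theta s * (position z s == 0)%R%:R)%:E)).
Qed.

(** The density involves only the jumps of [Y], so it can be moved inside the integral over [X]. By
    Tonelli this gives a weighted path density of the difference walk, whose step kernels are the
    tilted ones. *)
Lemma tilted_expectation H kappa n : (0 < kappa)%R ->
  \int[P2]_w2 ((\prod_(i < n) tilt_density JK H kappa rho delta i (D2 i w2))%R%:E *
     \int[P1]_w1 (path_weight theta n (fun i => walk_difference (i%:R * delta)%R (w1, w2)))%:E) =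
  pinned theta (tilted JK H kappa rho delta) n 0%R.
Proof.
move=> k0.
pose phi (i : nat) (l : seq int * seq int) := tilt_density JK H kappa rho delta i l.2.
have phi0 i l : (0 <= phi i l)%R by rewrite ltW// tilt_density_gt0.
have -> : tilted JK H kappa rho delta = step_kernel nu0 z phi0.
  apply/funext => l; apply: nnfunP => x.
  by rewrite -(tilted_pair_kernel JK H k0 rho0 rho1 delta0).
have mu1 : (P1 \x P2) setT = 1 by exact: probability_setT.
rewrite (pinnedE mu1 mD nu0 indep z phi0 theta0).
have mw : measurable_fun setT (fun w => (weight phi z theta (rtrace D n w) *
    (position z (rtrace D n w) == 0)%R%:R)%:E).
  exact: (measurable_fun_countable (measurable_rtrace mD n)
    (fun s => (weight phi z theta s * (position z s == 0)%R%:R)%:E)).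
rewrite fubini_tonelli2//; last first.
  by move=> w; rewrite lee_fin mulr_ge0// weight_ge0.
apply: eq_integral => w2 _; rewrite /fubini_G.
rewrite -ge0_integralZl//.
- apply: eq_integral => w1 _; rewrite weight_path -EFinM mulrC; congr ((_ * _)%:E).
  by congr path_weight; apply/funext => i; rewrite positionE.
- exact: measurableT_comp (measurable_path_weight n) (measurable_pair2 w2).
- by move=> w1 _; rewrite lee_fin path_weight_ge0.
- by rewrite lee_fin prodr_ge0// => i _; rewrite ltW// tilt_density_gt0.
Qed.

(** Independence over the intervals leaves a product of one-interval costs. From time [1] on, the
    logarithm of the cost of interval [l] is at most [C rho kappa ^ 2 / l], and the harmonic sum
    turns the product into a power of the time. *)
Lemma inverse_tilt_expectation H kappa C n : (0 < kappa)%R -> (0 < C)%R ->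
  (forall l, 1 <= l%:R * delta -> tail_prob JK (tilt_level gamma H delta l) <= C * (l%:R * delta)^-1)%R ->
  (1 <= n%:R * delta)%R ->
  \int[P2]_w2 ((\prod_(i < n) tilt_density JK H kappa rho delta i (D2 i w2))^-1)%R%:E <=
  ((n%:R * delta) `^ (2 * C * rho * kappa ^+ 2))%:E.
Proof.
move=> k0 C0 hi n1.
pose g (i : nat) s := (tilt_density JK H kappa rho delta i s)^-1%R.
have g0 i s : (0 <= g i s)%R by rewrite invr_ge0 ltW// tilt_density_gt0.
have mc i := inverse_tilt_mean JK H k0 rho0 delta0 i.
pose c (i : nat) : R := projT1 (cid2 (mc i)).
have cE i : \esum_(s in [set: seq int]) ((list_law J h2 s)%:E * (g i s)%:E) = (c i)%:E.
  by rewrite /c; case: cid2.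
have cb i : (0 <= c i <= expR (h2 * tilt_strength kappa delta i ^+ 2 * tail_prob JK (tilt_level gamma H delta i)))%R.
  by rewrite /c; case: cid2.
have n20 (i : nat) (s : seq int) : 0 <= (list_law J h2 s)%:E by rewrite lee_fin list_law_ge0.
have indep2 i s l := jumps_indep NP2 xiJ2 NxiI2 h20 i s l.
have := integral_grid_prod (probability_setT P2) mD2 n20 indep2 g0 n cE.
under eq_integral do rewrite prodfV.
move=> ->; rewrite lee_fin.
apply: (@le_trans _ _ (\prod_(i < n) expR (h2 * tilt_strength kappa delta i ^+ 2 * tail_prob JK (tilt_level gamma H delta i))))%R.
  by apply: ler_prod => i _; exact: cb.
rewrite -expR_sum /powR gt_eqF ?(lt_le_trans ltr01 n1)// ler_expR.
apply: (@le_trans _ _ (\sum_(l < n | 1 <= l%:R * delta) C * rho * kappa ^+ 2 * l%:R^-1))%R.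
  rewrite [leRHS]big_mkcond/=; apply: ler_sum => l _; rewrite /tilt_strength.
  case: ifPn => l1; last by rewrite expr0n mulr0 mul0r.
  have h := hi l l1.
  have := ler_wpM2l (mulr_ge0 (ltW h20) (sqr_ge0 kappa)) h.
  move=> /le_trans; apply; rewrite le_eqVlt; apply/orP; left; apply/eqP.
  have lp : (0 < (l : nat)%:R :> R)%R.
    by rewrite ltr0n lt0n; apply: contraTneq l1 => ->; rewrite mul0r ler10.
  by rewrite /h2; field; rewrite !gt_eqF.
rewrite -mulr_sumr; have := harmonic_le_ln delta0 n1.
have K0 : (0 <= C * rho * kappa ^+ 2)%R by rewrite !mulr_ge0 ?sqr_ge0// ltW.
move=> /(ler_wpM2l K0)/le_trans; apply; rewrite le_eqVlt; apply/orP; left; apply/eqP; ring.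
Qed.

End two_walks.

(** * From the grid to continuous time *)

Section riemann_sums.
Context {R : realType}.
Local Notation leb := (@lebesgue_measure R).

(** Right-continuity of a path with discrete values, stated without a topology on [U]. *)
Definition right_constant (U : Type) (x : R -> U) := forall t : R, 0 <= t ->
  exists2 e : R, 0 < e & forall s, t <= s -> s < t + e -> x s = x t.

Lemma right_constant_near (U : Type) (x : R -> U) :
  (forall t, 0 <= t -> \forall s \near t^'+, x s = x t) -> right_constant x.
Proof.
move=> h t t0; have /nbhs_ballP[e /= e0 he] := h t t0.
exists e => // s; rewrite le_eqVlt => /orP[/eqP <- //|ts] se.
apply: he => //; rewrite /ball /= ltr_distlC; apply/andP; split=> //.
by rewrite (lt_trans _ ts)// gtrBl.
Qed.

Lemma right_constant_scale (U : Type) (x : R -> U) (c : R) : 0 < c -> right_constant x ->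
  right_constant (fun t => x (c * t)).
Proof.
move=> c0 hx t t0; have [e e0 he] := hx (c * t) (mulr_ge0 (ltW c0) t0).
exists (e / c); first exact: divr_gt0.
move=> s ts se; apply: he; first by rewrite ler_pM2l.
by rewrite -ltrBlDl -mulrBr mulrC -ltr_pdivlMr// ltrBlDl.
Qed.

Lemma right_constant2 (U V W : Type) (f : U -> V -> W) (x : R -> U) (y : R -> V) :
  right_constant x -> right_constant y -> right_constant (fun t => f (x t) (y t)).
Proof.
move=> hx hy t t0; have [e e0 he] := hx t t0; have [e' e'0 he'] := hy t t0.
exists (Num.min e e'); first by rewrite lt_min e0.
move=> s ts; rewrite -ltrBlDl lt_min !ltrBlDl => /andP[se se'].
by rewrite he// he'.
Qed.

Variable T : R.
Hypothesis T0 : 0 < T.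
Definition mesh (n : nat) : R := T / n.+1%:R.

Lemma mesh_gt0 n : 0 < mesh n.
Proof. by rewrite divr_gt0. Qed.

Lemma mesh_total n : n.+1%:R * mesh n = T.
Proof. by rewrite /mesh mulrC divfK. Qed.

Lemma mesh_cvg : mesh n @[n --> \oo] --> (0 : R).
Proof.
rewrite -[X in _ --> X](mulr0 T); apply: cvgM; first exact: cvg_cst.
exact: cvg_harmonic.
Qed.

Lemma mesh_small (e : R) : 0 < e -> \forall n \near \oo, mesh n < e.
Proof.
move=> e0; have /cvgrPdist_lt/(_ e e0) := mesh_cvg.
by apply: filterS => n; rewrite sub0r normrN gtr0_norm ?mesh_gt0.
Qed.

Variable f : R -> bool.
Hypothesis rf : right_constant f.

Let cell n (i : nat) : set R := `[(i%:R * mesh n)%R, (i.+1%:R * mesh n)%R[%classic.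
Let D : set R := `[0, T[%classic.
(** The value on a cell is taken at its right endpoint, so that right-continuity alone gives
    pointwise convergence to [f]. *)
Let h n (t : R) : R := \sum_(i < n.+1) (f (i.+1%:R * mesh n))%:R * \1_(cell n i) t.

Let hE n t : D t -> exists2 s, t <= s <= t + mesh n & h n t = (f s)%:R.
Proof.
rewrite /D/= in_itv/= => /andP[t0 tT]; have m0 := mesh_gt0 n.
have := truncn_itv (divr_ge0 t0 (ltW m0)); set k := Num.truncn _.
rewrite ler_pdivlMr// ltr_pdivrMr// => /andP[kt tk].
have kn : (k < n.+1)%N.
  rewrite -(ltr_nat R) -(ltr_pM2r m0) mesh_total; exact: le_lt_trans kt tT.
exists (k.+1%:R * mesh n).
  by rewrite (ltW tk)/= -natr1 mulrDl mul1r lerD2r.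
rewrite /h (bigD1 (Ordinal kn))//= big1.
  by rewrite addr0 indicE mem_set ?mulr1// /cell/= in_itv/= kt.
move=> j jk; rewrite indicE memNset ?mulr0// /cell/= in_itv/= => /andP[jt tj].
have jk' : (j <= k)%N by rewrite -ltnS -(ltr_nat R) -(ltr_pM2r m0) (le_lt_trans jt tk).
have kj : (k <= j)%N by rewrite -ltnS -(ltr_nat R) -(ltr_pM2r m0) (le_lt_trans kt tj).
by move/eqP: jk; apply; apply/val_inj/eqP; rewrite /= eqn_leq jk' kj.
Qed.

Let h_cvg t : D t -> (h n t)%:E @[n --> \oo] --> ((f t)%:R%:E : \bar R).
Proof.
move=> Dt; have t0 : 0 <= t by move: Dt; rewrite /D/= in_itv/= => /andP[].
have [e e0 he] := rf t0.
apply: cvg_near_cst; near=> n.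
have [s /andP[ts st] ->] := hE n Dt.
rewrite he//; apply: le_lt_trans st _; rewrite ltrD2l.
by near: n; exact: mesh_small.
Unshelve. all: by end_near. Qed.

Let mD : measurable D. Proof. exact: measurable_itv. Qed.

Let mh n : measurable_fun D (fun t => (h n t)%:E).
Proof.
apply/measurable_EFinP; rewrite /h; apply: measurable_sum => i.
apply: measurable_funM; first exact: measurable_cst.
by apply: measurable_indic; exact: measurable_itv.
Qed.

Let int_h n : (\int[leb]_(t in D) (h n t)%:E =
  (mesh n * \sum_(i < n.+1) (f (i.+1%:R * mesh n))%:R)%:E)%E.
Proof.
have mc i : measurable_fun D (fun t => (\1_(cell n i) t)%:E : \bar R).
  by apply/measurable_EFinP; apply: measurable_indic; exact: measurable_itv.
have m0 := mesh_gt0 n.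
rewrite /h; under eq_integral do rewrite -sumEFin.
rewrite ge0_integral_sum//; last first.
  move=> i; apply/measurable_EFinP; apply: measurable_funM; first exact: measurable_cst.
  by apply: measurable_indic; exact: measurable_itv.
rewrite mulr_sumr -sumEFin; apply: eq_bigr => i _.
under eq_integral do rewrite EFinM.
rewrite ge0_integralZl ?lee_fin//; last exact: mc.
rewrite integral_indic//; last exact: measurable_itv.
have -> : cell n i `&` D = cell n i.
  apply: setIidl => t; rewrite /cell /D/= !in_itv/= => /andP[it ti].
  apply/andP; split; first by apply: le_trans it; rewrite mulr_ge0// ltW.
  by apply: lt_le_trans ti _; rewrite -(mesh_total n) ler_pM2r// ler_nat.
have lc : leb (cell n i) = (mesh n)%:E.
  rewrite lebesgue_measure_itv/= lte_fin ltr_pM2r// ltr_nat ltnSn -EFinB -mulrBl.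
  by rewrite -natrB// subSnn mul1r.
transitivity (((f (i.+1%:R * mesh n))%:R)%:E * (mesh n)%:E)%E; last by rewrite -EFinM mulrC.
by congr (_ * _)%E; exact: lc.
Qed.

Lemma riemann_sum_cvg : mesh n * \sum_(i < n.+1) (f (i%:R * mesh n))%:R @[n --> \oo] -->
  \int[leb]_(t in `[0, T]) ((f t)%:R : R).
Proof.
have mf : measurable_fun D (fun t => ((f t)%:R)%:E : \bar R).
  exact: (@emeasurable_fun_cvg _ _ _ _ (fun n t => (h n t)%:E) _ mh (fun t => @h_cvg t)).
have hb n t : D t -> (`|(h n t)%:E| <= 1)%E.
  by move=> Dt; have [s _ ->] := hE n Dt; rewrite lee_fin; case: (f s); rewrite ?normr1 ?normr0.
have i1 : leb.-integrable D (cst 1%E).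
  apply/integrableP; split; first exact: measurable_cst.
  rewrite (eq_integral (cst 1%E)); last by move=> t _; rewrite /= normr1.
  have lD : leb D = T%:E by rewrite lebesgue_measure_itv/= lte_fin T0 -EFinB subr0.
  apply: (@le_lt_trans _ _ (leb D)); last by rewrite lD ltry.
  by rewrite integral_cst// mul1e.
have fin1 t : D t -> (cst 1%E t : \bar R) \is a fin_num by [].
have C := @dominated_cvg _ _ _ leb D mD (fun n t => (h n t)%:E) (fun t => (f t)%:R%:E) (cst 1%E) mh h_cvg fin1 i1 hb.
rewrite integral_itv_bndo_bndc// in C.
have If : (\int[leb]_(t in `[0%R, T]) ((f t)%:R)%:E)%E \is a fin_num.
  rewrite -integral_itv_bndo_bndc//; apply: integrable_fin_num => //.
  apply: le_integrable i1 => // t _; rewrite /= normr1 lee_fin.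
  by case: (f t); rewrite ?normr1 ?normr0.
rewrite -(fineK If) in C; have {}C := fine_cvg C; rewrite /Rintegral.
have {}C : mesh n * \sum_(i < n.+1) (f (i.+1%:R * mesh n))%:R @[n --> \oo] -->
    fine (\int[leb]_(t in `[0%R, T]) ((f t)%:R)%:E)%E.
  have E1 n : mesh n * \sum_(i < n.+1) (f (i.+1%:R * mesh n))%:R = fine (\int[leb]_(t in D) (h n t)%:E)%E.
    by rewrite int_h.
  under eq_cvg do rewrite E1.
  exact: C.
rewrite -[X in _ --> X]addr0.
(* The sums over left and right endpoints differ only in their two extreme terms, whose contribution
   vanishes with the mesh. *)
have E n : mesh n * \sum_(i < n.+1) (f (i%:R * mesh n))%:R =
    mesh n * \sum_(i < n.+1) (f (i.+1%:R * mesh n))%:R + mesh n * ((f 0)%:R - (f T)%:R).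
  rewrite big_ord_recl big_ord_recr/= mul0r mesh_total; ring.
under eq_cvg do rewrite E.
apply: cvgD => //; rewrite -[X in _ --> X](mul0r ((f 0)%:R - (f T)%:R)).
by apply: cvgM; [exact: mesh_cvg|exact: cvg_cst].
Unshelve. all: by end_near. Qed.

(** Squeezed by [exp (x / (1 + x)) <= 1 + x <= exp x] with [x = beta * mesh n], applied at the grid
    points where [f] holds. *)
Lemma exp_riemann_cvg (beta : R) : 0 <= beta ->
  \prod_(i < n.+1) (1 + beta * mesh n * (f (i%:R * mesh n))%:R) @[n --> \oo] -->
  expR (beta * \int[leb]_(t in `[0, T]) ((f t)%:R : R)).
Proof.
move=> b0; set A := \int[leb]_(t in _) _.
pose a n := mesh n * \sum_(i < n.+1) (f (i%:R * mesh n))%:R : R.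
have ha : a n @[n --> \oo] --> A := riemann_sum_cvg.
have bm n : 0 <= beta * mesh n by rewrite mulr_ge0 ?(ltW (mesh_gt0 n)).
have d1 n : 0 < 1 + beta * mesh n by rewrite ltr_pwDl.
apply: (@squeeze_cvgr _ _ _ _ (fun n => expR (beta * a n / (1 + beta * mesh n))) (fun n => expR (beta * a n))).
- near=> n; rewrite /a mulrA !mulr_sumr mulr_suml !expR_sum; apply/andP; split.
    apply: ler_prod => i _; rewrite expR_ge0/=; case: (f _); last by rewrite !mulr0 mul0r expR0 addr0.
    rewrite !mulr1; have := expR_ge1Dx (- (beta * mesh n / (1 + beta * mesh n))).
    have -> : 1 - beta * mesh n / (1 + beta * mesh n) = (1 + beta * mesh n)^-1.
      by field; rewrite gt_eqF.
    by rewrite expRN lef_pV2 ?posrE ?expR_gt0.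
  by apply: ler_prod => i _; apply/andP; split; [by rewrite addr_ge0// mulr_ge0|exact: expR_ge1Dx].
- have -> : expR (beta * A) = expR (beta * A / (1 + beta * 0)) by rewrite mulr0 addr0 divr1.
  apply: continuous_cvg; first exact: continuous_expR.
  apply: cvgM; first by apply: cvgM; [exact: cvg_cst|exact: ha].
  apply: cvgV; first by rewrite mulr0 addr0 oner_neq0.
  apply: cvgD; first exact: cvg_cst.
  by apply: cvgM; [exact: cvg_cst|exact: mesh_cvg].
- apply: continuous_cvg; first exact: continuous_expR.
  by apply: cvgM; [exact: cvg_cst|exact: ha].
Unshelve. all: by end_near. Qed.

End riemann_sums.

Lemma path_weight_cvg (R : realType) (T beta : R) (x : R -> int) : 0 < T -> 0 <= beta ->
  right_constant x ->
  path_weight (beta * mesh T n) n.+1 (fun i => x (i%:R * mesh T n)) @[n --> \oo] -->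
  expR (beta * \int[@lebesgue_measure R]_(t in `[0, T]) (x t == 0)%R%:R) * (x T == 0)%R%:R.
Proof.
move=> T0 b0 rx.
have rf : right_constant (fun t => x t == 0).
  by move=> t t0; have [e e0 he] := rx t t0; exists e => // s ts se; rewrite he.
rewrite /path_weight; under eq_cvg do rewrite mesh_total.
by apply: cvgM; [exact: exp_riemann_cvg|exact: cvg_cst].
Qed.

Section partition_limit.
Context {R : realType} {d : measure_display} {Omega : measurableType d}.
Variable P : probability Omega R.
Variables (T beta : R) (X : R -> Omega -> int).
Hypotheses (T0 : 0 < T) (beta0 : 0 <= beta).
Hypothesis X_right : forall w, right_constant (X ^~ w).
Hypothesis mX : forall n, measurable_fun setT
  (fun w => (path_weight (beta * mesh T n) n.+1 (fun i => X (i%:R * mesh T n) w))%:E).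
Local Notation leb := (@lebesgue_measure R).

Definition continuum_weight (w : Omega) : R :=
  expR (beta * \int[leb]_(t in `[0, T]) (X t w == 0)%R%:R) * (X T w == 0)%R%:R.

Lemma path_weight_mesh_le n x : path_weight (beta * mesh T n) n.+1 x <= expR (beta * T).
Proof.
have bm : 0 <= beta * mesh T n by rewrite mulr_ge0// ltW// mesh_gt0.
apply: le_trans (path_weight_le n.+1 x bm) _.
apply: (@le_trans _ _ (expR (beta * mesh T n) ^+ n.+1)).
  by apply: lerXn2r; rewrite ?nnegrE ?addr_ge0 ?expR_ge0// expR_ge1Dx.
by rewrite -expRM_natl mulrCA mesh_total.
Qed.

Lemma partition_cvg :
  (\int[P]_w (path_weight (beta * mesh T n) n.+1 (fun i => X (i%:R * mesh T n) w))%:E)%E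
    @[n --> \oo] --> (\int[P]_w (continuum_weight w)%:E)%E /\
  (\int[P]_w (continuum_weight w)%:E)%E \is a fin_num.
Proof.
pose f (n : nat) (w : Omega) : \bar R :=
  (path_weight (beta * mesh T n) n.+1 (fun i => X (i%:R * mesh T n) w))%:E.
have fcvg w : [set: Omega] w -> f n w @[n --> \oo] --> (continuum_weight w)%:E.
  move=> _; apply: cvg_EFin; first exact: nearW.
  exact: path_weight_cvg.
have i1 : P.-integrable setT (cst (expR (beta * T))%:E) by exact: finite_measure_integrable_cst.
have fb n w : [set: Omega] w -> (`|f n w| <= (expR (beta * T))%:E)%E.
  move=> _; rewrite lee_fin ger0_norm ?path_weight_mesh_le// path_weight_ge0//.
  by rewrite mulr_ge0// ltW// mesh_gt0.
have mcw : measurable_fun setT (fun w => (continuum_weight w)%:E).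
  exact: (@emeasurable_fun_cvg _ _ _ _ f _ mX fcvg).
split.
  exact: (@dominated_cvg _ _ _ P setT measurableT f _ (cst (expR (beta * T))%:E) mX fcvg).
apply: integrable_fin_num => //; apply: le_integrable i1 => // w _.
rewrite /= lee_fin ger0_norm; last by rewrite mulr_ge0 ?expR_ge0.
rewrite ger0_norm ?expR_ge0//.
have := fcvg w I => /fine_cvg /=; set a := fine \o _ => ha.
rewrite -(cvg_lim (@Rhausdorff R) ha); apply: limr_le; first by apply/cvg_ex; exists (continuum_weight w).
apply: nearW => n; exact: path_weight_mesh_le.
Qed.

End partition_limit.

(** * Tail bounds from a change of measure, and their passage to the limit *)

Section tail_bound.
Context {R : realType} {d2 : measure_display} {Omega2 : measurableType d2}.
Variable P2 : probability Omega2 R.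
Local Open Scope ereal_scope.

(* On the event, [2 r <= lambda F Z / z + 1 / (lambda F)] by the
   arithmetic-geometric inequality. *)
Lemma change_of_measure_bound (F : Omega2 -> R) (Z : Omega2 -> \bar R) (z r lambda e1 e2 : R) :
  (forall w, 0 < F w)%R -> (forall w, 0 <= Z w) -> measurable_fun setT Z -> measurable_fun setT F ->
  measurable_fun setT (fun w => (F w)^-1)%R -> (0 < z)%R -> (0 < r)%R -> (0 < lambda)%R ->
  \int[P2]_w ((F w)%:E * Z w) <= (e1 * z)%:E -> \int[P2]_w ((F w)^-1)%:E <= e2%:E ->
  P2 [set w | (r ^+ 2 * z)%:E <= Z w] <= ((lambda * e1 + lambda^-1 * e2) / (2 * r))%:E.
Proof.
move=> F0 Z0 mZ mF mFV z0 r0 l0 h1 h2.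
set A := [set w | _].
have mA : measurable A.
  by have := emeasurable_fun_c_infty measurableT mZ (r ^+ 2 * z)%:E; rewrite setTI.
have mF' : measurable_fun setT (fun w => (F w)%:E) by exact/measurable_EFinP.
have mFi : measurable_fun setT (fun w => ((F w)^-1)%:E).
  exact/measurable_EFinP.
have r20 : (0 < 2 * r)%R by rewrite mulr_gt0.
have lz : (0 <= lambda / z)%R by rewrite divr_ge0 ?ltW.
have l1 : (0 <= lambda^-1)%R by rewrite invr_ge0 ltW.
have pt w : ((2 * r)%:E * (\1_A w)%:E <= (lambda / z)%:E * ((F w)%:E * Z w) + (lambda^-1)%:E * ((F w)^-1)%:E).
  have Fw := F0 w; have Fi : (0 < (F w)^-1)%R by rewrite invr_gt0.
  have pos : 0 <= (lambda / z)%:E * ((F w)%:E * Z w) + (lambda^-1)%:E * ((F w)^-1)%:E.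
    by rewrite adde_ge0// !mule_ge0// lee_fin ltW.
  rewrite indicE; case: (boolP (w \in A)) => [|_]; last by rewrite mule0.
  rewrite inE /A/= => Aw; rewrite mule1.
  apply: (@le_trans _ _ ((lambda / z * (F w * (r ^+ 2 * z)) + lambda^-1 * (F w)^-1)%:E)).
    rewrite lee_fin -subr_ge0.
    rewrite [leRHS](_ : _ = (lambda * r * F w - 1) ^+ 2 * (lambda^-1 * (F w)^-1))%R.
      by rewrite mulr_ge0 ?sqr_ge0// mulr_ge0// ltW.
    by field; rewrite !gt_eqF.
  rewrite EFinD !EFinM; apply: leeD => //; apply: lee_wpmul2l => //.
  by apply: lee_wpmul2l; rewrite // lee_fin ltW.
have key : (2 * r)%:E * P2 A <= (lambda * e1 + lambda^-1 * e2)%:E.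
  apply: (@le_trans _ _ (\int[P2]_w ((lambda / z)%:E * ((F w)%:E * Z w) + (lambda^-1)%:E * ((F w)^-1)%:E))).
    rewrite -[A in P2 A]setIT -(integral_indic P2 measurableT mA) -ge0_integralZl//.
    - apply: ge0_le_integral => //.
      + by move=> w _; rewrite mule_ge0// lee_fin ltW.
      + apply: emeasurable_funM => //; apply/measurable_EFinP; exact: measurable_indic.
      + apply: emeasurable_funD; first by apply: emeasurable_funM => //; exact: emeasurable_funM.
        exact: emeasurable_funM.
    - by apply/measurable_EFinP; exact: measurable_indic.
    - by rewrite lee_fin ltW.
  rewrite ge0_integralD//.
  - rewrite !ge0_integralZl//.
    + rewrite EFinD; apply: leeD.
        apply: le_trans (lee_wpmul2l _ h1) _ => //.
        by rewrite -EFinM lee_fin; rewrite le_eqVlt; apply/orP; left; apply/eqP; field; rewrite gt_eqF.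
      by apply: le_trans (lee_wpmul2l _ h2) _.
    + by move=> w _; rewrite lee_fin invr_ge0 ltW.
    + exact: emeasurable_funM.
    + by move=> w _; rewrite mule_ge0// lee_fin ltW.
  - by move=> w _; rewrite !mule_ge0// lee_fin ltW.
  - by apply: emeasurable_funM => //; exact: emeasurable_funM.
  - by move=> w _; rewrite mule_ge0// lee_fin invr_ge0 ltW.
  - exact: emeasurable_funM.
have Pf : P2 A \is a fin_num by exact: fin_num_measure.
move: key; rewrite -(fineK Pf) -EFinM !lee_fin => key.
by rewrite ler_pdivlMr// mulrC.
Qed.

(* The event [{s z <= Z}] is contained in the lower limit of the events
   [{s / 4 * z_n <= Z_n}]. *)
Lemma limit_event_bound (Zn : nat -> Omega2 -> \bar R) (Z : Omega2 -> R) (zn : nat -> R)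
    (z s b : R) :
  (forall n, measurable_fun setT (Zn n)) -> (forall w, Zn n w @[n --> \oo] --> (Z w)%:E) ->
  zn n @[n --> \oo] --> z -> (0 < z)%R -> (0 < s)%R ->
  (\forall n \near \oo, P2 [set w | (s / 4 * zn n)%:E <= Zn n w] <= b%:E) ->
  P2 [set w | (s <= Z w / z)%R] <= b%:E.
Proof.
move=> mZn cZ cz z0 s0 [m0 _ hm0].
pose A n := [set w | (s / 4 * zn n)%:E <= Zn n w].
have mA n : measurable (A n).
  by have := emeasurable_fun_c_infty measurableT (mZn n) (s / 4 * zn n)%:E; rewrite setTI.
pose B m := \bigcap_(n in [set n | (m <= n)%N]) A n.
have mB m : measurable (B m) by apply: bigcap_measurableType.
have PB m : P2 (B m) <= b%:E.
  apply: (@le_trans _ _ (P2 (A (maxn m m0)))); last by apply: hm0; rewrite /= leq_maxr.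
  by apply: le_measure; rewrite ?inE//; apply: bigcap_inf; rewrite /= leq_maxl.
have mZ : measurable_fun setT (fun w => (Z w)%:E).
  by apply: (@emeasurable_fun_cvg _ _ _ _ Zn) => // w _; exact: cZ.
set A0 := [set w | _].
have mA0 : measurable A0.
  have := emeasurable_fun_c_infty measurableT mZ (s * z)%:E; rewrite setTI.
  by congr measurable; apply: eq_set => w; rewrite lee_fin ler_pdivlMr.
have sub : A0 `<=` \bigcup_m B m.
  move=> w; rewrite /A0/= ler_pdivlMr// => sz.
  (* The factor [4] leaves room: eventually [s / 4 * zn n] lies below [s / 2 * z] and [Zn n w] above
     it. *)
  have zp : (s / 4 * z < s / 2 * z)%R by rewrite ltr_pM2r// ltr_pM2l// ltf_pV2 ?posrE ?ltr_nat.
  have Zp : (s / 2 * z < Z w)%R.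
    by apply: lt_le_trans sz; rewrite ltr_pM2r// ltr_pdivrMr// ltr_pMr// ltr1n.
  have c1 : (s / 4 * zn n)%R @[n --> \oo] --> (s / 4 * z)%R by apply: cvgM => //; exact: cvg_cst.
  have /fine_cvgP[fZ c2] := cZ w.
  have n1 := cvgr_lt _ c1 _ zp; have n2 := cvgr_gt _ c2 _ Zp.
  have : \forall n \near \oo, A n w.
    near=> n; rewrite /A/= -(fineK (_ : Zn n w \is a fin_num)); last by near: n.
    rewrite lee_fin; apply/ltW/(@lt_trans _ _ (s / 2 * z)%R).
      by near: n; exact: n1.
    by near: n; exact: n2.
  by move=> [m _ hm]; exists m => // n mn; exact: hm.
apply: (@le_trans _ _ (P2 (\bigcup_m B m))).
  by apply: le_measure; rewrite ?inE//; apply: bigcup_measurable.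
have cB : P2 (B m) @[m --> \oo] --> P2 (\bigcup_m B m).
  apply: nondecreasing_cvg_mu => //; first by apply: bigcup_measurable.
  move=> i j ij; apply/subsetPset => w h n /= jn; apply: h; exact: leq_trans jn.
rewrite -(cvg_lim (@ereal_hausdorff R) cB); apply: lime_le.
  by apply/cvg_ex; exists (P2 (\bigcup_m B m)).
by apply: nearW.
Unshelve. all: by end_near. Qed.

End tail_bound.

Lemma walk_right_constant (R : realType) (d : measure_display) (Omega : measurableType d)
    (P : probability Omega R) N xi w : rate1_poisson_counter P N -> right_constant (fun t => walk N xi t w).
Proof.
move=> NP; have h : right_constant (fun t => N t w).
  by apply: right_constant_near => t t0; apply: (counter_rcont NP).
move=> t t0; have [e e0 he] := h t t0; exists e => // s ts se.
by rewrite /walk he.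
Qed.

(** Only paths without reward are kept. The bound depends on the total time alone, so it survives
    the mesh limit and keeps the homogeneous partition function positive. *)
Lemma return_le_pinned (R : realType) (gamma : R) (J : int -> R) (JK : jump_kernel gamma J)
    (theta h : R) n : 0 <= theta -> 0 <= h ->
  ((return_prob JK (n%:R * h))%:E <= pinned theta (fun=> heat JK h) n 0%R)%E.
Proof.
move=> t0 h0; rewrite pinned_sum nnfunDE prodr_const_nat subn0 heatX// return_probE ?mulr_ge0//.
by rewrite leeDl// nnfun_ge0.
Qed.

(** * The ratio of partition functions at a fixed time *)

Section ratio.
Context {R : realType}.
Variables (gamma : R) (J : int -> R).
Hypotheses (g23 : 2 / 3 < gamma) (g1 : gamma < 1).
Hypothesis JK : jump_kernel gamma J.
Hypothesis Jeq : equiv_at_infinity J (fun x => absr x `^ (- (1 + gamma))).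
Local Notation beta := (total_occupation JK)^-1.

Lemma ratio_tail_bound : exists2 c : R, 0 < c &
  forall rho : R, 0 < rho -> rho < 1 -> exists B : R,
  forall (d d1 d2 : measure_display)
    (Omega : measurableType d) (Omega1 : measurableType d1) (Omega2 : measurableType d2)
    (P : probability Omega R) (P1 : probability Omega1 R) (P2 : probability Omega2 R)
    N xi N1 xi1 N2 xi2,
  rate1_poisson_counter P N -> steps_with_law P J xi -> independent_increments_steps P N xi ->
  rate1_poisson_counter P1 N1 -> steps_with_law P1 J xi1 -> independent_increments_steps P1 N1 xi1 ->
  rate1_poisson_counter P2 N2 -> steps_with_law P2 J xi2 -> independent_increments_steps P2 N2 xi2 ->
  forall T : R, 1 <= T ->
  (P2 [set w2 | (T `^ (- (c * rho)) <=
     fine (\int[P1]_w1 (continuum_weight T beta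
        (fun t w => walk_difference N1 xi1 N2 xi2 rho t (w, w2)) w1)%:E)%E /
     fine (\int[P]_w (continuum_weight T beta (walk N xi) w)%:E)%E)%R] <=
   (B * T `^ (- (c * rho / 2)))%:E)%E.
Proof.
have [_ [_ [_ [_ [I0 _ _ _ _]]]]] := heat_renewal g23 g1 JK Jeq.
have [H [c0 [C [L [H1 c00 C0 L0 [tailC decay]]]]]] := tilted_pinned_decay g23 g1 JK Jeq.
have b0 : 0 < beta by rewrite invr_gt0.
(* The tilted mean decays with exponent [c0 * kappa * rho], and the inverse moment grows with
   exponent at most [2 * C * kappa ^ 2 * rho]; this choice makes the second at most half of the
   first. *)
pose kappa : R := Num.min 1 (c0 / (4 * C)).
have k0 : 0 < kappa by rewrite lt_min ltr01 divr_gt0// mulr_gt0.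
have k1 : kappa <= 1 by rewrite ge_min lexx.
have kC : 4 * C * kappa <= c0.
  by rewrite mulrC -ler_pdivlMr ?mulr_gt0// ge_min lexx orbT.
clearbody kappa.
exists (c0 * kappa / 4); first by rewrite divr_gt0// mulr_gt0.
set c := c0 * kappa / 4.
move=> rho r0 r1; have [D D0 dec] := decay kappa rho k0 k1 r0 (ltW r1).
exists (D + 1) => d d1 d2 Omega Omega1 Omega2 P P1 P2 N xi N1 xi1 N2 xi2.
move=> NP xiJ NxiI NP1 xiJ1 NxiI1 NP2 xiJ2 NxiI2 T T1.
have T0 : 0 < T := lt_le_trans ltr01 T1.
have m0 n : 0 < mesh T n := mesh_gt0 T0 n.
have th0 n : 0 <= beta * mesh T n by rewrite mulr_ge0// ltW.
pose Zn (n : nat) (w2 : Omega2) := (\int[P1]_w1 (path_weight (beta * mesh T n) n.+1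
  (fun i => walk_difference N1 xi1 N2 xi2 rho (i%:R * mesh T n) (w1, w2)))%:E)%E.
have mW n := measurable_path_weight NP1 xiJ1 NP2 xiJ2 (beta * mesh T n) r0 r1 (m0 n) n.+1.
have mZn n : measurable_fun setT (Zn n).
  have nonneg (w : Omega1 * Omega2) : (0 <= (path_weight (beta * mesh T n) n.+1
      (fun i => walk_difference N1 xi1 N2 xi2 rho (i%:R * mesh T n) w))%:E)%E.
    by rewrite lee_fin path_weight_ge0.
  exact: (measurable_fun_fubini_tonelli_G (m1 := P1) _ (mW n) nonneg).
have Zlim w2 : [/\ Zn n w2 @[n --> \oo] --> (\int[P1]_w1 (continuum_weight T beta
      (fun t w => walk_difference N1 xi1 N2 xi2 rho t (w, w2)) w1)%:E)%E &
    (\int[P1]_w1 (continuum_weight T beta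
      (fun t w => walk_difference N1 xi1 N2 xi2 rho t (w, w2)) w1)%:E)%E \is a fin_num].
  have [] := @partition_cvg _ _ _ P1 T beta
    (fun t w => walk_difference N1 xi1 N2 xi2 rho t (w, w2)) T0 (ltW b0) _ _ => //.
    move=> w1; rewrite /walk_difference.
    apply: (right_constant2 (fun a b : int => a - b)).
      apply: (right_constant_scale (x := fun t => walk N1 xi1 t w1)); first by rewrite subr_gt0.
      exact: walk_right_constant NP1.
    apply: (right_constant_scale (x := fun t => walk N2 xi2 t w2)) => //.
    exact: walk_right_constant NP2.
  by move=> n; exact: measurableT_comp (mW n) (measurable_pair2 w2).
pose zn (n : nat) : R := fine (pinned (beta * mesh T n) (fun=> heat JK (mesh T n)) n.+1 0).
have hom n := homogeneous_expectation JK NP xiJ NxiI (th0 n) (m0 n) n.+1.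
have [zlim zfin] := @partition_cvg _ _ _ P T beta (walk N xi) T0 (ltW b0)
  (fun w => walk_right_constant xi w NP)
  (fun n => measurable_walk_path_weight NP xiJ (beta * mesh T n) (m0 n) n.+1).
set z := fine _; rewrite -/z.
have zE n : pinned (beta * mesh T n) (fun=> heat JK (mesh T n)) n.+1 0 = (zn n)%:E.
  rewrite /zn fineK// -hom ge0_fin_numE; last first.
    by apply: integral_ge0 => w _; rewrite lee_fin path_weight_ge0.
  apply: (@le_lt_trans _ _ (\int[P]_w (expR (beta * T))%:E)%E); last first.
    by rewrite integral_cst//= probability_setT mule1 ltry.
  apply: ge0_le_integral => //.
  - by move=> w _; rewrite lee_fin path_weight_ge0.
  - exact: (measurable_walk_path_weight NP xiJ (beta * mesh T n) (m0 n) n.+1).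
  - by move=> w _; rewrite lee_fin path_weight_mesh_le// ltW.
have pz n : return_prob JK T <= zn n.
  have h := return_le_pinned JK n.+1 (th0 n) (ltW (m0 n)).
  by rewrite mesh_total zE lee_fin in h.
have pT : 0 < return_prob JK T := lt_le_trans (expR_gt0 _) (return_prob_ge_exp JK (ltW T0)).
have cz : zn n @[n --> \oo] --> z.
  have e n : zn n = fine (\int[P]_w (path_weight (beta * mesh T n) n.+1 (fun i => walk N xi (i%:R * mesh T n) w))%:E)%E.
    by rewrite hom.
  under eq_cvg do rewrite e.
  by rewrite -(fineK zfin) in zlim; exact: (fine_cvg zlim).
have z0 : 0 < z.
  apply: (lt_le_trans pT); rewrite -(cvg_lim (@Rhausdorff R) cz); apply: limr_ge.
    by apply/cvg_ex; exists z.
  exact: nearW.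
have s0 : 0 < T `^ (- (c * rho)) by rewrite powR_gt0.
apply: (limit_event_bound mZn _ cz z0 s0).
  by move=> w2; have [h f] := Zlim w2; rewrite fineK.
(* The renewal lower bound at time [T] looks ahead to time [L * T], so the horizon has to extend
   that far. *)
pose S := L%:R * T.
have S0 : 0 < S by rewrite mulr_gt0// ltr0n.
near=> n.
have d4 : mesh T n <= 4^-1 by apply: ltW; near: n; apply: mesh_small; rewrite // invr_gt0.
have dS : mesh T n <= S `^ (- (gamma^-1 - 1)).
  by apply: ltW; near: n; apply: mesh_small; rewrite // powR_gt0.
have nS : (n.+1 * L)%:R * mesh T n <= S by rewrite natrM mulrAC mesh_total mulrC.
have := dec (mesh T n) S (m0 n) d4 S0 dS n.+1 isT nS.
rewrite zE mesh_total -EFinM.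
rewrite -(tilted_expectation JK NP1 xiJ1 NxiI1 NP2 xiJ2 NxiI2 r0 r1 (m0 n) (th0 n) H n.+1 k0) => h1.
have n1 : 1 <= n.+1%:R * mesh T n by rewrite mesh_total.
have := inverse_tilt_expectation NP2 xiJ2 NxiI2 r0 (m0 n) k0 C0 (fun l => tailC _ l (m0 n)) n1.
rewrite mesh_total => h2.
pose F (w2 : Omega2) : R := \prod_(i < n.+1) tilt_density JK H kappa rho (mesh T n) i
  (jumps N2 xi2 (rho * mesh T n) i w2).
have F0 w : 0 < F w by rewrite prodr_gt0// => i _; exact: tilt_density_gt0.
(* This is [r], half of the square root of the threshold: [r ^ 2 = T ^ (- (c * rho)) / 4] provides
   the factor [4] demanded by [limit_event_bound]. *)
have rT : 0 < 2^-1 * T `^ (- (c * rho / 2)) by rewrite mulr_gt0 ?invr_gt0// powR_gt0.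
(* This is [lambda]. Since [c0 * kappa = 4 * c], the two moments have exponents [- 4 c rho] and at
   most [2 c rho]; multiplying and dividing by [T ^ (3 c rho)] makes both terms at most a constant
   times [T ^ (- c rho)], and division by [2 r] leaves [T ^ (- c rho / 2)]. *)
have lT : 0 < T `^ (3 * c * rho) by rewrite powR_gt0.
have hr : 0 < rho * mesh T n by rewrite mulr_gt0.
have mprod (g : nat -> seq int -> R) : measurable_fun setT
    (fun w => \prod_(i < n.+1) g i (jumps N2 xi2 (rho * mesh T n) i w)).
  apply/measurable_EFinP; apply: (eq_measurable_fun (fun w =>
    (fun s : seq (seq int) => (trace_prod g s)%:E) (rtrace (jumps N2 xi2 (rho * mesh T n)) n.+1 w))).
    by move=> w _; rewrite trace_prodE.
  exact: (measurable_fun_countable (measurable_rtrace (measurable_jumps NP2 xiJ2 hr) n.+1)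
    (fun s : seq (seq int) => (trace_prod g s)%:E)).
have mF : measurable_fun setT F by exact: mprod.
have mFV : measurable_fun setT (fun w => (F w)^-1).
  by rewrite /F; under eq_fun do rewrite -prodfV; exact: (mprod (fun i s => (tilt_density JK H kappa rho (mesh T n) i s)^-1)).
have Zn0 w : (0 <= Zn n w)%E by apply: integral_ge0 => w1 _; rewrite lee_fin path_weight_ge0.
have := change_of_measure_bound F0 Zn0 (mZn n) mF mFV (lt_le_trans pT (pz n)) rT lT h1 h2.
have x0 : 0 < T `^ (- (c * rho / 2)) by rewrite powR_gt0.
have xx : T `^ (- (c * rho)) = T `^ (- (c * rho / 2)) ^+ 2.
  by rewrite -powR_mulrn ?powR_ge0// -powRrM mulNr divfK.
have -> : (2^-1 * T `^ (- (c * rho / 2))) ^+ 2 = T `^ (- (c * rho)) / 4.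
  by rewrite xx; field.
move=> /le_trans; apply; rewrite lee_fin.
have -> : 2 * (2^-1 * T `^ (- (c * rho / 2))) = T `^ (- (c * rho / 2)) by field.
rewrite ler_pdivrMr// -[leRHS]mulrA -expr2 -xx [leRHS]mulrDl mul1r.
apply: lerD.
  rewrite mulrCA -powRDp// le_eqVlt; apply/orP; left; apply/eqP.
  by congr (_ * _ `^ _); rewrite /c; field.
rewrite -powRN -powRDp//; apply: ler_powR => //.
have -> : - (c * rho) = - (3 * c * rho) + c0 * kappa * rho / 2 by rewrite /c; field.
rewrite lerD2l.
have := ler_wpM2r (mulr_ge0 (ltW k0) (ltW r0)) kC; rewrite expr2; lra.
Unshelve. all: by end_near. Qed.

End ratio.

Lemma powRN_cvg0 (R : realType) (e B : R) : 0 < e -> (B * T `^ (- e))%:E @[T --> +oo] --> (0 : \bar R)%E.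
Proof.
move=> e0; apply: cvg_EFin; first exact: nearW.
rewrite -[X in _ --> X](mulr0 B); apply: cvgM; first exact: cvg_cst.
apply/cvgrPdist_lt => eps eps0; near=> T.
have M0 : 0 < eps^-1 `^ e^-1 by rewrite powR_gt0 ?invr_gt0.
have MT : eps^-1 `^ e^-1 < T by near: T; exact: nbhs_pinfty_gt.
have T0 : 0 < T := lt_trans M0 MT.
rewrite sub0r normrN ger0_norm ?powR_ge0// powRN invf_plt ?posrE ?powR_gt0//.
have -> : eps^-1 = (eps^-1 `^ e^-1) `^ e.
  by rewrite -powRrM mulVf ?gt_eqF// powRr1// invr_ge0 ltW.
by apply: gt0_ltr_powR; rewrite // nnegrE ltW.
Unshelve. all: by end_near. Qed.

Lemma pinned_partition_functionE (R : realType) (d : measure_display) (Omega : measurableType d)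
    (P : probability Omega R) (beta T : R) (X D : R -> Omega -> int) (y : R -> int) :
  0 <= T -> (forall t w, 0 <= t -> X t w - y t = D t w) ->
  pinned_partition_function P beta T X y =
  beta * fine (\int[P]_w (continuum_weight T beta D w)%:E)%E.
Proof.
move=> T0 XD; rewrite /pinned_partition_function unlock; congr (_ * fine _).
apply: eq_integral => w _; rewrite /continuum_weight /= -XD// subr_eq0; congr ((expR (_ * _) * _)%:E).
rewrite /overlap; apply: eq_Rintegral => t; rewrite inE/= in_itv/= => /andP[t0 _].
by rewrite -XD// subr_eq0.
Qed.

Theorem proposition1p7 (R : realType) (gamma : R) (J : int -> R) :
  2 / 3 < gamma -> gamma < 1 ->
  jump_kernel gamma J ->
  equiv_at_infinity J (fun x => absr x `^ (- (1 + gamma))) ->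
  exists2 c : R, 0 < c &
    forall rho : R, 0 < rho -> rho < 1 ->
    forall (d d1 d2 : measure_display)
      (Omega : measurableType d) (Omega1 : measurableType d1)
      (Omega2 : measurableType d2)
      (P : probability Omega R) (P1 : probability Omega1 R)
      (P2 : probability Omega2 R)
      (W : R -> Omega -> int) (W1 : R -> Omega1 -> int)
      (W2 : R -> Omega2 -> int),
    random_walk P J W -> random_walk P1 J W1 -> random_walk P2 J W2 ->
    let X t := W1 ((1 - rho) * t) in
    let Y t := W2 (rho * t) in
    let b0 := beta0 P W in
    P2 [set w2 | T `^ (- (c * rho)) <=
                 pinned_partition_function P1 b0 T X (Y ^~ w2) /
                 homogeneous_partition_function P b0 T W]
      @[T --> +oo] --> (0 : \bar R)%E.
Proof.
move=> g23 g1 JK Jeq; have [c c0 bound] := ratio_tail_bound g23 g1 JK Jeq.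
have [_ [_ [_ [_ [I0 _ _ _ _]]]]] := heat_renewal g23 g1 JK Jeq.
exists c => // rho r0 r1 d d1 d2 Omega Omega1 Omega2 P P1 P2 W W1 W2.
move=> [N [xi [NP xiJ NxiI WE]]] [N1 [xi1 [NP1 xiJ1 NxiI1 W1E]]] [N2 [xi2 [NP2 xiJ2 NxiI2 W2E]]] X Y b0.
have [B {}bound] := bound rho r0 r1.
(* [beta0] depends on [W] only through its return probabilities, which [walk_law] identifies with
   the heat kernel. *)
have b0E : b0 = (total_occupation JK)^-1.
  rewrite /b0 /beta0 /total_occupation; congr (_^-1).
  apply: eq_Rintegral => t; rewrite inE/= in_itv/= andbT => t0.
  rewrite /return_prob -(walk_law JK NP xiJ NxiI t0); congr (fine (P _)).
  by apply: eq_set => w; rewrite WE.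
have bneq0 : b0 != 0 by rewrite b0E invr_eq0 gt_eqF.
apply: (@squeeze_cvge _ _ _ _ (cst 0%E) _ (fun T => (B * T `^ (- (c * rho / 2)))%:E)).
- near=> T; have T1 : 1 <= T by near: T; exact: nbhs_pinfty_ge.
  have T0 : 0 <= T := le_trans ler01 T1.
  rewrite measure_ge0/=.
  apply: le_trans (bound _ _ _ _ _ _ P P1 P2 _ _ _ _ _ _ NP xiJ NxiI NP1 xiJ1 NxiI1 NP2 xiJ2 NxiI2 T T1).
  rewrite le_eqVlt; apply/orP; left; apply/eqP; congr (P2 _); apply: eq_set => w2.
  rewrite (pinned_partition_functionE _ _ T0 (D := fun t w => walk_difference N1 xi1 N2 xi2 rho t (w, w2))); last first.
    move=> t w t0; rewrite /X /Y W1E ?W2E ?mulr_ge0 ?subr_ge0 ?(ltW r0) ?(ltW r1)//.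
  rewrite /homogeneous_partition_function (pinned_partition_functionE _ _ T0 (D := walk N xi)); last first.
    by move=> t w t0; rewrite subr0 WE.
  by rewrite -mulf_div mulfV// mul1r b0E.
- exact: cvg_cst.
- by apply: powRN_cvg0; rewrite divr_gt0// mulr_gt0.
Unshelve. all: by end_near. Qed.
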